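(* Let $n\ge 9$. Let $$s_1(n)=\left\lfloor\frac{n^2}{18}-\frac{20n}{27}+\frac{287}{81}\right\rfloor+\left\lfloor\frac{6n-13}{9}\right\rfloor$$ and let $$s_2(n)=\left\lceil\frac{n^2}{18}-\frac{11n}{27}+\frac{44}{81}\right\rceil+\left\lceil\frac{6n-13}{9}\right\rceil.$$ Then $\sigma_s(Gr(2,n))$ has the expected dimension whenever $s\le s_1(n)$ and whenever $s\ge s_2(n)$ (and in this second case $\sigma_s(Gr(2,n))$ fills the ambient space $\mathbb{P}(\wedge^3\mathbb{C}^{n+1})$).
   Context: $Gr(2,n)$ is the Grassmannian of projective planes in $\mathbb{P}^n$ (over $\mathbb{C}$), i.e. of $3$-dimensional linear subspaces of $\mathbb{C}^{n+1}$, embedded by the Plücker embedding in $\mathbb{P}^N=\mathbb{P}(\wedge^3\mathbb{C}^{n+1})$, $N=\binom{n+1}{3}-1$; it has dimension $3(n-2)$. For $s\ge1$ and a projective variety $X\subset\mathbb{P}^N$, $\sigma_s(X)$ is the Zariski closure of the union of the linear spans of $s$-tuples of points of $X$. One says $\sigma_s(Gr(2,n))$ has the expected dimension if $$\dim\sigma_s(Gr(2,n))=\min\Big\{s(3n-5)-1,\ \binom{n+1}{3}-1\Big\}.$$ *)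

(* Defs.v *)
From mathcomp Require Import all_boot all_order all_algebra.
From mathcomp Require Import classical_sets.
From mathcomp Require Import mpoly.

Set Implicit Arguments.
Unset Strict Implicit.
Unset Printing Implicit Defensive.

Import Order.TTheory GRing.Theory Num.Theory.

Local Open Scope ring_scope.
Local Open Scope classical_set_scope.

(* P(K^m): the points are the lines (one-dimensional subspaces) of K^m. *)
Definition pspace (K : fieldType) (m : nat) : Type :=
  {L : {vspace 'rV[K]_m} | \dim L == 1%N}.

Section Zariski.
Variables (K : fieldType) (m : nat).
Implicit Types (L : pspace K m) (p : {mpoly K[m]}) (X Y Z : set (pspace K m)).

Definition pvanish p L : Prop :=
  forall v : 'rV[K]_m, v \in val L -> p.@[fun i => v 0 i] = 0.

Definition homogeneous p : Prop := exists d : nat, p \is d.-homog.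

Definition zariski_closed Z : Prop :=
  exists2 I : set {mpoly K[m]}, I `<=` homogeneous &
    Z = [set L | forall p, I p -> pvanish p L].

Definition zariski_closure X : set (pspace K m) := smallest zariski_closed X.

Definition irreducible Z : Prop :=
  Z !=set0 /\
  forall X Y, zariski_closed X -> zariski_closed Y ->
    Z `<=` X `|` Y -> Z `<=` X \/ Z `<=` Y.

Definition irreducible_chain X (d : nat) : Prop :=
  exists Z : 'I_d.+1 -> set (pspace K m),
    [/\ forall i, [/\ zariski_closed (Z i), irreducible (Z i) & Z i `<=` X]
      & forall i j : 'I_d.+1, (i < j)%N -> Z i `<` Z j].

(* Krull dimension of a Zariski closed set X. *)
Definition has_dim X (d : nat) : Prop :=
  irreducible_chain X d /\
  forall e : nat, irreducible_chain X e -> (e <= d)%N.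

(* Points lying in the projective span of s points of X, which need be neither
   distinct nor independent. *)
Definition spanned (s : nat) X : set (pspace K m) :=
  [set L | exists2 x : 'I_s -> pspace K m,
     forall i, X (x i) & (val L <= \sum_(i < s) val (x i))%VS].

Definition secant (s : nat) X : set (pspace K m) :=
  zariski_closure (spanned s X).

End Zariski.

(* The increasing r-tuples t of indices below k index the standard basis
   e_{t 0} /\ ... /\ e_{t (r-1)} of wedge^r K^k, which is thus identified with
   K^(extdim k r). *)
Definition extbasis (k r : nat) : {set r.-tuple 'I_k} :=
  [set t : r.-tuple 'I_k | sorted ltn [seq val i | i <- t]]%SET.

Definition extdim (k r : nat) : nat := #|extbasis k r|.

Lemma extdimE (k r : nat) : extdim k r = 'C(k, r).
Proof. exact: card_ltn_sorted_tuples. Qed.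

(* The coordinates of the wedge product of the rows of M: its maximal minors. *)
Definition wedge (K : fieldType) (k r : nat) (M : 'M[K]_(r, k)) :
    'rV[K]_(extdim k r) :=
  \row_j \det (colsub (tnth (enum_val j : r.-tuple 'I_k)) M).

(* The line spanned by w_0 /\ ... /\ w_(r-1), for (w_i) a basis of W; it does
   not depend on the basis. Meaningful for \dim W = r. *)
Definition plucker (K : fieldType) (k r : nat) (W : {vspace 'rV[K]_k}) :
    {vspace 'rV[K]_(extdim k r)} :=
  <[wedge (\matrix_(i < r) (vbasis W)`_i)]>%VS.

(* Gr r k consists of the projective r-planes in P^k, i.e. of the
   (r+1)-dimensional subspaces of K^(k+1), in its Plücker embedding. *)
Definition Gr (K : fieldType) (r k : nat) : set (pspace K (extdim k.+1 r.+1)) :=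
  [set L | exists2 W : {vspace 'rV[K]_k.+1},
     \dim W = r.+1 & val L = plucker r.+1 W].
Arguments Gr K r k : clear implicits.

Definition expected_dim (s n : nat) : nat :=
  minn (s * (3 * n - 5) - 1) ('C(n.+1, 3) - 1).

Definition s1 (n : nat) : int :=
  Num.floor (n%:R ^+ 2 / 18 - 20 * n%:R / 27 + 287 / 81 : rat)
  + Num.floor ((6 * n%:R - 13) / 9 : rat).

Definition s2 (n : nat) : int :=
  Num.ceil (n%:R ^+ 2 / 18 - 11 * n%:R / 27 + 44 / 81 : rat)
  + Num.ceil ((6 * n%:R - 13) / 9 : rat).

(* Main.v *)
Require Import Defs.
From HB Require Import structures.
From mathcomp Require Import all_boot all_order all_algebra.
From mathcomp Require Import boolp classical_sets reals complex.
From mathcomp Require Import mpoly ring zify.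

(** A point of the cone over the Grassmannian of planes in P(K^N) is a product
    p = p_0 /\ p_1 /\ p_2 of three vectors, and the cone over the s-th secant
    variety is the closure of the image of
      phi (p^1, ..., p^s) = p^1 + ... + p^s.
    Its dimension is the rank of the differential of phi at a general
    configuration (p^1, ..., p^s).  As a minor of the Jacobian matrix that is
    nonzero at one configuration is nonzero at a general one, the theorem reduces
    to exhibiting configurations with a minor of order s (3 N - 8), the largest
    possible when the tangent spaces of the s points are independent, or of order
    'C(N, 3), when they span.  This condition is [generic_rank_ge K N s r].

    Construction of the minors.  A configuration in K^m is enlarged to one in
    K^(m + 6) = K^m + U, where K^m = F_0 + ... + F_(h-1) + Z with all F_j of
    dimension 6 and m = 6 h + z.  The a old points stay in K^m; four new points
    are put into each U + F_j and e new points into U + Z.  In the trivectors of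
    K^m the old points contribute a rank known by induction.  Modulo these
    trivectors the old points can be specialized afresh ([generic_rank_extend]):
    four go to each F_j + F_k, x to each F_j + Z and y to Z.  The remaining
    Jacobian matrix is then block triangular, with one block for each pair j < k
    (trivectors of U, F_j, F_k), one for each j (of U, F_j and possibly Z) and one
    for U + Z ([blocks_minor]).  Each type of block has bounded size, so that the
    existence of a good configuration is a finite problem: it is solved by 0/1
    configurations whose minors are odd, found by elimination over the field with
    two elements.  The specialization accommodates 4 'C(h, 2) + x h + y old points,
    and this produces the quadratic functions s1 and s2 ([independent_s1],
    [spanning_s2]).  Here independence passes to fewer points
    because a single point contributes at most 3 N - 8 to the rank
    ([tangent_rank]).

    From the rank to the dimension.  Let [swept psi] be the closed set cut out
    by the homogeneous polynomials that vanish on the image of psi.  A chain of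
    irreducible closed subsets of [swept psi] yields, on its affine cones, as many
    algebraically independent functions as it has members, and there cannot be
    more of these than the number M of variables of psi ([swept_dim_le]).  With
    psi the identity this bounds the dimension by that of the ambient space, and
    with psi the parametrization by multiples of reduced matrices (1 | A) it
    bounds it by s (3 N - 8) - 1.  In the other direction, r independent tangent
    vectors of phi at a configuration p, the first of them phi (p) up to a factor, give
    linear families of configurations of dimensions 1, ..., r; the closures swept
    out by them form a strictly increasing chain, since a polynomial that vanishes
    at the ends of curves through phi (p) with arbitrary velocities is zero
    ([curves_determine], [wedge_sum_chain]).  The same lemma shows that the secant
    variety is everything when r = 'C(N, 3). *)

Set Implicit Arguments.
Unset Strict Implicit.
Unset Printing Implicit Defensive.

Import Order.TTheory GRing.Theory Num.Theory.

Local Open Scope ring_scope.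

(** * Minors *)

(** A lower bound on the rank of the family of values of f, expressed by a
    witness so that it makes sense over a ring, for infinite index types, and is
    transported along maps of indices. *)
Definition has_minor (R : comNzRingType) (X Y : Type) (P : pred X) (Q : pred Y)
    (f : X -> Y -> R) (r : nat) : Prop :=
  exists x : 'I_r -> X, exists y : 'I_r -> Y,
    [/\ forall i, P (x i), forall i, Q (y i)
      & \det (\matrix_(i, j) f (x i) (y j)) != 0].

Section Minors.
Variables (R : comNzRingType) (X Y : Type).
Implicit Types (P : pred X) (Q : pred Y) (f : X -> Y -> R).

Lemma has_minor0 P Q f : has_minor P Q f 0.
Proof.
have no (T : Type) : 'I_0 -> T by case.
by exists (no X), (no Y); split=> [[]|[]|]; rewrite // det_mx00 oner_neq0.
Qed.

Lemma has_minor_map (X' Y' : Type) (P' : pred X') (Q' : pred Y')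
    (f' : X' -> Y' -> R) (a : X -> X') (b : Y -> Y') P Q f r :
    (forall x, P x -> P' (a x)) -> (forall y, Q y -> Q' (b y)) ->
    (forall x y, P x -> Q y -> f' (a x) (b y) = f x y) ->
  has_minor P Q f r -> has_minor P' Q' f' r.
Proof.
move=> aP bQ fE [x [y [xP yQ dN0]]]; exists (a \o x), (b \o y).
split=> [i|i|] /=; [exact: aP | exact: bQ |].
by congr (\det _ != 0): dN0; apply/matrixP=> i j; rewrite !mxE fE.
Qed.

End Minors.

Section BlockMinors.
Variables (R : idomainType) (X Y : Type).
Implicit Types (P : pred X) (Q : pred Y) (f : X -> Y -> R).

Lemma has_minor_block P1 P2 Q1 Q2 f r1 r2 :
    (forall x y, P1 x -> Q2 y -> f x y = 0) ->
    has_minor P1 Q1 f r1 -> has_minor P2 Q2 f r2 ->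
  has_minor (predU P1 P2) (predU Q1 Q2) f (r1 + r2).
Proof.
move=> f0 [x1 [y1 [P1x1 Q1y1 d1]]] [x2 [y2 [P2x2 Q2y2 d2]]].
pose u T (a : 'I_r1 -> T) (b : 'I_r2 -> T) (i : 'I_(r1 + r2)) :=
  match split i with inl j => a j | inr j => b j end.
exists (u X x1 x2), (u Y y1 y2).
split=> [i|i|]; rewrite /u /=; try by case: split => j; rewrite ?P1x1 ?Q1y1 ?P2x2 ?Q2y2 ?orbT.
set M := \matrix_(i, j) _.
have -> : M = block_mx (\matrix_(i, j) f (x1 i) (y1 j)) 0
    (\matrix_(i, j) f (x2 i) (y1 j)) (\matrix_(i, j) f (x2 i) (y2 j)).
  apply/matrixP=> k l; rewrite mxE -[k]splitK -[l]splitK !unsplitK.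
  case: (split k) (split l) => i' [] j' /=;
    rewrite ?block_mxEul ?block_mxEur ?block_mxEdl ?block_mxEdr !mxE //.
  exact: f0.
by rewrite det_lblock mulf_neq0.
Qed.

(** Block triangular families: the blocks may be listed in any order along
    which [lvl] does not decrease, so that blocks of one level need not be compared
    by hand. *)
Lemma has_minor_blocks (T : eqType) (lvl : T -> nat) (P : T -> pred X)
    (Q : T -> pred Y) (rho : T -> nat) (ts : seq T) f :
    uniq ts -> sorted (fun s t => lvl s <= lvl t)%N ts ->
    {in ts &, forall s t, s != t -> (lvl s <= lvl t)%N ->
       forall x y, P s x -> Q t y -> f x y = 0} ->
    {in ts, forall t, has_minor (P t) (Q t) f (rho t)} ->
  has_minor (fun x => has (P^~ x) ts) (fun y => has (Q^~ y) ts) f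
    (\sum_(t <- ts) rho t).
Proof.
elim: ts => [|s ts IHts] /= => [*|/andP[sNts Uts] s_ts f0 minor_f].
  by rewrite big_nil; apply: has_minor0.
have le_tr : transitive (fun s t => lvl s <= lvl t)%N.
  by move=> ? ? ?; apply: leq_trans.
rewrite big_cons; apply: has_minor_block.
- move=> x y Px /hasP[t t_ts Qy].
  apply: (f0 s t) Px Qy; rewrite ?inE ?eqxx ?t_ts ?orbT //.
    by apply: contraNneq sNts => ->.
  by move: s_ts => /(order_path_min le_tr)/allP; apply.
- by apply: minor_f; rewrite inE eqxx.
apply: IHts => //; first exact: path_sorted s_ts.
  by move=> t1 t2 t1s t2s; apply: f0; rewrite inE ?t1s ?t2s orbT.
by move=> t t_ts; apply: minor_f; rewrite inE t_ts orbT.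
Qed.

End BlockMinors.

Section FieldMinors.
Variables (F : fieldType).

Lemma row_free_rowsub m n k (a : 'I_k -> 'I_m) (A : 'M[F]_(m, n)) :
  injective a -> row_free A -> row_free (rowsub a A).
Proof.
move=> a_inj freeA; rewrite /row_free rowsubE mxrankMfree //.
apply/row_freeP; exists (rowsub a 1%:M)^T; apply/matrixP=> i j.
rewrite !mxE (bigD1 (a i)) //= big1 ?addr0 => [|l /negPf neq].
  by rewrite !mxE eqxx mul1r (inj_eq a_inj) eq_sym.
by rewrite !mxE [a i == l]eq_sym neq mul0r.
Qed.

Variables (X Y : Type).
Implicit Types (P : pred X) (Q : pred Y) (f : X -> Y -> F).

(** A maximal set of independent rows, and then of independent columns of
    these rows, gives a minor of the order of the rank. *)
Lemma rank_has_minor P Q f m n (x : 'I_m -> X) (y : 'I_n -> Y) r :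
    (forall i, P (x i)) -> (forall j, Q (y j)) ->
    (r <= \rank (\matrix_(i, j) f (x i) (y j)))%N ->
  has_minor P Q f r.
Proof.
move=> Px Qy; set M := \matrix_(i, j) _ => le_r.
have sub_free k l (A : 'M[F]_(k, l)) : (r <= \rank A)%N ->
    exists a : 'I_r -> 'I_k, row_free (rowsub a A).
  move=> leA; exists (maxrankfun A \o widen_ord leA).
  rewrite rowsub_comp row_free_rowsub ?maxrowsub_free //.
  by move=> i j /(congr1 val) eq_ij; apply: val_inj.
have [a Da] := sub_free _ _ _ le_r.
have [|b Db] := sub_free _ _ (rowsub a M)^T; first by rewrite mxrank_tr (eqnP Da).
exists (x \o a), (y \o b); split=> [i|i|]; rewrite ?Px ?Qy //.
rewrite -unitfE; move: Db; rewrite row_free_unit unitmxE -det_tr.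
by congr (\det _ \is a GRing.unit); apply/matrixP=> i j; rewrite !mxE.
Qed.

Lemma has_minorW P Q f r s : (s <= r)%N ->
  has_minor P Q f r -> has_minor P Q f s.
Proof.
move=> le_sr [x [y [Px Qy d]]]; apply: (rank_has_minor (x := x) (y := y)) => //.
by rewrite mxrank_unit // unitmxE unitfE.
Qed.

End FieldMinors.

(** Deleting a row lowers the rank by at most one. *)
Lemma has_minor_drop (F : fieldType) (X : eqType) (Y : Type) (P : pred X)
    (Q : pred Y) (f : X -> Y -> F) (D : seq X) r :
  has_minor P Q f r ->
  has_minor (fun x => P x && (x \notin D)) Q f (r - size D).
Proof.
move=> [x [y [Px Qy d]]]; set M := \matrix_(i, j) _ in d.
have freeM : row_free M by rewrite row_free_unit unitmxE unitfE.
have x_inj : injective x.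
  move=> i j eq_x; have: row i M = row j M by apply/rowP=> k; rewrite !mxE eq_x.
  rewrite !rowE => /(row_free_inj freeM) /matrixP/(_ 0 j)/eqP.
  by rewrite !mxE !eqxx /=; case: (j =P i) => // _; rewrite eq_sym oner_eq0.
pose S := [pred i | x i \notin D].
have le_S : (r - size D <= #|S|)%N.
  have cardS : (#|S| + #|predC S| = r)%N by rewrite cardC card_ord.
  suff le_D : (#|predC S| <= size D)%N by rewrite leq_subLR addnC; lia.
  rewrite cardE -(size_map x); apply: uniq_leq_size.
    by rewrite map_inj_uniq ?enum_uniq.
  by move=> _ /mapP[i + ->]; rewrite mem_enum !inE negbK.
pose a (i : 'I_#|S|) := enum_val i.
have a_inj : injective a by apply: enum_val_inj.
apply: (rank_has_minor (x := x \o a) (y := y)) => [i||] //=.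
  by rewrite Px /=; have := enum_valP i.
apply: leq_trans le_S _; apply: eq_leq.
rewrite -[LHS](eqnP (row_free_rowsub a_inj freeM)).
by congr (\rank _); apply/matrixP=> i j; rewrite !mxE.
Qed.

(** The minor is a polynomial in t, nonzero at t0. *)
Lemma has_minor_generic (F : fieldType) (X Y : Type) (P : pred X) (Q : pred Y)
    (f : X -> Y -> {poly F}) r t0 :
    has_minor P Q (fun x y => (f x y).[t0]) r ->
  exists2 g : {poly F}, g.[t0] != 0 &
    forall t, g.[t] != 0 -> has_minor P Q (fun x y => (f x y).[t]) r.
Proof.
move=> [x [y [Px Qy d]]]; pose M := \matrix_(i, j) f (x i) (y j).
have detE t : (\det M).[t] = \det (\matrix_(i, j) (f (x i) (y j)).[t]).
  rewrite -horner_evalE -det_map_mx; congr (\det _).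
  by apply/matrixP=> i j; rewrite !mxE.
exists (\det M) => [|t]; rewrite detE // => dt.
by exists x, y.
Qed.

(** In characteristic zero finitely many open conditions on a line that hold
    somewhere hold simultaneously. *)
Lemma exists_non_root (F : numFieldType) (gs : seq {poly F}) :
  all (fun g => g != 0) gs -> exists t, all (fun g : {poly F} => g.[t] != 0) gs.
Proof.
move=> gs_neq0; pose p := \prod_(g <- gs) g.
have p_neq0 : p != 0 by rewrite prodf_seq_neq0; apply: sub_all gs_neq0 => g ->.
have [t pt | roots] := pickP (fun i : 'I_(size p) => p.[i%:R] != 0).
  exists t%:R; move: pt; rewrite horner_prod prodf_seq_neq0.
  by apply: sub_all => g.
suff: (size [seq (i : 'I_(size p))%:R : F | i <- enum 'I_(size p)] < size p)%N.
  by rewrite size_map size_enum_ord ltnn.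
apply: max_poly_roots => //.
  by apply/allP=> _ /mapP[i _ ->]; rewrite rootE; have := roots i; case: eqP.
rewrite map_inj_uniq ?enum_uniq // => i j /eqP.
by rewrite eqr_nat => /eqP /val_inj.
Qed.

(** * The Jacobian of a sum of decomposable trivectors *)

Definition triple := (nat * nat * nat)%type.

Definition det3 (R : comNzRingType) (u v w : nat -> R) (t : triple) : R :=
  let: (i, j, k) := t in
  u i * (v j * w k - v k * w j) - u j * (v i * w k - v k * w i)
    + u k * (v i * w j - v j * w i).

Definition point (R : Type) := nat -> nat -> R.

Definition subst_unit (R : comNzRingType) (p : point R) (r l : nat) : point R :=
  fun r' i => if r' == r then (i == l)%:R else p r' i.

(** The derivative of p_0 /\ p_1 /\ p_2 in the direction that moves the vector
    p_r along e_l: the product in which e_l replaces p_r. *)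
Definition tangent (R : comNzRingType) (p : point R) (r l : nat) (t : triple) : R :=
  let q := subst_unit p r l in det3 (q 0%N) (q 1%N) (q 2) t.

Arguments det3 : simpl never.
Arguments tangent : simpl never.

Definition jacobian (R : comNzRingType) (L : Type) (pts : L -> point R)
    (x : L * nat * nat) (t : triple) : R :=
  tangent (pts x.1.1) x.1.2 x.2 t.

Arguments jacobian : simpl never.

Definition below (N : nat) : pred triple :=
  fun t => let: (i, j, k) := t in [&& i < N, j < N & k < N]%N.

(** The indices of the rows are (point, slot, coordinate). *)
Definition generic_rank_ge (R : comNzRingType) (N s r : nat) : Prop :=
  exists pts : nat -> point R,
    has_minor (fun x => [&& x.1.1 < s, x.1.2 < 3 & x.2 < N]%N) (below N)
      (jacobian pts) r.

Section Det3.
Variable R : comNzRingType.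
Implicit Types (u v w : nat -> R) (t : triple) (p : point R).

Lemma det3_eq0 u v w i t : i \in [:: t.1.1; t.1.2; t.2] ->
  u i = 0 -> v i = 0 -> w i = 0 -> det3 u v w t = 0.
Proof.
case: t => [[j k] l] /=; rewrite !inE => /or3P[]/eqP-> u0 v0 w0;
  by rewrite /det3 u0 v0 w0; ring.
Qed.

(** A minor with a column in which all its rows vanish. *)
Lemma tangent_eq0 p r l i t : i \in [:: t.1.1; t.1.2; t.2] -> i != l ->
  (forall r', (r' < 3)%N -> p r' i = 0) -> tangent p r l t = 0.
Proof.
by move=> it /negPf il p0; apply: (det3_eq0 it);
   rewrite /subst_unit il; case: ifP => // _; apply: p0.
Qed.

(** Only the coordinates in the triple matter, up to relabelling. *)
Lemma eq_tangent p p' r l t t' s :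
    (forall i, i \in [:: t.1.1; t.1.2; t.2] ->
       (s i == s l) = (i == l) /\ forall r', (r' < 3)%N -> p' r' (s i) = p r' i) ->
    t' = (s t.1.1, s t.1.2, s t.2) ->
  tangent p' r (s l) t' = tangent p r l t.
Proof.
case: t => [[i j] k] /= pE ->; rewrite /tangent /subst_unit /det3.
have /pE[-> pi] : i \in [:: i; j; k] by rewrite !inE eqxx.
have /pE[-> pj] : j \in [:: i; j; k] by rewrite !inE eqxx orbT.
have /pE[-> pk] : k \in [:: i; j; k] by rewrite !inE eqxx !orbT.
by rewrite !pi ?pj ?pk.
Qed.
End Det3.

Lemma rmorph_tangent (R S : comNzRingType) (f : {rmorphism R -> S})
    (p : point R) r l t :
  f (tangent p r l t) = tangent (fun r' i => f (p r' i)) r l t.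
Proof.
case: t => [[i j] k]; rewrite /tangent /det3 /subst_unit.
by rewrite !(rmorphD, rmorphN, rmorphM) /= !(fun_if f) !rmorph_nat.
Qed.

(** Move the first a points on the lines from a configuration in K^m that
    realizes the rank r1 to the configuration [pts1], which may have been chosen
    freely.  At a general parameter both minors survive: the first one, on the
    trivectors of K^m, and the second one, on the trivectors that involve a new
    coordinate.  The rows of the first minor, which move an old point within K^m,
    vanish on the columns of the second, as the old points stay in K^m on the
    whole line.  Hence the two minors form a triangular block matrix. *)
Lemma generic_rank_extend (K : numFieldType) m d a b r1 r2 (pts1 : nat -> point K) :
    generic_rank_ge K m a r1 ->
    (forall i r j, (i < a)%N -> (m <= j)%N -> pts1 i r j = 0) ->
    has_minor
      (fun x => [&& x.1.1 < a + b, x.1.2 < 3, x.2 < m + d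
                  & (x.1.1 < a) ==> (m <= x.2)]%N)
      (fun t => below (m + d) t && ~~ below m t) (jacobian pts1) r2 ->
  generic_rank_ge K (m + d) (a + b) (r1 + r2).
Proof.
move=> [pts0 minor0] supp1 minor1.
(* the projection to K^m, which keeps the old points in K^m along the line *)
pose tr (i r j : nat) := if (j < m)%N then pts0 i r j else 0.
(* at 0 the first minor is nonzero, at 1 the second one *)
pose line (i r j : nat) : {poly K} := if (i < a)%N
  then (tr i r j)%:P + 'X * (pts1 i r j - tr i r j)%:P else (pts1 i r j)%:P.
pose fam t (i : nat) : point K := fun r j => (line i r j).[t].
have jacE t x y : (jacobian line x y).[t] = jacobian (fam t) x y.
  by rewrite -horner_evalE /jacobian rmorph_tangent.
have fam0 i r j : (i < a)%N -> (j < m)%N -> fam 0 i r j = pts0 i r j.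
  by move=> ia jm; rewrite /fam /line /tr ia jm !(hornerE, mul0r, addr0).
have fam1 i r j : fam 1 i r j = pts1 i r j.
  rewrite /fam /line; case: ifP => _; rewrite ?hornerC //.
  by rewrite hornerD hornerM hornerX !hornerC mul1r addrC subrK.
have minor0' : has_minor (fun x => [&& x.1.1 < a, x.1.2 < 3 & x.2 < m]%N)
    (below m) (fun x y => (jacobian line x y).[0]) r1.
  apply: (has_minor_map (a := id) (b := id)) minor0 => // -[[i r] l] [[j k] n].
  move=> /and3P[/= ia r3 lm] /and3P[jm km nm].
  apply: etrans (jacE _ (i, r, l) (j, k, n))  _; rewrite /jacobian /=;
    apply: (@eq_tangent _ _ _ _ _ _ _ id) => // i'.
  rewrite !inE => oy; split=> // r' _; rewrite fam0 //.
  by case/or3P: oy => /eqP->.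
have minor1' : has_minor
      (fun x => [&& x.1.1 < a + b, x.1.2 < 3, x.2 < m + d
                  & (x.1.1 < a) ==> (m <= x.2)]%N)
      (fun t => below (m + d) t && ~~ below m t)
      (fun x y => (jacobian line x y).[1]) r2.
  apply: (has_minor_map (a := id) (b := id)) minor1 => // -[[i r] l] y _ _.
  apply: etrans (jacE _ (i, r, l) y) _.
  by rewrite /jacobian /=; apply: (@eq_tangent _ _ _ _ _ _ _ id); case: y => [[? ?] ?].
have [g0 g0N h0] := has_minor_generic minor0'.
have [g1 g1N h1] := has_minor_generic minor1'.
have [|t /= /and3P[/h0 k0 /h1 k1 _]] := @exists_non_root K [:: g0; g1].
  by rewrite /= andbT; apply/andP; split;
     [apply: contraNneq g0N | apply: contraNneq g1N] => ->; rewrite horner0.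
exists (fam t).
apply: (has_minor_map (a := id) (b := id)) (has_minor_block _ k0 k1).
- move=> [[i r] l] /= /orP[|]; last by case/and4P=> -> -> ->.
  by case/and3P=> ia -> lm; rewrite !ltn_addr.
- move=> [[i j] k] /= /orP[|/andP[] //] /and3P[im jm km].
  by rewrite !ltn_addr.
- by move=> x y _ _; rewrite -jacE.
move=> [[i r] l] y /and3P[/= ia r3 lm] /andP[_].
rewrite jacE; case: y => [[y1 y2] y3]; rewrite /jacobian /=.
have off j : (m <= j)%N -> tangent (fam t i) r l (y1, y2, y3) = 0 \/
    j \notin [:: y1; y2; y3].
  move=> mj; have [jy|] := boolP (j \in _); [left|by right].
  apply: (@tangent_eq0 _ _ _ _ j (y1, y2, y3)) => // [|r' _];
    first by rewrite neq_ltn orbC (leq_trans lm).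
  rewrite /fam /line ia /tr ltnNge mj /= supp1 //.
  by rewrite hornerD hornerM !hornerC subrr mulr0 addr0.
by rewrite !negb_and -!leqNgt => /or3P[]/off[]//; rewrite !inE eqxx ?orbT.
Qed.

(** * The blocks of an enlargement by six dimensions *)

(** In the old space lie the points [InPair j k c] of F_j + F_k, [InVertex j c]
    of F_j + Z and [InCore c] of Z; the new points are [AtVertex j c] in U + F_j
    and [AtCore c] in U + Z. *)
Inductive label :=
  | InPair of nat & nat & nat
  | InVertex of nat & nat
  | InCore of nat
  | AtVertex of nat & nat
  | AtCore of nat.

Definition label_code (a : label) : nat * (nat * nat * nat) :=
  match a with
  | InPair j k c => (0, (j, k, c))
  | InVertex j c => (1, (j, 0, c))
  | InCore c => (2, (0, 0, c))
  | AtVertex j c => (3, (j, 0, c))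
  | AtCore c => (4, (0, 0, c))
  end%N.

Definition label_decode (a : nat * (nat * nat * nat)) : label :=
  match a with
  | (0, (j, k, c)) => InPair j k c
  | (1, (j, _, c)) => InVertex j c
  | (2, (_, _, c)) => InCore c
  | (3, (j, _, c)) => AtVertex j c
  | (_, (_, _, c)) => AtCore c
  end%N.

Lemma label_codeK : cancel label_code label_decode. Proof. by case. Qed.

HB.instance Definition _ := Equality.copy label (can_type label_codeK).

Section Local.
Variables (z e x y : nat).

(** The blocks in local coordinates.  U has the coordinates 0 to 5; in a
    pair block F_j and F_k have 6 to 11 and 12 to 17, in a vertex block F_j has 6
    to 11 and Z the following ones from 12 on, in the core block Z also starts
    at 12, and the coordinates 6 to 11 stay empty. *)
Definition pair_row : pred (label * nat * nat) := fun '(a, r, l) =>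
  (r < 3)%N && match a with
  | InPair 0 1 c => (c < 4) && (l < 6)
  | AtVertex 0 c => (c < 4) && (12 <= l < 18)
  | AtVertex 1 c => (c < 4) && (6 <= l < 12)
  | _ => false end%N.

Definition pair_col : pred triple := fun '(i, j, k) =>
  [&& i < 6, 6 <= j < 12 & 12 <= k < 18]%N.

Definition vertex_row : pred (label * nat * nat) := fun '(a, r, l) =>
  (r < 3)%N && match a with
  | InVertex 0 c => (c < x) && (l < 6)
  | AtVertex 0 c => (c < 4) && (l < 12 + z)
  | AtCore c => (c < e) && (6 <= l < 12)
  | _ => false end%N.

Definition vertex_col : pred triple := fun '(i, j, k) =>
  [&& i < 6, j < 12 + z, k < 12 + z & (6 <= j < 12) || (6 <= k < 12)]%N.

Definition core_row : pred (label * nat * nat) := fun '(a, r, l) =>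
  (r < 3)%N && match a with
  | InCore c => (c < y) && (l < 6)
  | AtCore c => (c < e) && ((l < 6) || (12 <= l < 12 + z))
  | _ => false end%N.

Definition core_col : pred triple := fun '(i, j, k) =>
  [&& i < 6, (j < 6) || (12 <= j < 12 + z) & (k < 6) || (12 <= k < 12 + z)]%N.

Variable R : comNzRingType.
Variables (pp X E Y : nat -> point R).

(** The four points of U + F_k are given in the coordinates of a vertex block;
    in a pair block the second vertex lives in 12 to 17. *)
Definition shifted (q : point R) : point R := fun r i =>
  if (i < 6)%N then q r i else if (12 <= i)%N then q r (i - 6)%N else 0.

Definition pair_pts (q0 q1 : nat -> point R) (a : label) : point R :=
  match a with
  | InPair 0 1 c => pp c
  | AtVertex 0 c => q0 c
  | AtVertex 1 c => shifted (q1 c)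
  | _ => fun _ _ => 0
  end.

Definition vertex_pts (q : nat -> point R) (a : label) : point R :=
  match a with
  | InVertex 0 c => X c
  | AtVertex 0 c => q c
  | AtCore c => E c
  | _ => fun _ _ => 0
  end.

Definition core_pts (a : label) : point R :=
  match a with
  | InCore c => Y c
  | AtCore c => E c
  | _ => fun _ _ => 0
  end.

Definition pair_ok q0 q1 r :=
  has_minor pair_row pair_col (jacobian (pair_pts q0 q1)) r.
Definition vertex_ok q r :=
  has_minor vertex_row vertex_col (jacobian (vertex_pts q)) r.
Definition core_ok r := has_minor core_row core_col (jacobian core_pts) r.
End Local.

Section Global.
Variables (K : numFieldType) (h z e x y : nat).
Variables (pp X E Y : nat -> point K) (q : nat -> nat -> point K).
Hypothesis pp_U : forall c r i, (i < 6)%N -> pp c r i = 0.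
Hypothesis X_U : forall c r i, (i < 6)%N -> X c r i = 0.
Hypothesis Y_U : forall c r i, (i < 12)%N -> Y c r i = 0.
Hypothesis E_F : forall c r i, (6 <= i < 12)%N -> E c r i = 0.
Hypothesis q_Z : forall j c r i, (12 <= i)%N -> q j c r i = 0.

Let m := (6 * h + z)%N.
(** In K^(m + 6) the spaces F_j come first, then Z, and U comes last. *)
Definition inU i := (m <= i < m + 6)%N.
Definition inF j i := (6 * j <= i < 6 * j + 6)%N.
Definition inZ i := (6 * h <= i < m)%N.

Definition global_pts (a : label) : point K := fun r i =>
  match a with
  | InPair j k c => if inF j i then pp c r (6 + i - 6 * j)%N
                    else if inF k i then pp c r (12 + i - 6 * k)%N else 0
  | InVertex j c => if inF j i then X c r (6 + i - 6 * j)%N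
                    else if inZ i then X c r (12 + i - 6 * h)%N else 0
  | InCore c => if inZ i then Y c r (12 + i - 6 * h)%N else 0
  | AtVertex j c => if inU i then q j c r (i - m)%N
                    else if inF j i then q j c r (6 + i - 6 * j)%N else 0
  | AtCore c => if inU i then E c r (i - m)%N
                else if inZ i then E c r (12 + i - 6 * h)%N else 0
  end.

(** [None] is the core block, [Some (j, None)] the block of the vertex j and
    [Some (j, Some k)] that of the pair j, k. *)
Let block := option (nat * option nat).

(** A row of a block moves a point in a direction for which the product remains
    a trivector of the sum of the spaces of the block; every row belongs to at
    most one block. *)
Definition block_row (t : block) : pred (label * nat * nat) := fun '(a, r, l) =>
  (r < 3)%N && match t, a with
  | Some (j, Some k), InPair j' k' c => [&& j' == j, k' == k, (c < 4)%N & inU l]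
  | Some (j, Some k), AtVertex j' c =>
      (c < 4)%N && ((j' == j) && inF k l || (j' == k) && inF j l)
  | Some (j, None), InVertex j' c => [&& j' == j, (c < x)%N & inU l]
  | Some (j, None), AtVertex j' c =>
      [&& j' == j, (c < 4)%N & [|| inU l, inF j l | inZ l]]
  | Some (j, None), AtCore c => (c < e)%N && inF j l
  | None, InCore c => (c < y)%N && inU l
  | None, AtCore c => (c < e)%N && (inU l || inZ l)
  | _, _ => false end.

Definition block_col (t : block) : pred triple := fun '(i, j, k) =>
  [&& inU i, j < m + 6, k < m + 6 &
  match t with
  | Some (a, Some b) => inF a j && inF b k
  | Some (a, None) => inF a j || inF a k
  | None => true end]%N.

Definition block_rank r0 r1 r2 (t : block) : nat :=
  match t with Some (_, Some _) => r2 | Some (_, None) => r1 | None => r0 end.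

Definition block_level (t : block) := block_rank 0 1 2 t.

Definition vertices_of (t : block) : seq nat :=
  match t with
  | Some (j, Some k) => [:: j; k] | Some (j, None) => [:: j] | None => [::] end.

Definition vertex_pairs : seq (nat * nat) :=
  [seq (j, k) | k <- iota 0 h, j <- iota 0 k].

Lemma mem_vertex_pairs j k : ((j, k) \in vertex_pairs) = (j < k < h)%N.
Proof.
apply/allpairsPdep/idP => [[k' [j' []]]|/andP[jk kh]].
  by rewrite !mem_iota !add0n /= => kh jk [-> ->]; rewrite jk.
by exists k, j; rewrite !mem_iota !add0n /= jk kh.
Qed.

Lemma uniq_vertex_pairs : uniq vertex_pairs.
Proof.
apply: allpairs_uniq_dep => [|k _|[k j] [k' j'] _ _ [-> ->]] //; exact: iota_uniq.
Qed.

Lemma size_vertex_pairs : size vertex_pairs = 'C(h, 2).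
Proof.
rewrite size_allpairs_dep -bin2_sum sumnE big_map /index_iota subn0.
by apply: eq_bigr => i _; rewrite size_iota.
Qed.

Definition blocks : seq block :=
  None :: [seq Some (j, None) | j <- iota 0 h]
       ++ [seq Some (jk.1, Some jk.2) | jk <- vertex_pairs].

Definition valid (t : block) : bool :=
  match t with
  | Some (j, Some k) => j < k < h | Some (j, None) => j < h | None => true end%N.

Lemma blocks_valid t : t \in blocks -> valid t.
Proof.
rewrite inE mem_cat => /or3P[/eqP->//|/mapP[j jh ->]|/mapP[[j k] jk ->]] /=.
  by move: jh; rewrite mem_iota.
by rewrite mem_vertex_pairs in jk.
Qed.

Lemma blocks_uniq : uniq blocks.
Proof.
rewrite /blocks /= mem_cat negb_or cat_uniq.
rewrite !map_inj_uniq ?iota_uniq ?uniq_vertex_pairs; first last.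
- by move=> i j [].
- by move=> [i j] [k l] [-> ->].
rewrite /= andbT -andbA; apply/and3P; split.
- by apply/negP=> /mapP[].
- by apply/negP=> /mapP[].
by apply/hasPn=> _ /mapP[jk _ ->]; apply/negP=> /mapP[].
Qed.

Lemma blocks_sorted : sorted (fun s t => block_level s <= block_level t)%N blocks.
Proof.
have lvl_cst n (s : seq block) : all (fun t => block_level t == n) s ->
    sorted (fun s t => block_level s <= block_level t)%N s.
  case: s => // t s; elim: s t => //= t' s IHs t /and3P[/eqP lt /eqP lt' ls].
  by rewrite lt lt' leqnn IHs //= lt' eqxx.
rewrite /blocks /= path_sortedE => [|? ? ?]; last exact: leq_trans.
apply/andP; split; first by apply/allP.
set s1 := map _ _; set s2 := map _ _.
have l1 : all (fun t => block_level t == 1%N) s1 by apply/allP=> _ /mapP[? _ ->].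
have l2 : all (fun t => block_level t == 2) s2 by apply/allP=> _ /mapP[? _ ->].
rewrite sorted_pairwise => [|? ? ?]; last exact: leq_trans.
rewrite pairwise_cat -!sorted_pairwise => [|? ? ? |? ? ?]; try exact: leq_trans.
rewrite (lvl_cst 1%N) ?(lvl_cst 2) // !andbT.
apply/allrelP => s t /(allP l1)/eqP-> /(allP l2)/eqP->. by [].
Qed.

(** A product of vectors of U, Z and the F_j of the block s has no component on
    a column that involves another F_k. *)
Lemma block_row_supp t a r l k i :
    valid t -> block_row t (a, r, l) -> (k < h)%N -> inF k i ->
    k \notin vertices_of t ->
  i != l /\ forall r', global_pts a r' i = 0.
Proof.
move=> vt rowt kh ik; move: vt rowt; rewrite /block_row /global_pts.
have -> : inU i = false by move: ik; rewrite /inF /inU /m; lia.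
have -> : inZ i = false by move: ik; rewrite /inF /inZ /m; lia.
have Fi j : inF j i = (j == k).
  by move: ik; rewrite /inF => ik; apply/idP/eqP; lia.
case: t => [[j [j'|]]|]; case: a => [k1 k2 c|k1 c|c|k1 c|c] //=; rewrite ?inE ?negb_or;
  rewrite ?andbF ?[k == _]eq_sym //; move=> vt H kN; split=> [|r']; rewrite ?Fi //=.
all: try by move: H ik vt kN; rewrite /inF /inU /inZ /m; lia.
all: do ?case: eqP => [?|_] //; exfalso; by move: H ik vt kN; rewrite /inF /inU /inZ /m; lia.
Qed.

(** If t has level at least that of s and is not s, it has a vertex that s
    lacks. *)
Lemma block_zero s t a r l i j k :
    valid s -> valid t -> s != t -> (block_level s <= block_level t)%N ->
    block_row s (a, r, l) -> block_col t (i, j, k) ->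
  jacobian global_pts (a, r, l) (i, j, k) = 0.
Proof.
move=> vs vt st lvl rows cols.
have off v c : (v < h)%N -> inF v c -> v \notin vertices_of s ->
    c \in [:: i; j; k] -> jacobian global_pts (a, r, l) (i, j, k) = 0.
  move=> vh cv vNs cin; have [cl c0] := block_row_supp vs rows vh cv vNs.
  by apply: (@tangent_eq0 _ _ _ _ c (i, j, k)) => // r' _; apply: c0.
have inj : j \in [:: i; j; k] by rewrite !inE eqxx orbT.
have ink : k \in [:: i; j; k] by rewrite !inE eqxx !orbT.
case: t vt st lvl cols => [[u [v|]]|] /= vt st lvl /and4P[_ _ _]; last 1 first.
- by case: s st lvl {vs rows off} => [[? []]|].
- move=> /andP[ju kv].
  have [us|us] := boolP (u \notin vertices_of s); first by apply: (off u j) => //; lia.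
  have [ws|ws] := boolP (v \notin vertices_of s); first by apply: (off v k) => //; lia.
  exfalso; case: s vs st us ws {lvl rows off} => [[u' [v'|]]|] //=; rewrite !negbK !inE.
    move=> vs st us ws; case/negP: st; apply/eqP.
    by have [-> ->] : u' = u /\ v' = v by lia.
  by lia.
move=> cu; have us : u \notin vertices_of s.
  case: s vs st lvl {rows off} => [[u' [v'|]]|] //= _ st _; rewrite inE.
  by apply: contra st => /eqP->.
by case/orP: cu => cu; [apply: (off u j) | apply: (off u k)].
Qed.

(** From local to global coordinates: the second and the third segment of six go
    to the positions a and b. *)
Definition place a b l : nat :=
  if (l < 6)%N then (m + l)%N else if (l < 12)%N then (a + (l - 6))%N
  else (b + (l - 12))%N.

Lemma block_minor (P : pred (label * nat * nat)) (Q : pred triple)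
    (lpts : label -> point K) rho t (f : label -> label) a b :
    (forall s r l, P (s, r, l) -> block_row t (f s, r, place a b l)) ->
    (forall i j k, Q (i, j, k) ->
       block_col t (place a b i, place a b j, place a b k)) ->
    (forall s r l i j k, P (s, r, l) -> Q (i, j, k) ->
       forall o, o \in [:: i; j; k] ->
       (place a b o == place a b l) = (o == l) /\
       forall r', global_pts (f s) r' (place a b o) = lpts s r' o) ->
    has_minor P Q (jacobian lpts) rho ->
  has_minor (block_row t) (block_col t) (jacobian global_pts) rho.
Proof.
move=> rowsP colsP ptsE.
apply: (has_minor_map (a := fun s => (f s.1.1, s.1.2, place a b s.2))
  (b := fun t => (place a b t.1.1, place a b t.1.2, place a b t.2))).
- by move=> [[s r] l]; apply: rowsP.
- by move=> [[i j] k]; apply: colsP.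
move=> [[s r] l] [[i j] k] Px Qy; rewrite /jacobian /=.
apply: (@eq_tangent _ _ _ _ _ (i, j, k) _ (place a b)) => //= o oin.
have [-> oE] := ptsE _ _ _ _ _ _ Px Qy o oin.
by split=> // r' _; apply: oE.
Qed.

Variables (r0 r1 r2 : nat).
Hypothesis core_minor : core_ok z e y E Y r0.
Hypothesis vertex_minor : forall j, (j < h)%N -> vertex_ok z e x X E (q j) r1.
Hypothesis pair_minor :
  forall j k, (j < k < h)%N -> pair_ok pp (q j) (q k) r2.

Lemma core_block : has_minor (block_row None) (block_col None)
  (jacobian global_pts) r0.
Proof.
move: core_minor; apply: (@block_minor _ _ _ _ _ id 0%N (6 * h)%N).
- by case=> [? ? ?|? ?|c|? ?|c] r l; rewrite /core_row /block_row /inU /inZ /place /m;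
  do ?case: ifP => ?; lia.
- by move=> i j k; rewrite /core_col /block_col /inU /place /m; do ?case: ifP => ?; lia.
move=> s r l i j k Ps Qs o oin.
have l_ok : (l < 6)%N || (12 <= l < 12 + z)%N.
  by case: s Ps => [? ? ?|? ?|c|? ?|c]; rewrite /core_row /= ?andbF //; lia.
have o_ok : (o < 6)%N || (12 <= o < 12 + z)%N.
  by move: Qs oin; rewrite /core_col !inE; lia.
split; first by rewrite /place /m; do ?case: ifP => ?; lia.
move=> r'; have : (o < 6)%N || (12 <= o < 12 + z)%N by [].
rewrite /place; case/orP=> [o6|o12].
  have [U Z] : inU (m + o) /\ inZ (m + o) = false by rewrite /inU /inZ; lia.
  case: s Ps => [? ? ?|? ?|c|? ?|c]; rewrite /core_row /= ?andbF // => _.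
    by rewrite o6 Z Y_U // (ltn_trans o6).
  by rewrite o6 U addKn.
have [o6 o12'] : (o < 6)%N = false /\ (o < 12)%N = false by lia.
have [U Z] : inU (6 * h + (o - 12)) = false /\ inZ (6 * h + (o - 12)).
  by rewrite /inU /inZ /m; lia.
have eo : (12 + (6 * h + (o - 12)) - 6 * h = o)%N by lia.
by case: s Ps => [? ? ?|? ?|c|? ?|c]; rewrite /core_row /= ?andbF // => _;
  rewrite o6 o12' ?U Z eo.
Qed.

Definition at_vertex j (a : label) : label :=
  match a with
  | InVertex _ c => InVertex j c
  | AtVertex _ c => AtVertex j c
  | _ => a
  end.

Lemma vertex_block j : (j < h)%N ->
  has_minor (block_row (Some (j, None))) (block_col (Some (j, None)))
    (jacobian global_pts) r1.
Proof.
move=> jh; move: (vertex_minor jh).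
apply: (@block_minor _ _ _ _ _ (at_vertex j) (6 * j)%N (6 * h)%N).
- case=> [? ? ?|[|k] ?|c|[|k] ?|c] r l;
    rewrite /vertex_row /block_row /inU /inF /inZ /place /m /= ?andbF //;
      do ?case: ifP => ?; lia.
- by move=> i k l; rewrite /vertex_col /block_col /inU /inF /place /m; do ?case: ifP => ?; lia.
move=> s r l i k k' Ps Qs o oin.
have o_lt : (o < 12 + z)%N by move: Qs oin; rewrite /vertex_col !inE; lia.
have l_lt : (l < 12 + z)%N.
  by case: s Ps => [? ? ?|[|?] ?|c|[|?] ?|c]; rewrite /vertex_row /= ?andbF //; lia.
split; first by rewrite /place /m; do ?case: ifP => ?; lia.
move=> r'; rewrite /place; case: (ltnP o 6) => o6.
  have [U Z] : inU (m + o) /\ inZ (m + o) = false by rewrite /inU /inZ; lia.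
  have F : inF j (m + o) = false by rewrite /inF /m; lia.
  case: s Ps => [? ? ?|[|?] c|c|[|?] c|c]; rewrite /vertex_row /= ?andbF // => _;
    rewrite ?U ?Z ?F ?addKn // X_U //.
case: (ltnP o 12) => o12.
  have [U Z] : inU (6 * j + (o - 6)) = false /\ inZ (6 * j + (o - 6)) = false.
    by rewrite /inU /inZ /m; lia.
  have F : inF j (6 * j + (o - 6)) by rewrite /inF /m; lia.
  have eo : (6 + (6 * j + (o - 6)) - 6 * j = o)%N by lia.
  case: s Ps => [? ? ?|[|?] c|c|[|?] c|c]; rewrite /vertex_row /= ?andbF // => _;
    rewrite ?U ?Z ?F ?eo //.
  by rewrite E_F // o6.
have [U Z] : inU (6 * h + (o - 12)) = false /\ inZ (6 * h + (o - 12)).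
  by rewrite /inU /inZ /m; lia.
have F : inF j (6 * h + (o - 12)) = false by rewrite /inF /m; lia.
have eo : (12 + (6 * h + (o - 12)) - 6 * h = o)%N by lia.
case: s Ps => [? ? ?|[|?] c|c|[|?] c|c]; rewrite /vertex_row /= ?andbF // => _;
  rewrite ?U ?Z ?F ?eo //.
by rewrite q_Z.
Qed.

Definition at_pair j k (a : label) : label :=
  match a with
  | InPair _ _ c => InPair j k c
  | AtVertex 0 c => AtVertex j c
  | AtVertex _ c => AtVertex k c
  | _ => a
  end.

Lemma pair_block j k : (j < k < h)%N ->
  has_minor (block_row (Some (j, Some k))) (block_col (Some (j, Some k)))
    (jacobian global_pts) r2.
Proof.
move=> jkh; move: (pair_minor jkh).
apply: (@block_minor _ _ _ _ _ (at_pair j k) (6 * j)%N (6 * k)%N).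
- case=> [[|?] [|[|?]] ?|? ?|c|[|[|?]] ?|c] r l;
    rewrite /pair_row /block_row /inU /inF /inZ /place /m /= ?andbF //; do ?case: ifP => ?; lia.
- by move=> i i' l; rewrite /pair_col /block_col /inU /inF /place /m; do ?case: ifP => ?; lia.
move=> s r l i i' i2 Ps Qs o oin.
have o_lt : (o < 18)%N by move: Qs oin; rewrite /pair_col !inE; lia.
have l_lt : (l < 18)%N.
  by case: s Ps => [[|?] [|[|?]] ?|? ?|c|[|[|?]] ?|c]; rewrite /pair_row /= ?andbF //; lia.
split; first by rewrite /place /m; do ?case: ifP => ?; lia.
move=> r'; rewrite /place; case: (ltnP o 6) => o6.
  have U : inU (m + o) by rewrite /inU; lia.
  have F : inF j (m + o) = false by rewrite /inF /m; lia.
  have F' : inF k (m + o) = false by rewrite /inF /m; lia.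
  case: s Ps => [[|?] [|[|?]] c|? ?|c|[|[|?]] c|c]; rewrite /pair_row /= ?andbF // => _;
    rewrite ?U ?F ?F' ?addKn /shifted ?o6 // pp_U //.
case: (ltnP o 12) => o12.
  have U : inU (6 * j + (o - 6)) = false by rewrite /inU /m; lia.
  have F : inF j (6 * j + (o - 6)) by rewrite /inF /m; lia.
  have F' : inF k (6 * j + (o - 6)) = false by rewrite /inF /m; lia.
  have eo : (6 + (6 * j + (o - 6)) - 6 * j = o)%N by lia.
  case: s Ps => [[|?] [|[|?]] c|? ?|c|[|[|?]] c|c]; rewrite /pair_row /= ?andbF // => _;
    rewrite ?U ?F ?F' ?eo // /shifted.
  by rewrite ltnNge o6 /= leqNgt o12.
have U : inU (6 * k + (o - 12)) = false by rewrite /inU /m; lia.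
have F : inF j (6 * k + (o - 12)) = false by rewrite /inF /m; lia.
have F' : inF k (6 * k + (o - 12)) by rewrite /inF /m; lia.
have eo : (12 + (6 * k + (o - 12)) - 6 * k = o)%N by lia.
have eo' : (6 + (6 * k + (o - 12)) - 6 * k = o - 6)%N by lia.
case: s Ps => [[|?] [|[|?]] c|? ?|c|[|[|?]] c|c]; rewrite /pair_row /= ?andbF // => _;
  rewrite ?U ?F ?F' ?eo ?eo' // /shifted.
  by rewrite q_Z.
by rewrite ltnNge o6 /= o12.
Qed.

Lemma blocks_minor :
  has_minor (fun s => has (block_row^~ s) blocks)
    (fun t => has (block_col^~ t) blocks) (jacobian global_pts)
    (r0 + h * r1 + 'C(h, 2) * r2).
Proof.
have -> : (r0 + h * r1 + 'C(h, 2) * r2 = \sum_(t <- blocks) block_rank r0 r1 r2 t)%N.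
  rewrite /blocks big_cons big_cat !big_map /= !big_const_seq !iter_addn_0.
  rewrite !count_predT size_iota size_vertex_pairs addnA; lia.
apply: (has_minor_blocks (lvl := block_level)) blocks_uniq blocks_sorted _ _.
  move=> s t /blocks_valid vs /blocks_valid vt st lvl [[a r] l] [[i j] k].
  exact: block_zero.
move=> t /blocks_valid; case: t => [[j [k|]]|] /=.
- exact: pair_block.
- exact: vertex_block.
by move=> _; apply: core_block.
Qed.

End Global.

(** * The enlargement step *)

Section Step.
Variables (K : numFieldType) (h z e x y : nat).
Let m := (6 * h + z)%N.

(** The old points are listed in this order, so that fewer than all of them can
    be used. *)
Definition in_labels : seq label :=
  [seq InPair jk.1 jk.2 c | jk <- vertex_pairs h, c <- iota 0 4]
    ++ [seq InVertex j c | j <- iota 0 h, c <- iota 0 x]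
    ++ [seq InCore c | c <- iota 0 y].

Definition at_labels : seq label :=
  [seq AtVertex j c | j <- iota 0 h, c <- iota 0 4]
    ++ [seq AtCore c | c <- iota 0 e].

Lemma size_in_labels : size in_labels = ('C(h, 2) * 4 + h * x + y)%N.
Proof.
by rewrite !size_cat !size_allpairs size_map !size_iota size_vertex_pairs addnA.
Qed.

Lemma size_at_labels : size at_labels = (h * 4 + e)%N.
Proof. by rewrite size_cat size_allpairs size_map !size_iota. Qed.

(** Old points are differentiated only in directions of U, so that their rows
    do not compete with the rows used in the old space. *)
Lemma block_row_label t a r l :
    t \in blocks h -> block_row h z e x y t (a, r, l) ->
  [&& r < 3, l < m + 6 & (a \in in_labels) && (m <= l) || (a \in at_labels)]%N.
Proof.
move=> /blocks_valid vt /andP[-> H] /=.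
have inPair j k c : (InPair j k c \in in_labels) = [&& (j < k < h)%N & (c < 4)%N].
  rewrite mem_cat; apply/orP/idP => [[/allpairsP[[[j' k'] c'] [/= + + [-> -> ->]]]|]|].
  - by rewrite mem_vertex_pairs !inE => -> /=; lia.
  - by rewrite mem_cat => /orP[/allpairsP[? [_ _]]|/mapP[]].
  move=> /andP[jk c4]; left; apply/allpairsP; exists ((j, k), c).
  by rewrite mem_vertex_pairs mem_iota.
have inVertex j c : (InVertex j c \in in_labels) = ((j < h) && (c < x))%N.
  rewrite mem_cat mem_cat; apply/or3P/idP =>
    [[/allpairsP[? [_ _]]//|/allpairsP[[j' c'] [/= + + [-> ->]]]|/mapP[]//]|].
    by rewrite !mem_iota /= => -> ->.
  move=> /andP[jh cx]; apply: Or32; apply/allpairsP; exists (j, c).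
  by rewrite !mem_iota.
have inCore c : (InCore c \in in_labels) = (c < y)%N.
  rewrite mem_cat mem_cat; apply/or3P/idP =>
    [[/allpairsP[? [_ _]]//|/allpairsP[? [_ _]]//|/mapP[c' + [->]]]|cy].
    by rewrite mem_iota.
  by apply: Or33; apply/mapP; exists c; rewrite ?mem_iota.
have atVertex j c : (AtVertex j c \in at_labels) = ((j < h) && (c < 4))%N.
  rewrite mem_cat; apply/orP/idP => [[/allpairsP[[j' c'] [/= + + [-> ->]]]|/mapP[]//]|].
    by rewrite mem_iota !inE /= => -> /=; lia.
  move=> /andP[jh cx]; left; apply/allpairsP; exists (j, c).
  by rewrite !mem_iota.
have atCore c : (AtCore c \in at_labels) = (c < e)%N.
  rewrite mem_cat; apply/orP/idP => [[/allpairsP[? [_ _]]//|/mapP[c' + [->]]]|cy].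
    by rewrite mem_iota.
  by right; apply/mapP; exists c; rewrite ?mem_iota.
move: vt H; case: t => [[j [k|]]|]; case: a => [u v c|u c|c|u c|c] //=;
  rewrite ?inPair ?inVertex ?inCore ?atVertex ?atCore /inU /inF /inZ -/m;
  move=> vt H; apply/andP; split; lia.
Qed.

Variables (pp X E Y : nat -> point K) (q : nat -> nat -> point K).
Hypothesis pp_U : forall c r i, (i < 6)%N -> pp c r i = 0.
Hypothesis X_U : forall c r i, (i < 6)%N -> X c r i = 0.
Hypothesis Y_U : forall c r i, (i < 12)%N -> Y c r i = 0.
Hypothesis E_F : forall c r i, (6 <= i < 12)%N -> E c r i = 0.
Hypothesis q_Z : forall j c r i, (12 <= i)%N -> q j c r i = 0.
Variables (r0 r1 r2 : nat).
Hypothesis core_minor : core_ok z e y E Y r0.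
Hypothesis vertex_minor : forall j, (j < h)%N -> vertex_ok z e x X E (q j) r1.
Hypothesis pair_minor :
  forall j k, (j < k < h)%N -> pair_ok pp (q j) (q k) r2.

Let pts := global_pts h z pp X E Y q.

Lemma in_label_supp a r i : a \in in_labels -> (m <= i)%N -> pts a r i = 0.
Proof.
move=> a_in mi; have [Z F] : inZ h z i = false /\ forall j, (j < h)%N -> inF j i = false.
  by split=> [|j]; rewrite /inZ /inF; move: mi; rewrite /m; lia.
move: a_in; rewrite !mem_cat => /or3P[/allpairsP[[[j k] c]]|/allpairsP[[j c]]|/mapP[c]].
- by rewrite mem_vertex_pairs mem_iota => -[/= jk c4 ->] /=; rewrite !F //; lia.
- by rewrite !mem_iota => -[/= jk c4 ->] /=; rewrite F // Z.
by move=> _ -> /=; rewrite Z.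
Qed.

(** If there are fewer old points than the specialization asks for, each
    missing one costs its 3 * 6 rows. *)
Lemma generic_rank_step a r :
  generic_rank_ge K m a r ->
  generic_rank_ge K (m + 6) (a + (4 * h + e))
    (r + (r0 + h * r1 + 'C(h, 2) * r2 - 18 * (4 * 'C(h, 2) + x * h + y - a))).
Proof.
move=> gm; pose la := take a in_labels; pose ld := drop a in_labels.
pose P0 : pred (label * nat * nat) := fun s => has ((block_row h z e x y)^~ s) (blocks h).
pose Q0 : pred triple := fun t => has ((block_col h z)^~ t) (blocks h).
pose D := [seq (ar, l) | ar <- [seq (b, s) | b <- ld, s <- iota 0 3], l <- iota m 6].
have D_size : size D = (18 * (4 * 'C(h, 2) + x * h + y - a))%N.
  rewrite !size_allpairs !size_iota size_drop size_in_labels; lia.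
have := has_minor_drop D (blocks_minor pp_U X_U Y_U E_F q_Z core_minor vertex_minor pair_minor).
rewrite D_size => minor1.
pose pts1 (i : nat) : point K :=
  if (i < a)%N then (if (i < size la)%N then pts (nth (InCore 0) la i) else fun _ _ => 0)
  else pts (nth (InCore 0) at_labels (i - a)).
(* the points that are used: at most a old ones, followed by the new ones *)
pose num (b : label) := if b \in la then index b la else (a + index b at_labels)%N.
have inD b s l : (s < 3)%N -> (l < m + 6)%N -> b \in in_labels -> (m <= l)%N ->
    b \notin la -> (b, s, l) \in D.
  move=> s3 lm b_in ml b_la; apply: allpairs_f; last by rewrite mem_iota ml.
  apply: allpairs_f; last by rewrite mem_iota.
  by move: b_in; rewrite -[in_labels](cat_take_drop a) mem_cat (negPf b_la).
have la_a : (size la <= a)%N by rewrite size_take; case: ltnP.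
apply: (generic_rank_extend (pts1 := pts1) gm).
- move=> i s j ia mj; rewrite /pts1 ia; case: ifP => // i_la.
  by rewrite in_label_supp // (mem_take (mem_nth _ i_la)).
have at_a : (a + (4 * h + e) = a + size at_labels)%N by rewrite size_at_labels; lia.
apply: (has_minor_map (a := fun s => (num s.1.1, s.1.2, s.2)) (b := id)) minor1.
- move=> [[b s] l] /andP[/hasP[t t_in row_t] notD].
  have /and3P[s3 lm bl] := block_row_label t_in row_t.
  rewrite /= s3 lm /= /num.
  have [b_la|b_la] := boolP (b \in la).
    have bi : (index b la < a)%N by apply: leq_trans la_a; rewrite index_mem.
    rewrite bi ltn_addr //=.
    case/orP: bl => [/andP[]//|]; rewrite mem_cat => /orP[]; last first.
      by move=> /mapP[? _ b_eq]; move/mem_take: b_la;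
        rewrite !mem_cat b_eq => /or3P[/allpairsP[? []]|/allpairsP[? []]|/mapP[]].
    by move=> /allpairsP[? [_ _ b_eq]]; move/mem_take: b_la;
      rewrite !mem_cat b_eq => /or3P[/allpairsP[? []]|/allpairsP[? []]|/mapP[]].
  have b_at : b \in at_labels.
    case/orP: bl => [/andP[b_in ml]|//]; case/negP: notD.
    exact: inD.
  by rewrite at_a ltn_add2l index_mem b_at ltnNge leq_addr.
- move=> [[i j] k] /hasP[t _ /and4P[iU jm km _]].
  by rewrite /below -!/m jm km !andbT; move: iU; rewrite /inU -/m; lia.
move=> [[b s] l] t /andP[/hasP[u u_in row_u] notD] _; rewrite /jacobian /= /num.
have /and3P[s3 lm bl] := block_row_label u_in row_u.
rewrite /pts1; have [b_la|b_la] := boolP (b \in la).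
  by rewrite (leq_trans _ la_a) ?index_mem // b_la nth_index.
rewrite ltnNge leq_addr /= addKn.
have b_at : b \in at_labels.
  case/orP: bl => [/andP[b_in ml]|//]; case/negP: notD.
  exact: inD.
by rewrite nth_index.
Qed.

End Step.

(** * Ranks over the field with two elements *)

Fixpoint addv (v w : seq bool) : seq bool :=
  match v, w with
  | [::], _ => w
  | _, [::] => v
  | a :: v', b :: w' => (a (+) b) :: addv v' w'
  end.

Lemma nth_addv v w c : nth false (addv v w) c = nth false v c (+) nth false w c.
Proof.
elim: v w c => [|a v IHv] [|b w] [|c] //=; rewrite ?nth_nil ?addbF //.
Qed.

(** The rank by elimination on the first column: the pivot is the first row
    that starts with [true], and it is added to the others that do. *)
Fixpoint f2rank (k : nat) (rows : seq (seq bool)) : nat :=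
  if k is k'.+1 then
    let i := find (head false) rows in
    if drop i rows is w :: rest then
      let w' := behead w in
      (f2rank k' [seq (if head false v then addv (behead v) w' else behead v)
                 | v <- take i rows ++ rest]).+1%N
    else f2rank k' (map behead rows)
  else 0%N.

Lemma f2rank_minor k rows :
  has_minor (fun i => i < size rows)%N (fun c => c < k)%N
    (fun i c => nth false (nth [::] rows i) c) (f2rank k rows).
Proof.
elim: k rows => [|k IHk] rows /=; first exact: has_minor0.
set i := find _ rows; case def_w: (drop i rows) => [|w rest].
  apply: (has_minor_map (a := id) (b := S)) (IHk (map behead rows)) => //.
    by move=> j; rewrite size_map.
  by move=> j c; rewrite size_map => lt_j _; rewrite (nth_map [::]) // nth_behead.
have rowsE : rows = take i rows ++ w :: rest by rewrite -def_w cat_take_drop.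
have lti : (i < size rows)%N.
  by rewrite ltnNge; apply/negP=> /drop_oversize; rewrite def_w.
have size_i : size (take i rows) = i by rewrite size_takel // ltnW.
have w_i : nth [::] rows i = w by rewrite rowsE nth_cat size_i ltnn subnn.
have w_head : nth false w 0 by rewrite nth0 -w_i nth_find // has_find.
set others := take i rows ++ rest.
have others_nth j : nth [::] others j = nth [::] rows (bump i j).
  rewrite /others [in RHS]rowsE !nth_cat size_i /bump; case: leqP => ij.
    by rewrite add1n ltnNge leqW // subSn.
  by rewrite add0n ij.
have others_size : (size others).+1 = size rows.
  by rewrite [in RHS]rowsE !size_cat /= addnS.
set rows' := map _ others; have [x [y [x_lt y_lt dN0]]] := IHk rows'.
pose ix (j : 'I_(1 + f2rank k rows')) := if split j is inr j then bump i (x j) else i.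
pose iy (j : 'I_(1 + f2rank k rows')) := if split j is inr j then (y j).+1 else 0%N.
rewrite -[(f2rank _ rows').+1]add1n; exists ix, iy; split=> [j|j|].
- rewrite /ix; case: (split j) => // {}j; have := x_lt j.
  by rewrite size_map -others_size /bump; case: leqP; lia.
- by rewrite /iy; case: (split j) => // {}j; rewrite ltnS.
(* subtracting multiples of the pivot row clears the pivot column *)
pose elim : 'M[bool]_(1 + _) := block_mx 1%:M 0
  (\col_j head false (nth [::] others (x j))) 1%:M.
pose tri : 'M[bool]_(1 + f2rank k rows') :=
  block_mx 1%:M (\row_j nth false w (y j).+1) 0
    (\matrix_(i, j) nth false (nth [::] rows' (x i)) (y j)).
have -> : (\matrix_(i, j) nth false (nth [::] rows (ix i)) (iy j)) = elim *m tri.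
  rewrite mulmx_block !mul1mx !mul0mx !mulmx1 !addr0.
  apply/matrixP=> a b; rewrite mxE -[a]splitK -[b]splitK /ix /iy !unsplitK.
  case: (split a) (split b) => a' [] b' /=.
  - by rewrite block_mxEul mxE !ord1 eqxx w_i w_head.
  - by rewrite block_mxEur mxE w_i.
  - by rewrite block_mxEdl mxE nth0 others_nth.
  rewrite block_mxEdr !mxE big_ord1 !mxE /rows' (nth_map [::]); last first.
    by have := x_lt a'; rewrite size_map.
  rewrite -others_nth; case: ifP => _; last by rewrite mul0r add0r nth_behead.
  by rewrite nth_addv !nth_behead mul1r addrA [X in X + _]addrC addrK.
by rewrite det_mulmx det_lblock det_ublock !det1 !mul1r.
Qed.

Lemma f2rank_has_minor (X Y : eqType) (P : pred X) (Q : pred Y) (xs : seq X)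
    (ys : seq Y) (f : X -> Y -> bool) r :
    all P xs -> all Q ys ->
    (r <= f2rank (size ys) [seq [seq f x y | y <- ys] | x <- xs])%N ->
  has_minor P Q f r.
Proof.
move=> Pxs Qys le_r; have minor := has_minorW le_r (f2rank_minor _ _).
have [x [y [x_lt y_lt _]]] := minor; rewrite size_map in x_lt.
case: r x y {le_r} x_lt y_lt minor => [*|r x y x_lt y_lt]; first exact: has_minor0.
case: xs Pxs {x_lt} (x_lt ord0) => [|x0 xs] // Pxs _.
case: ys Qys {y_lt} (y_lt ord0) => [|y0 ys] // Qys _.
apply: (has_minor_map (a := nth x0 (x0 :: xs)) (b := nth y0 (y0 :: ys)))
  => [i|i|].
- by rewrite size_map => lti; apply: (allP Pxs); rewrite mem_nth.
- by move=> lti; apply: (allP Qys); rewrite mem_nth.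
move=> i j; rewrite size_map => lti ltj.
by rewrite (nth_map x0) // (nth_map y0).
Qed.

(** A determinant of integers that is odd is not zero. *)
Lemma has_minor_odd (K : numFieldType) (X Y : Type) (P : pred X) (Q : pred Y)
    (F : X -> Y -> int) (fb : X -> Y -> bool) (f : X -> Y -> K) r :
    (forall x y, (F x y)%:~R = fb x y) -> (forall x y, (F x y)%:~R = f x y) ->
  has_minor P Q fb r -> has_minor P Q f r.
Proof.
move=> Fb Ff [x [y [Px Qy d]]]; exists x, y; split=> //.
pose M := \matrix_(i, j) F (x i) (y j).
have Mb : \matrix_(i, j) fb (x i) (y j) = map_mx intr M.
  by apply/matrixP=> i j; rewrite !mxE Fb.
have Mf : \matrix_(i, j) f (x i) (y j) = map_mx intr M.
  by apply/matrixP=> i j; rewrite !mxE Ff.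
rewrite Mf det_map_mx intr_eq0; apply: contraNneq d => d0.
by rewrite Mb det_map_mx d0.
Qed.

Section Rmorph.
Variables (R S : comNzRingType) (f : {rmorphism R -> S}).

Lemma rmorph_jacobian L (pts : L -> point R) (pts' : L -> point S) x t :
    (forall a r i, f (pts a r i) = pts' a r i) ->
  f (jacobian pts x t) = jacobian pts' x t.
Proof.
move=> ptsE; rewrite /jacobian rmorph_tangent.
apply: (@eq_tangent _ _ _ _ _ t _ id) => [i _|]; last by case: t => [[]].
by split=> // r _; rewrite ptsE.
Qed.

Lemma rmorph_pair_pts (pp q0 q1 : nat -> point R) (pp' q0' q1' : nat -> point S) a r i :
    (forall c r i, f (pp c r i) = pp' c r i) ->
    (forall c r i, f (q0 c r i) = q0' c r i) ->
    (forall c r i, f (q1 c r i) = q1' c r i) ->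
  f (pair_pts pp q0 q1 a r i) = pair_pts pp' q0' q1' a r i.
Proof.
move=> ppE q0E q1E; case: a => [[|?] [|[|?]] ?|? ?|?|[|[|?]] ?|?] /=; rewrite ?rmorph0 //.
by rewrite /shifted; do ?case: ifP; rewrite ?rmorph0.
Qed.

Lemma rmorph_vertex_pts (X E q : nat -> point R) (X' E' q' : nat -> point S) a r i :
    (forall c r i, f (X c r i) = X' c r i) ->
    (forall c r i, f (E c r i) = E' c r i) ->
    (forall c r i, f (q c r i) = q' c r i) ->
  f (vertex_pts X E q a r i) = vertex_pts X' E' q' a r i.
Proof.
by move=> XE EE qE; case: a => [? ? ?|[|?] ?|?|[|?] ?|?] /=; rewrite ?rmorph0.
Qed.

End Rmorph.

Lemma eq_jacobian (R : comNzRingType) (L : Type) (pts pts' : L -> point R) P Q r :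
    (forall a s i, pts a s i = pts' a s i) ->
  has_minor P Q (jacobian pts) r -> has_minor P Q (jacobian pts') r.
Proof.
move=> ptsE; apply: (has_minor_map (a := id) (b := id)) => // x t _ _.
exact/esym/(rmorph_jacobian (f := idfun)).
Qed.

Lemma jacobian_generic (K : fieldType) (L : Type) (P : pred (L * nat * nat))
    (Q : pred triple) r (F : L -> point {poly K}) (G : K -> L -> point K) t0 :
    (forall t a s i, (F a s i).[t] = G t a s i) ->
    has_minor P Q (jacobian (G t0)) r ->
  exists2 g : {poly K}, g != 0 &
    forall t, g.[t] != 0 -> has_minor P Q (jacobian (G t)) r.
Proof.
move=> FE minor_t0.
have jE t x y : (jacobian F x y).[t] = jacobian (G t) x y.
  by apply: (rmorph_jacobian (f := horner_eval t)) => a s i; apply: FE.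
have [|g g_t0 gP] := @has_minor_generic _ _ _ P Q (jacobian F) r t0.
  by apply: (has_minor_map (a := id) (b := id)) minor_t0.
exists g => [|t /gP]; first by apply: contraNneq g_t0 => ->; rewrite horner0.
by apply: (has_minor_map (a := id) (b := id)) => // x y _ _; rewrite -jE.
Qed.

Section Choice.
Variables (K : numFieldType) (z e x : nat).
Variables (pp X E q0 q1 : nat -> point K) (r1 r2 : nat).

Definition between (t : K) (c : nat) : point K :=
  fun r i => q0 c r i + t * (q1 c r i - q0 c r i).

Hypothesis vertex_minor : vertex_ok z e x X E q0 r1.
Hypothesis pair_minor : pair_ok pp q0 q1 r2.

Let line c : point {poly K} :=
  fun r i => (q0 c r i)%:P + 'X * (q1 c r i - q0 c r i)%:P.
Let cst (p : nat -> point K) c : point {poly K} := fun r i => (p c r i)%:P.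

Let lineE t c r i : (line c r i).[t] = between t c r i.
Proof. by rewrite hornerD hornerM hornerX !hornerC. Qed.

Let cstE t p c r i : (cst p c r i).[t] = p c r i.
Proof. by rewrite hornerC. Qed.

(** The pair blocks require the configurations at two vertices to be in
    general position to each other, while the number of vertices is unbounded.
    All vertices use configurations on one line, from [q0] to [q1].  The vertex
    blocks are nondegenerate at a general point of the line, since they are so at
    [q0]; the pair blocks are nondegenerate at a general pair of points, since
    they are so at the pair of end points.  The parameters are chosen one after
    the other, keeping the pairs with [q1] nondegenerate as well, because this is
    what makes the next choice possible. *)
Lemma exists_vertex_parameters h : exists tau : nat -> K,
  (forall j, (j < h)%N -> vertex_ok z e x X E (between (tau j)) r1) /\
  (forall j k, (j < k < h)%N ->
     pair_ok pp (between (tau j)) (between (tau k)) r2).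
Proof.
suff [tau [vtx prs _]] : exists tau : nat -> K,
   [/\ forall j, (j < h)%N -> vertex_ok z e x X E (between (tau j)) r1,
     forall j k, (j < k < h)%N -> pair_ok pp (between (tau j)) (between (tau k)) r2
     & forall j, (j < h)%N -> pair_ok pp (between (tau j)) q1 r2].
  by exists tau.
have b0 c r i : between 0 c r i = q0 c r i by rewrite /between mul0r addr0.
have b1 c r i : between 1 c r i = q1 c r i by rewrite /between mul1r addrC subrK.
have [gv gv0 gvP] : exists2 g : {poly K}, g != 0 &
    forall t, g.[t] != 0 -> vertex_ok z e x X E (between t) r1.
  apply: (jacobian_generic (F := vertex_pts (cst X) (cst E) line) (t0 := 0)).
    by move=> t a s i; apply: (rmorph_vertex_pts (f := horner_eval t)) => *;
      rewrite /= /horner_eval ?lineE ?cstE.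
  apply: eq_jacobian vertex_minor => a s i.
  by apply: (rmorph_vertex_pts (f := idfun)) => c s' i'; rewrite /= ?b0.
have [g1 g10 g1P] : exists2 g : {poly K}, g != 0 &
    forall t, g.[t] != 0 -> pair_ok pp (between t) q1 r2.
  apply: (jacobian_generic (F := pair_pts (cst pp) line (cst q1)) (t0 := 0)).
    by move=> t a s i; apply: (rmorph_pair_pts (f := horner_eval t)) => *;
      rewrite /= /horner_eval ?lineE ?cstE.
  apply: eq_jacobian pair_minor => a s i.
  by apply: (rmorph_pair_pts (f := idfun)) => c s' i'; rewrite /= ?b0.
have g2P u : pair_ok pp (between u) q1 r2 -> exists2 g : {poly K}, g != 0 &
    forall t, g.[t] != 0 -> pair_ok pp (between u) (between t) r2.
  move=> u_ok.
  apply: (jacobian_generic (F := pair_pts (cst pp) (cst (between u)) line) (t0 := 1)).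
    by move=> t a s i; apply: (rmorph_pair_pts (f := horner_eval t)) => *;
      rewrite /= /horner_eval ?lineE ?cstE.
  apply: eq_jacobian u_ok => a s i.
  by apply: (rmorph_pair_pts (f := idfun)) => c s' i'; rewrite /= ?b1.
elim: h => [|h [tau [vtx prs prs1]]]; first by exists (fun=> 0); split=> // j k;
  rewrite ltn0 andbF.
(* one open condition for each of the parameters chosen before *)
have [gs gs0 gsP] : exists2 gs : seq {poly K}, all (fun g => g != 0) gs &
    forall t, all (fun g : {poly K} => g.[t] != 0) gs ->
    forall j, (j < h)%N -> pair_ok pp (between (tau j)) (between t) r2.
  elim: h {vtx prs} prs1 => [|h IHh] prs1; first by exists [::].
  have [j jh|gs gs0 gsP] := IHh; first by apply: prs1; rewrite ltnW.
  have [|g g0 gP] := g2P (tau h); first exact: prs1.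
  exists (g :: gs) => [|t /= /andP[/gP gt /gsP gst] j]; first by rewrite /= g0.
  by rewrite ltnS leq_eqVlt => /predU1P[->|/gst].
have [|t /= /and3P[/gvP vt /g1P t1 /gsP ts]] := @exists_non_root K [:: gv, g1 & gs].
  by rewrite /= gv0 g10.
exists (fun j => if j == h then t else tau j); split.
- move=> j; rewrite ltnS leq_eqVlt; case: eqP => // _ /=; exact: vtx.
- move=> j k jkh; have jh : (j < h)%N by lia.
  by rewrite (ltn_eqF jh); case: (k =P h) => [_|kN]; [apply: ts | apply: prs; lia].
- move=> j; rewrite ltnS leq_eqVlt; case: eqP => // _ /=; exact: prs1.
Qed.
End Choice.

(** * Explicit configurations *)

(** Vectors of zeros and ones are given by the lists of their nonzero
    coordinates. *)
Definition support_pts (R : comNzRingType) (L : Type) (d : L -> seq (seq nat))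
    (a : L) : point R :=
  fun r i => (i \in nth [::] (d a) r)%:R.

(** The entry of the Jacobian matrix modulo 2, in a form that evaluates
    fast. *)
Definition entry (d : seq (seq nat)) (r l : nat) (t : triple) : bool :=
  let: (i, j, k) := t in
  let u := nth [::] d (if r is 0 then 1 else 0) in
  let v := nth [::] d (if r is 2 then 1 else 2) in
  let mem s n := has (eqn n) s in
  let minor a b := (mem u a && mem v b) (+) (mem u b && mem v a) in
  (eqn l i && minor j k) (+) (eqn l j && minor i k) (+) (eqn l k && minor i j).

Lemma entryE L (d : L -> seq (seq nat)) a r l t : (r < 3)%N ->
  entry (d a) r l t = jacobian (support_pts bool d) (a, r, l) t.
Proof.
have memE (s : seq nat) n : has (eqn n) s = (n \in s).
  by elim: s => //= m s ->; rewrite inE eqE.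
have addbE (b c : bool) : b (+) c = b + c by [].
have andbE (b c : bool) : b && c = b * c by [].
have oppbE (b : bool) : - b = b by [].
have natb (b : bool) : b%:R = b :> bool by case: b.
case: t => [[i j] k]; case: r => [|[|[|//]]] _; rewrite /jacobian /tangent /det3;
  rewrite /subst_unit /support_pts /entry /= !memE !natb !eqnE ![l == _]eq_sym;
  rewrite !addbE !andbE !oppbE; ring.
Qed.

(** The membership tests on the listed rows and columns make the enumeration
    irrelevant to correctness. *)
Definition rank_check (L : Type) (P : pred (L * nat * nat)) (Q : pred triple)
    (xs : seq (L * nat * nat)) (ys : seq triple) (d : L -> seq (seq nat)) r : bool :=
  [&& all P xs, all Q ys
    & (r <= f2rank (size ys) [seq [seq entry (d x.1.1) x.1.2 x.2 y | y <- ys] | x <- xs])%N].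

Lemma rank_check_minor (K : numFieldType) (L : eqType) (P : pred (L * nat * nat))
    (Q : pred triple) xs ys (d : L -> seq (seq nat)) (pts : L -> point K) r :
    (forall x, P x -> (x.1.2 < 3)%N) ->
    (forall a s i, support_pts K d a s i = pts a s i) ->
  rank_check P Q xs ys d r -> has_minor P Q (jacobian pts) r.
Proof.
move=> P3 ptsE /and3P[Px Qy rk]; apply: eq_jacobian ptsE _.
have := f2rank_has_minor Px Qy rk => minor.
apply: (@has_minor_odd _ _ _ _ _ (jacobian (support_pts int d))
   (jacobian (support_pts bool d))).
- by move=> x t; apply: (rmorph_jacobian (f := intr)) => a s i; apply: rmorph_nat.
- by move=> x t; apply: (rmorph_jacobian (f := intr)) => a s i; apply: rmorph_nat.
apply: (has_minor_map (a := id) (b := id)) minor => // -[[a s] l] t /P3 /= s3 _.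
exact/esym/entryE.
Qed.

Definition list_pts (R : comNzRingType) (d : seq (seq (seq nat))) : nat -> point R :=
  support_pts R (nth [::] d).

Definition rows_of (L : Type) (ls : seq L) (us : seq nat) : seq (L * nat * nat) :=
  [seq (ar, u) | ar <- [seq (a, r) | a <- ls, r <- iota 0 3], u <- us].

Definition increasing (us vs : seq nat) : seq triple :=
  [seq (kj.2, kj.1.2, kj.1.1) | kj <- [seq (kj, i) | kj <- [seq (k, j) | k <- vs, j <- vs],
    i <- us]
     & (kj.2 < kj.1.2 < kj.1.1)%N].

Definition pair_data (pp q0 q1 : seq (seq (seq nat))) (a : label) : seq (seq nat) :=
  match a with
  | InPair 0 1 c => nth [::] pp c
  | AtVertex 0 c => nth [::] q0 c
  | AtVertex 1 c =>
      [seq [seq if (i < 6)%N then i else (6 + i)%N | i <- s] | s <- nth [::] q1 c]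
  | _ => [::]
  end.

Definition pair_check (pp q0 q1 : seq (seq (seq nat))) r :=
  rank_check pair_row pair_col
    (rows_of [seq InPair 0 1 c | c <- iota 0 4] (iota 0 6)
       ++ rows_of [seq AtVertex 0 c | c <- iota 0 4] (iota 12 6)
       ++ rows_of [seq AtVertex 1 c | c <- iota 0 4] (iota 6 6))
    [seq t <- increasing (iota 0 6) (iota 6 12) | pair_col t]
    (pair_data pp q0 q1) r.

Lemma pair_check_ok (K : numFieldType) pp q0 q1 r : pair_check pp q0 q1 r ->
  pair_ok (list_pts K pp) (list_pts K q0) (list_pts K q1) r.
Proof.
apply: rank_check_minor => [[[a s] l] /andP[]//|a s i].
case: a => [[|?] [|[|?]] c|? ?|c|[|[|?]] c|c];
  rewrite /list_pts /support_pts /= ?nth_nil ?in_nil //.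
rewrite /shifted /list_pts /support_pts.
set q := nth [::] q1 c; have [sq|sq] := ltnP s (size q); last first.
  by rewrite !nth_default ?size_map // !in_nil; do ?case: ifP.
rewrite (nth_map [::]) //; set v := nth _ q s.
have -> : (i \in [seq if (j < 6)%N then j else (6 + j)%N | j <- v])
    = if (i < 6)%N then i \in v else (12 <= i)%N && ((i - 6)%N \in v).
  apply/mapP/idP => [[j jv ->]|].
    case: (ltnP j 6) => j6; first by rewrite j6.
    by rewrite ltnNge leq_addr /= addKn jv andbT; lia.
  case: ltnP => [i6 iv|i6 /andP[i12 iv]]; first by exists i; rewrite ?i6.
  by exists (i - 6)%N => //; case: ltnP; lia.
by do ![case: ifP => //].
Qed.

Definition vertex_data (q E X : seq (seq (seq nat))) (a : label) : seq (seq nat) :=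
  match a with
  | InVertex 0 c => nth [::] X c
  | AtVertex 0 c => nth [::] q c
  | AtCore c => nth [::] E c
  | _ => [::]
  end.

Definition vertex_check z e x (q E X : seq (seq (seq nat))) r :=
  rank_check (vertex_row z e x) (vertex_col z)
    (rows_of [seq InVertex 0 c | c <- iota 0 x] (iota 0 6)
       ++ rows_of [seq AtCore c | c <- iota 0 e] (iota 6 6)
       ++ rows_of [seq AtVertex 0 c | c <- iota 0 4] (iota 0 (12 + z)))
    [seq t <- increasing (iota 0 6) (iota 0 (12 + z)) | vertex_col z t]
    (vertex_data q E X) r.

Lemma vertex_check_ok (K : numFieldType) z e x q E X r : vertex_check z e x q E X r ->
  vertex_ok z e x (list_pts K X) (list_pts K E) (list_pts K q) r.
Proof.
apply: rank_check_minor => [[[a s] l] /andP[]//|a s i].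
by case: a => [? ? ?|[|?] c|c|[|?] c|c]; rewrite /list_pts /support_pts /= ?nth_nil.
Qed.

Definition core_data (E Y : seq (seq (seq nat))) (a : label) : seq (seq nat) :=
  match a with
  | InCore c => nth [::] Y c
  | AtCore c => nth [::] E c
  | _ => [::]
  end.

Definition core_check z e y (E Y : seq (seq (seq nat))) r :=
  rank_check (core_row z e y) (core_col z)
    (rows_of [seq InCore c | c <- iota 0 y] (iota 0 6)
       ++ rows_of [seq AtCore c | c <- iota 0 e] (iota 0 6 ++ iota 12 z))
    [seq t <- increasing (iota 0 6) (iota 0 6 ++ iota 12 z) | core_col z t]
    (core_data E Y) r.

Lemma core_check_ok (K : numFieldType) z e y E Y r : core_check z e y E Y r ->
  core_ok z e y (list_pts K E) (list_pts K Y) r.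
Proof.
apply: rank_check_minor => [[[a s] l] /andP[]//|a s i].
by case: a => [? ? ?|? ?|c|? ?|c]; rewrite /list_pts /support_pts /= ?nth_nil.
Qed.

Definition generic_rank_check N s d r :=
  rank_check (fun x : nat * nat * nat => [&& x.1.1 < s, x.1.2 < 3 & x.2 < N]%N) (below N)
    (rows_of (iota 0 s) (iota 0 N)) (increasing (iota 0 N) (iota 0 N)) (nth [::] d) r.

Lemma generic_rank_check_ok (K : numFieldType) N s d r : generic_rank_check N s d r ->
  generic_rank_ge K N s r.
Proof.
by move=> chk; exists (list_pts K d); apply: rank_check_minor chk => // x /and3P[].
Qed.

(** The suffixes below name the step that uses the data: I for independent and
    S for spanning tangent spaces, followed by the dimension of Z.  The
    configurations were found by random search. *)
Definition q0_data : seq (seq (seq nat)) :=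
  ([:: [:: [:: 0; 4; 5; 6; 7; 9; 11]; [:: 0; 1; 2; 5; 6; 7; 9]; [:: 0; 2; 4; 5; 7; 8]];
     [:: [:: 0; 1; 5; 7; 9; 10]; [:: 0; 2; 3; 4; 8]; [:: 0; 2; 4; 7; 11]];
     [:: [:: 0; 2; 6; 11]; [:: 0; 1; 4; 7; 8; 11]; [:: 1; 3; 8]];
     [:: [:: 0; 1; 5; 6; 9; 11]; [:: 0; 1; 2; 3; 6; 7; 9; 10; 11]; [:: 0; 1; 2; 3; 5; 6;
       8]]])%N.
Definition q1_data : seq (seq (seq nat)) :=
  ([:: [:: [:: 0; 1; 3; 7; 8; 11]; [:: 1; 3; 6; 8; 9; 10]; [:: 2; 4; 5; 11]];
     [:: [:: 2; 3; 5; 6]; [:: 0; 1; 2; 3; 8; 10]; [:: 2]];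
     [:: [:: 0; 4; 5; 8; 9; 10; 11]; [:: 3; 5; 7; 8; 10; 11]; [:: 0; 1; 4; 6; 7; 9; 10]];
     [:: [:: 0; 2; 6; 8; 10; 11]; [:: 3; 6; 11]; [:: 1; 2; 3; 4; 7; 8; 9; 10; 11]]])%N.
Definition pp_data : seq (seq (seq nat)) :=
  ([:: [:: [:: 6; 9; 10; 12; 13]; [:: 10; 11; 12; 16; 17]; [:: 6; 9; 10; 11; 12; 15; 16; 17]];
     [:: [:: 6; 8; 12; 14; 15]; [:: 6; 7; 8; 13; 15]; [:: 6; 7; 8; 10; 11; 14; 15]];
     [:: [:: 6; 7; 10; 12; 13; 15; 16]; [:: 6; 7; 8; 12; 13; 15; 16; 17]; [:: 8; 11; 12;
       15; 16]];
     [:: [:: 6; 7; 12; 13; 16; 17]; [:: 6; 8; 13; 14; 15; 17]; [:: 8; 10; 12; 16]]])%N.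
Definition E_I0 : seq (seq (seq nat)) :=
  ([:: [:: [:: 1; 2; 3]; [:: 0; 1; 5]; [:: 0; 1; 3]]])%N.
Definition X_I0 : seq (seq (seq nat)) :=
  ([:: [:: [:: 9; 10; 11]; [:: 6; 7; 10]; [:: 10]];
     [:: [:: 6; 8; 11]; [:: 10]; [:: 8; 9; 10]]])%N.
Definition Y_I0 : seq (seq (seq nat)) :=
  ([::])%N.
Definition E_I1 : seq (seq (seq nat)) :=
  ([:: [:: [:: 0; 1; 4; 5]; [:: 3; 4; 5]; [:: 0; 1]];
     [:: [:: 1; 2; 3; 4; 5; 12]; [:: 0; 1; 4; 12]; [:: 0; 1; 2; 4; 12]]])%N.
Definition X_I1 : seq (seq (seq nat)) :=
  ([:: [:: [:: 7; 9; 11]; [:: 8; 9; 10; 12]; [:: 9; 10; 11]];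
     [:: [:: 6; 9; 10; 11]; [:: 6; 8; 10; 12]; [:: 6; 8; 9; 11; 12]]])%N.
Definition Y_I1 : seq (seq (seq nat)) :=
  ([::])%N.
Definition E_I2 : seq (seq (seq nat)) :=
  ([:: [:: [:: 0; 2; 3; 4; 5; 12; 13]; [:: 0; 1; 3; 13]; [:: 1; 2; 4; 12; 13]];
     [:: [:: 2; 3; 5; 12]; [:: 1; 2; 4; 5; 13]; [:: 0; 1; 4; 5; 12]];
     [:: [:: 0; 2; 4; 5]; [:: 1; 2; 3; 4; 13]; [:: 1; 3; 5; 13]]])%N.
Definition X_I2 : seq (seq (seq nat)) :=
  ([:: [:: [:: 6; 8; 9]; [:: 7; 8; 12; 13]; [:: 9; 11]];
     [:: [:: 7; 9; 12]; [:: 6; 11; 13]; [:: 6; 7; 8; 9; 11; 12; 13]];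
     [:: [:: 6; 11; 13]; [:: 9; 10]; [:: 7; 9; 11; 12]]])%N.
Definition Y_I2 : seq (seq (seq nat)) :=
  ([::])%N.
Definition E_I3 : seq (seq (seq nat)) :=
  ([:: [:: [:: 0; 3; 5; 12; 13]; [:: 0; 3; 13; 14]; [:: 0; 3; 5; 13]];
     [:: [:: 1; 3; 5; 12; 14]; [:: 0; 2; 3; 4; 12]; [:: 2; 4]];
     [:: [:: 0; 3; 4; 5; 13; 14]; [:: 1; 2; 3; 5; 12; 14]; [:: 2; 4; 5]]])%N.
Definition X_I3 : seq (seq (seq nat)) :=
  ([:: [:: [:: 6; 8; 10; 13; 14]; [:: 6; 9; 12]; [:: 6; 7; 8; 9; 10; 11; 12; 13; 14]];
     [:: [:: 6; 9; 10; 11; 12; 13]; [:: 8; 9; 11; 13; 14]; [:: 6; 9; 10; 13; 14]];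
     [:: [:: 6; 8; 11; 13]; [:: 7; 8; 11]; [:: 6; 7; 8; 11]]])%N.
Definition Y_I3 : seq (seq (seq nat)) :=
  ([::])%N.
Definition E_I4 : seq (seq (seq nat)) :=
  ([:: [:: [:: 0; 1; 2; 5; 13; 14; 15]; [:: 0; 4; 5; 12; 13; 14]; [:: 1; 2; 3; 4; 13; 15]];
     [:: [:: 2; 3; 12; 15]; [:: 0; 3; 4; 5; 12; 15]; [:: 0; 1; 2; 3; 5; 13]];
     [:: [:: 1; 3; 14; 15]; [:: 0; 2; 3; 13; 14]; [:: 0; 2; 13; 15]];
     [:: [:: 1; 3; 5; 12]; [:: 0; 1; 3; 4; 5; 12]; [:: 0; 3; 13; 14; 15]]])%N.
Definition X_I4 : seq (seq (seq nat)) :=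
  ([:: [:: [:: 6; 9; 13]; [:: 6; 7; 8; 9; 10; 12; 14; 15]; [:: 7; 8; 9; 10; 11; 12; 13; 15]];
     [:: [:: 6; 10; 14; 15]; [:: 6; 9; 12; 14]; [:: 7; 8; 10; 12; 14]];
     [:: [:: 6; 7; 8; 9; 11; 13]; [:: 6; 7; 9; 11; 12; 14]; [:: 7; 10; 15]];
     [:: [:: 7; 10; 12; 14]; [:: 6; 8; 10; 12; 13; 14]; [:: 7; 11; 15]]])%N.
Definition Y_I4 : seq (seq (seq nat)) :=
  ([:: [:: [:: 12; 13]; [:: 12; 14]; [:: 12; 13; 14]]])%N.
Definition E_I5 : seq (seq (seq nat)) :=
  ([:: [:: [:: 1; 4; 5; 13; 14; 15]; [:: 1; 2; 12; 13; 15; 16]; [:: 0; 2; 12; 14; 15; 16]];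
     [:: [:: 2; 4; 5; 12; 13]; [:: 3; 4; 5; 12; 13; 14; 15]; [:: 0; 5; 13]];
     [:: [:: 0; 1; 5; 12; 13]; [:: 13; 16]; [:: 0; 1; 2; 4; 5; 12; 13; 15; 16]];
     [:: [:: 1; 2; 4; 5; 12; 15; 16]; [:: 0; 1; 4; 5; 14; 15; 16]; [:: 3; 13; 14; 15]];
     [:: [:: 0; 3; 13; 15; 16]; [:: 2; 3; 4; 12; 13; 15]; [:: 0; 3; 5; 12; 15; 16]]])%N.
Definition X_I5 : seq (seq (seq nat)) :=
  ([:: [:: [:: 6; 8; 12; 13; 16]; [:: 6; 7; 9; 14; 16]; [:: 7; 8; 14; 15; 16]];
     [:: [:: 7; 10; 14; 15; 16]; [:: 9; 11; 13; 16]; [:: 10; 13; 15; 16]];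
     [:: [:: 8; 11; 12; 13; 15; 16]; [:: 6; 7; 11; 12; 14]; [:: 8; 9; 10; 11; 12; 16]];
     [:: [:: 6; 7; 8; 9; 11; 15]; [:: 8; 9; 10; 11; 12; 14]; [:: 8; 9; 10; 13; 14; 15; 16]];
     [:: [:: 7; 9; 11; 12; 13]; [:: 6; 11; 12; 16]; [:: 6; 8; 10; 15]]])%N.
Definition Y_I5 : seq (seq (seq nat)) :=
  ([:: [:: [:: 12; 14; 15]; [:: 14; 16]; [:: 13; 14; 15]]])%N.
Definition E_I9 : seq (seq (seq nat)) :=
  ([:: [:: [:: 0; 1; 3; 4; 12; 15; 17; 19; 20]; [:: 0; 3; 14; 20]; [:: 2; 4; 13; 15; 16;
    17; 19; 20]];
     [:: [:: 0; 2; 3; 13; 14; 17; 18; 19; 20]; [:: 2; 3; 5; 12; 13; 15; 16; 17; 18; 19];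
       [:: 0; 2; 3; 5; 13; 16; 17; 20]];
     [:: [:: 0; 3; 4; 5; 16; 17; 20]; [:: 2; 4; 13; 14; 16; 17; 18]; [:: 2; 3; 4; 5; 12;
       15; 17; 19]];
     [:: [:: 1; 3; 4; 5; 14; 15; 18; 20]; [:: 1; 2; 14; 15; 19; 20]; [:: 2; 3; 4; 5; 15;
       16; 17]];
     [:: [:: 1; 2; 3; 13; 15; 16; 17; 19]; [:: 12; 14; 15; 16; 18; 19; 20]; [:: 1; 5; 12;
       16; 20]];
     [:: [:: 1; 2; 3; 4; 5; 15; 19]; [:: 0; 1; 2; 12; 13; 15; 16; 18]; [:: 3; 4; 13; 14;
       15; 17; 18; 19; 20]];
     [:: [:: 0; 1; 2; 3; 4; 5; 12; 13; 14; 15; 16; 19; 20]; [:: 0; 2; 3; 12; 15; 16];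
       [:: 0; 1; 2; 12; 14; 15; 16; 20]];
     [:: [:: 1; 4; 5; 12; 14; 15; 16]; [:: 1; 3; 4; 5; 12; 13; 16; 17; 20]; [:: 0; 3; 5;
       14; 16; 17]]])%N.
Definition Y_I9 : seq (seq (seq nat)) :=
  ([:: [:: [:: 19]; [:: 12; 13; 15; 17; 18]; [:: 15; 17; 19; 20]];
     [:: [:: 12; 13; 15; 16; 17; 18; 19; 20]; [:: 12; 15; 16; 17; 20]; [:: 12; 13; 15; 17;
       18; 19; 20]];
     [:: [:: 12; 13; 15]; [:: 12; 13; 17; 19]; [:: 12; 14; 15; 17; 18; 19]]])%N.
Definition E_S0 : seq (seq (seq nat)) :=
  ([:: [:: [:: 1; 2; 3]; [:: 1; 2; 4; 5]; [:: 1]];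
     [:: [:: 0; 5]; [:: 0; 2; 3; 4]; [:: 1; 4]]])%N.
Definition X_S0 : seq (seq (seq nat)) :=
  ([:: [:: [:: 7; 8]; [:: 6; 8; 9; 11]; [:: 7; 10]];
     [:: [:: 6; 7; 10]; [:: 6; 7; 8]; [:: 6; 7; 9]]])%N.
Definition Y_S0 : seq (seq (seq nat)) :=
  ([::])%N.
Definition E_S2 : seq (seq (seq nat)) :=
  ([:: [:: [:: 0; 3; 5; 12; 13]; [:: 2; 3; 13]; [:: 1; 2; 3; 12]];
     [:: [:: 0; 1; 4]; [:: 5; 13]; [:: 4; 13]];
     [:: [:: 3; 12]; [:: 1; 3; 5; 12; 13]; [:: 1; 5; 12; 13]];
     [:: [:: 1; 4; 5; 12; 13]; [:: 1; 2; 3]; [:: 1; 3; 12]]])%N.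
Definition X_S2 : seq (seq (seq nat)) :=
  ([:: [:: [:: 6; 7]; [:: 8; 9; 11; 12]; [:: 6; 8; 9; 13]];
     [:: [:: 6; 9; 12; 13]; [:: 6; 9; 11; 13]; [:: 9; 10; 11; 13]];
     [:: [:: 8]; [:: 7; 8; 12; 13]; [:: 7; 8; 9]]])%N.
Definition Y_S2 : seq (seq (seq nat)) :=
  ([::])%N.
Definition E_S3 : seq (seq (seq nat)) :=
  ([:: [:: [:: 0; 1; 5; 14]; [:: 0; 1; 3; 14]; [:: 0; 2; 5; 12; 14]];
     [:: [:: 0; 2; 3; 4; 13]; [:: 0; 1; 2; 4; 12; 13]; [:: 0; 1; 2; 3; 4; 13; 14]];
     [:: [:: 0; 2; 3; 4; 5; 12; 13]; [:: 1; 2; 12; 14]; [:: 1; 4]];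
     [:: [:: 1; 3; 4; 5; 12; 14]; [:: 0; 2; 4; 5]; [:: 0; 4; 5; 12; 13]]])%N.
Definition X_S3 : seq (seq (seq nat)) :=
  ([:: [:: [:: 7; 10; 11; 12; 14]; [:: 11; 13; 14]; [:: 8; 9; 10; 13]];
     [:: [:: 6; 13; 14]; [:: 10]; [:: 7; 8; 11; 12; 14]];
     [:: [:: 7; 10; 11; 12; 14]; [:: 7; 8; 10; 12; 13]; [:: 7; 9; 11; 12; 13]];
     [:: [:: 7; 8; 9; 10; 11; 14]; [:: 7; 8; 9; 11; 13]; [:: 6; 8; 9; 11; 13; 14]]])%N.
Definition Y_S3 : seq (seq (seq nat)) :=
  ([:: [:: [:: 12; 13; 14]; [:: 13]; [:: 13; 14]]])%N.
Definition E_S4 : seq (seq (seq nat)) :=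
  ([:: [:: [:: 0; 1; 5; 13]; [:: 1; 5; 15]; [:: 0; 3; 5; 13; 15]];
     [:: [:: 0; 1; 5; 14; 15]; [:: 2; 4; 15]; [:: 0; 4; 5; 14; 15]];
     [:: [:: 0; 1; 3; 4; 12; 13; 14]; [:: 3; 5; 14]; [:: 1; 4; 5; 13; 15]];
     [:: [:: 1; 3; 5; 12]; [:: 0; 2; 12; 13]; [:: 0; 3; 12; 14]];
     [:: [:: 0; 2; 13; 14]; [:: 1; 2; 4; 12; 14; 15]; [:: 1; 2; 3; 12; 13; 15]]])%N.
Definition X_S4 : seq (seq (seq nat)) :=
  ([:: [:: [:: 6; 7; 9; 11; 12; 13; 15]; [:: 6; 7; 12]; [:: 6; 7; 10; 12]];
     [:: [:: 6; 8; 10; 13; 15]; [:: 9; 11; 12; 13]; [:: 9; 10]];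
     [:: [:: 6; 7; 8; 11; 15]; [:: 6; 9; 10; 11; 13; 15]; [:: 7; 8]];
     [:: [:: 8; 10; 11; 12; 13]; [:: 10; 11; 12; 15]; [:: 6; 9]];
     [:: [:: 6; 7; 10; 12; 13; 14; 15]; [:: 10; 13; 14]; [:: 8; 9; 10; 11; 13; 14]]])%N.
Definition Y_S4 : seq (seq (seq nat)) :=
  ([:: [:: [:: 12]; [:: 12; 13; 15]; [:: 13]]])%N.
Definition E_S5 : seq (seq (seq nat)) :=
  ([:: [:: [:: 0; 3; 4; 12; 14; 16]; [:: 0; 1; 2; 4; 14; 15]; [:: 0; 2; 5; 12; 13; 14; 16]];
     [:: [:: 1; 3; 5; 12; 13; 14; 15; 16]; [:: 0; 1; 2; 3; 13; 14]; [:: 1; 3; 13; 14; 15]];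
     [:: [:: 0; 1; 2; 4; 5; 16]; [:: 0; 13; 15; 16]; [:: 0; 3; 5; 13; 15]];
     [:: [:: 4; 5; 12; 13; 15; 16]; [:: 1; 3; 5; 14]; [:: 5; 12; 15]];
     [:: [:: 2; 3; 5; 12; 13; 15; 16]; [:: 0; 2; 3; 4; 5; 13; 15]; [:: 0; 1; 2; 13; 16]];
     [:: [:: 0; 2; 4; 12; 13; 14; 15]; [:: 1; 3; 4; 5; 12; 14]; [:: 2; 3; 4]]])%N.
Definition X_S5 : seq (seq (seq nat)) :=
  ([:: [:: [:: 6; 7; 10; 12; 15]; [:: 6; 7; 8; 10; 11; 13]; [:: 6; 8; 10; 14; 15]];
     [:: [:: 6; 7; 10; 13; 16]; [:: 7; 9; 10; 12; 13; 14; 15; 16]; [:: 8; 13]];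
     [:: [:: 6; 9; 10; 12; 16]; [:: 6; 7; 9; 10; 11; 12]; [:: 6; 7; 8; 9; 10; 11; 13; 15; 16]];
     [:: [:: 6; 7; 11; 12; 14; 15; 16]; [:: 6; 7; 8; 14; 15; 16]; [:: 6; 7; 9; 10]];
     [:: [:: 7; 12; 14; 15; 16]; [:: 7; 8; 10; 12; 14; 16]; [:: 8; 9; 10; 11; 12; 15; 16]]])%N.
Definition Y_S5 : seq (seq (seq nat)) :=
  ([:: [:: [:: 12; 13; 14]; [:: 12; 13; 15]; [:: 12; 13; 15]]])%N.
Definition E_S7 : seq (seq (seq nat)) :=
  ([:: [:: [:: 0; 1; 2; 5; 13; 16; 17]; [:: 3; 4; 13; 14; 17; 18]; [:: 0; 1; 3; 4; 12; 13]];
     [:: [:: 0; 1; 2; 3; 4; 13; 15]; [:: 0; 1; 2; 3; 13; 15; 17; 18]; [:: 0; 1; 5; 12; 14]];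
     [:: [:: 1; 2; 3; 12; 14; 15]; [:: 2; 4; 12; 13; 14; 17; 18]; [:: 4; 5; 14; 17]];
     [:: [:: 3; 4; 5; 16; 17]; [:: 3; 13; 16; 17]; [:: 1; 4; 5; 12; 13; 14; 16; 17; 18]];
     [:: [:: 0; 1; 2; 3; 4; 5; 12; 14; 18]; [:: 0; 5; 12; 15; 18]; [:: 0; 1; 2; 3; 5; 14;
       15; 16; 17]];
     [:: [:: 1; 2; 5; 15; 17]; [:: 0; 1; 3; 4; 13; 15; 17]; [:: 0; 3; 4; 13; 14; 17]];
     [:: [:: 0; 1; 2; 5; 14; 17; 18]; [:: 1; 2; 3; 12; 16; 17]; [:: 4; 14; 15; 16; 17]]])%N.
Definition X_S7 : seq (seq (seq nat)) :=
  ([:: [:: [:: 7; 11; 13; 14; 16]; [:: 6; 8; 10; 11; 13; 16]; [:: 7; 8; 9; 11; 12; 15; 17]];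
     [:: [:: 6; 7; 8; 10; 12; 13; 15; 17; 18]; [:: 6; 9; 10; 14; 15; 16; 17]; [:: 6; 10;
       11; 12; 13; 14; 15; 18]];
     [:: [:: 7; 8; 9; 10; 11; 12; 13; 17]; [:: 6; 9; 11; 13; 16; 17]; [:: 7; 8; 10; 11; 15;
       18]];
     [:: [:: 6; 8; 9; 12; 13; 15; 17; 18]; [:: 8; 13; 14; 15; 16; 17]; [:: 7; 12; 13; 14;
       15; 18]];
     [:: [:: 9; 10; 13; 14; 18]; [:: 11; 13; 14; 15; 17]; [:: 9; 12; 14; 15; 17; 18]];
     [:: [:: 9; 10; 12; 15; 16; 18]; [:: 7; 10; 11; 12; 13; 14; 15; 16; 17; 18]; [:: 6; 9;
       10; 11; 12; 14]];
     [:: [:: 8; 12; 13; 14; 16; 17]; [:: 6; 7; 8; 9; 12; 16; 17]; [:: 6; 10; 13; 18]]])%N.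
Definition Y_S7 : seq (seq (seq nat)) :=
  ([:: [:: [:: 12; 17]; [:: 15; 16; 17; 18]; [:: 14]];
     [:: [:: 12; 14; 16; 17; 18]; [:: 13; 14; 16; 17]; [:: 13; 17; 18]]])%N.
Definition E_S1 : seq (seq (seq nat)) :=
  ([:: [:: [:: 0; 2; 3; 12]; [:: 2; 3; 4]; [:: 1; 2; 4; 5]];
     [:: [:: 1; 2; 3; 12]; [:: 0; 1; 3]; [:: 1; 3; 12]];
     [:: [:: 0; 1; 3; 4; 12]; [:: 0; 1; 2; 3; 5]; [:: 1; 2; 4; 12]];
     [:: [:: 3; 4; 12]; [:: 0; 1; 4; 12]; [:: 0; 1; 2; 3; 4; 5]]])%N.
Definition Y_S1 : seq (seq (seq nat)) :=
  ([::])%N.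
(** All 6 * 6 * 6 columns of a pair block are independent, so that pair blocks
    serve both for independent and for spanning tangent spaces. *)
Lemma pair_data_rank : pair_check pp_data q0_data q1_data 216. Proof. by vm_compute. Qed.
Lemma core_I0 : core_check 0 1 0 E_I0 Y_I0 10. Proof. by vm_compute. Qed.
Lemma vertex_I0 : vertex_check 0 1 2 q0_data E_I0 X_I0 166. Proof. by vm_compute. Qed.
Lemma core_I1 : core_check 1 2 0 E_I1 Y_I1 26. Proof. by vm_compute. Qed.
Lemma vertex_I1 : vertex_check 1 2 2 q0_data E_I1 X_I1 196. Proof. by vm_compute. Qed.
Lemma core_I2 : core_check 2 3 0 E_I2 Y_I2 48. Proof. by vm_compute. Qed.
Lemma vertex_I2 : vertex_check 2 3 3 q0_data E_I2 X_I2 244. Proof. by vm_compute. Qed.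
Lemma core_I3 : core_check 3 3 0 E_I3 Y_I3 57. Proof. by vm_compute. Qed.
Lemma vertex_I3 : vertex_check 3 3 3 q0_data E_I3 X_I3 256. Proof. by vm_compute. Qed.
Lemma core_I4 : core_check 4 4 1 E_I4 Y_I4 106. Proof. by vm_compute. Qed.
Lemma vertex_I4 : vertex_check 4 4 4 q0_data E_I4 X_I4 304. Proof. by vm_compute. Qed.
Lemma core_I5 : core_check 5 5 1 E_I5 Y_I5 143. Proof. by vm_compute. Qed.
Lemma vertex_I5 : vertex_check 5 5 5 q0_data E_I5 X_I5 352. Proof. by vm_compute. Qed.
Lemma core_I9 : core_check 9 8 3 E_I9 Y_I9 350. Proof. by vm_compute. Qed.
Lemma core_S0 : core_check 0 2 0 E_S0 Y_S0 20. Proof. by vm_compute. Qed.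
Lemma vertex_S0 : vertex_check 0 2 2 q0_data E_S0 X_S0 180. Proof. by vm_compute. Qed.
Lemma core_S2 : core_check 2 4 0 E_S2 Y_S2 56. Proof. by vm_compute. Qed.
Lemma vertex_S2 : vertex_check 2 4 3 q0_data E_S2 X_S2 252. Proof. by vm_compute. Qed.
Lemma core_S3 : core_check 3 4 1 E_S3 Y_S3 83. Proof. by vm_compute. Qed.
Lemma vertex_S3 : vertex_check 3 4 4 q0_data E_S3 X_S3 288. Proof. by vm_compute. Qed.
Lemma core_S4 : core_check 4 5 1 E_S4 Y_S4 116. Proof. by vm_compute. Qed.
Lemma vertex_S4 : vertex_check 4 5 5 q0_data E_S4 X_S4 324. Proof. by vm_compute. Qed.
Lemma core_S5 : core_check 5 6 1 E_S5 Y_S5 155. Proof. by vm_compute. Qed.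
Lemma vertex_S5 : vertex_check 5 6 5 q0_data E_S5 X_S5 360. Proof. by vm_compute. Qed.
Lemma core_S7 : core_check 7 7 2 E_S7 Y_S7 251. Proof. by vm_compute. Qed.
Lemma vertex_S7 : vertex_check 7 7 7 q0_data E_S7 X_S7 432. Proof. by vm_compute. Qed.
Lemma core_S1 : core_check 1 4 0 E_S1 Y_S1 35. Proof. by vm_compute. Qed.

(** * Removing points *)

Definition set_row (R : Type) (p : point R) (r : nat) (c : nat -> R) : point R :=
  fun r' i => if r' == r then c i else p r' i.

Definition volume (R : comNzRingType) (p : point R) : triple -> R :=
  det3 (p 0%N) (p 1%N) (p 2).

Lemma tangent_set_row (R : comNzRingType) (p : point R) r l t :
  tangent p r l t = volume (set_row p r (fun i => (i == l)%:R)) t.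
Proof. by []. Qed.

Lemma volume_linear (R : comNzRingType) (p : point R) r i j k : (r < 3)%N ->
  exists A B C, forall c, volume (set_row p r c) (i, j, k) = c i * A + c j * B + c k * C.
Proof.
case: r => [|[|[|//]]] _; rewrite /volume /set_row /det3 /=.
- exists (p 1%N j * p 2 k - p 1%N k * p 2 j), (- (p 1%N i * p 2 k - p 1%N k * p 2 i)),
    (p 1%N i * p 2 j - p 1%N j * p 2 i) => c; ring.
- exists (- (p 0%N j * p 2 k - p 0%N k * p 2 j)), (p 0%N i * p 2 k - p 0%N k * p 2 i),
    (- (p 0%N i * p 2 j - p 0%N j * p 2 i)) => c; ring.
exists (p 0%N j * p 1%N k - p 0%N k * p 1%N j), (- (p 0%N i * p 1%N k - p 0%N k * p 1%N i)),
  (p 0%N i * p 1%N j - p 0%N j * p 1%N i) => c; ring.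
Qed.

Lemma sum_tangent (R : comNzRingType) N (p : point R) r t (c : nat -> R) :
    (r < 3)%N -> below N t ->
  \sum_(l < N) c l * tangent p r l t = volume (set_row p r c) t.
Proof.
case: t => [[i j] k] r3 /and3P[iN jN kN].
have [A [B [C volE]]] := volume_linear p i j k r3.
have cE n : (n < N)%N -> c n = \sum_(l < N) c l * (n == l)%:R.
  move=> nN; rewrite (bigD1 (Ordinal nN)) //= eqxx mulr1 big1 ?addr0 // => l lN.
  by move: lN; rewrite -val_eqE /= eq_sym => /negPf->; rewrite mulr0.
rewrite volE (cE i) // (cE j) // (cE k) // !mulr_suml -!big_split /=.
by apply: eq_bigr => l _; rewrite tangent_set_row volE; ring.
Qed.

Lemma volume_comb (R : comNzRingType) (p : point R) (b : nat -> R) r t : (r < 3)%N ->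
  volume (set_row p r (fun i => b 0%N * p 0%N i + b 1%N * p 1%N i + b 2 * p 2 i)) t
    = b r * volume p t.
Proof.
case: t => [[i j] k]; case: r => [|[|[|//]]] _; rewrite /volume /set_row /det3 /=; ring.
Qed.

Lemma det_volume (R : comNzRingType) (p : point R) i j k :
  \det (\matrix_(a < 3, b < 3) p a (nth 0%N [:: i; j; k] b)) = volume p (i, j, k).
Proof.
do 2 rewrite !(expand_det_row _ ord0) !big_ord_recl !big_ord0 !addr0 /cofactor.
rewrite !det_mx11 !mxE /= /volume /det3 /bump /=; ring.
Qed.

(** When the leading minor of p is nonzero, e_0, e_1 and e_2 are combinations
    of p_0, p_1, p_2 and the other e_l.  Replacing p_r by another p_r' gives 0, and
    by itself the product p; so 3 (N - 3) rows and p span all rows. *)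
Lemma tangent_rank_generic (K : fieldType) N (p : point K) (m : nat)
    (y : 'I_m -> triple) (x : 'I_m -> nat * nat) :
    (3 <= N)%N -> volume p (0%N, 1%N, 2) != 0 ->
    (forall i, (x i).1 < 3 /\ (x i).2 < N)%N -> (forall i, below N (y i)) ->
    \det (\matrix_(i, j) tangent p (x i).1 (x i).2 (y j)) != 0 ->
  (m <= 3 * N - 8)%N.
Proof.
move=> N3 vol_neq0 x_ok y_ok; set M := \matrix_(i, j) _ => M_neq0.
have M_unit : M \in unitmx by rewrite unitmxE unitfE.
pose P : 'M[K]_3 := \matrix_(i, j) p i j.
have P_unit : P \in unitmx.
  rewrite unitmxE unitfE; move: vol_neq0; rewrite -det_volume.
  congr (\det _ != 0); apply/matrixP=> a b'; rewrite !mxE.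
  by case: b' => [[|[|[|//]]] ?].
(* the spanning rows: the e_l with l >= 3 in the three slots, and p *)
pose V : 'M[K]_(3 * (N - 3) + 1, m) := \matrix_(i, j)
  match split i with
  | inl i => tangent p (i %/ (N - 3)) (3 + i %% (N - 3)) (y j)
  | inr _ => volume p (y j)
  end.
suff : (M <= V)%MS.
  move=> /mxrankS; rewrite mxrank_unit // => /leq_trans; apply.
  by apply: leq_trans (rank_leq_row _) _; lia.
apply/row_subP=> i; have [r3 lN] := x_ok i.
have big_row s l : (s < 3)%N -> (3 <= l < N)%N ->
    (\row_j tangent p s l (y j) <= V)%MS.
  move=> s3 l3; have sl : (s * (N - 3) + (l - 3) < 3 * (N - 3))%N by nia.
  have := row_sub (lshift 1 (Ordinal sl)) V; congr (_ <= _)%MS.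
  apply/rowP=> j; rewrite !mxE -[lshift _ _]/(unsplit (inl _)) unsplitK /=.
  rewrite divnMDl ?modnMDl; last by lia.
  by rewrite divn_small ?modn_small ?addn0; [congr (tangent _ _ _ _)| |]; lia.
have vol_row : (\row_j volume p (y j) <= V)%MS.
  have := row_sub (rshift _ 0) V; congr (_ <= _)%MS.
  by apply/rowP=> j; rewrite !mxE -[rshift _ _]/(unsplit (inr _)) unsplitK.
have -> : row i M = \row_j tangent p (x i).1 (x i).2 (y j).
  by apply/rowP=> j; rewrite !mxE.
have [l3|l3] := leqP 3 (x i).2; first by rewrite big_row ?l3.
pose s := (x i).1; pose b (k : nat) := invmx P (inord (x i).2) (inord k).
(* the combination of the p_r that agrees with e_l in the first three coordinates *)
pose c n := b 0%N * p 0%N n + b 1%N * p 1%N n + b 2 * p 2 n.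
have c_lt n : (n < 3)%N -> c n = (n == (x i).2)%:R.
  move=> n3; have := mulVmx P_unit => /matrixP/(_ (inord (x i).2) (inord n)).
  rewrite !mxE !big_ord_recl big_ord0 addr0 -val_eqE /= !inordK // eq_sym => <-.
  rewrite /c /b !mxE /= !inordK // -!addrA.
  by do ![congr (invmx P _ _ * _ + _) || congr (invmx P _ _ * _)]; apply: val_inj;
    rewrite /= inordK.
have -> : \row_j tangent p s (x i).2 (y j) = b s *: \row_j volume p (y j)
    - \sum_(l < N | (3 <= l)%N) c l *: \row_j tangent p s l (y j).
  apply/rowP=> j; rewrite !mxE summxE -volume_comb // -/c -(sum_tangent p c r3 (y_ok j)).
  rewrite [X in _ = X - _](bigID (fun l : 'I_N => (3 <= l)%N)) /=.
  rewrite [X in _ = X + _ - _](eq_bigr 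
    (fun l : 'I_N => (c l *: \row_j tangent p s l (y j)) 0 j)); last first.
    by move=> l _; rewrite !mxE.
  rewrite addrAC subrr add0r (bigD1 (Ordinal lN)) /=; last by rewrite -ltnNge.
  rewrite c_lt // eqxx mul1r big1 ?addr0 // => l /andP[l3' lN'].
  rewrite c_lt; last by rewrite ltnNge.
  by move: lN'; rewrite -val_eqE /= => /negPf->; rewrite mul0r.
rewrite addmx_sub ?scalemx_sub // eqmx_opp summx_sub // => l l3'.
by rewrite scalemx_sub // big_row // l3' /=.
Qed.

(** Moving p towards (e_0, e_1, e_2) makes the leading minor nonzero without
    destroying the given minor. *)
Lemma tangent_rank (K : numFieldType) N (p : point K) r : (3 <= N)%N ->
  has_minor (fun x : nat * nat => (x.1 < 3) && (x.2 < N))%N (below N)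
    (fun x t => tangent p x.1 x.2 t) r ->
  (r <= 3 * N - 8)%N.
Proof.
move=> N3 minor.
pose line s i : {poly K} := (p s i)%:P + 'X * ((s == i)%:R - p s i)%:P.
pose q t s i := p s i + t * ((s == i)%:R - p s i).
have lineE t s i : (line s i).[t] = q t s i.
  by rewrite hornerD hornerM hornerX !hornerC.
have volE t y : (volume line y).[t] = volume (q t) y.
  case: y => [[i j] k]; rewrite /volume /det3 /= -!lineE.
  by rewrite !(hornerD, hornerN, hornerM).
pose P : pred (unit * nat * nat) := fun x => [&& x.1.2 < 3 & x.2 < N]%N.
have [||g g0 gP] := @jacobian_generic K unit P (below N) r (fun=> line) (fun t _ => q t) 0.
- by move=> t _ s i; apply: lineE.
- pose f (x : nat * nat) := (tt, x.1, x.2).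
  apply: (has_minor_map (a := f) (b := id) (P' := P)) minor => // -[s l] y _ _.
  rewrite /jacobian /=; apply: (@eq_tangent _ _ _ _ _ y _ id) => [i _|];
    last by case: y => [[]].
  by split=> // s' _; rewrite /q mul0r addr0.
have vol0 : volume line (0%N, 1%N, 2) != 0.
  apply/eqP=> /(congr1 (fun g : {poly K} => g.[1])); rewrite volE horner0 /volume /det3 /q /=.
  move/eqP; rewrite !mul1r ![_ + (_ - _)]addrC !subrK /=.
  by rewrite !(mul0r, mulr0, mul1r, subr0, addr0) oner_eq0.
have [|t /= /and3P[/gP [x [y [Px Qy d]]] vt _]] := @exists_non_root K [:: g;
  volume line (0%N, 1%N, 2)].
  by rewrite /= g0 vol0.
apply: (@tangent_rank_generic K N (q t) r y (fun i => ((x i).1.2, (x i).2))) => //.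
  by rewrite -volE.
by move=> i; have /andP[] := Px i.
Qed.

Lemma has_minor_split (F : fieldType) (X : eqType) (Y : Type) (P D : pred X)
    (Q : pred Y) (f : X -> Y -> F) r :
  has_minor P Q f r -> exists2 k,
    has_minor (predI P D) Q f k & has_minor (predI P (predC D)) Q f (r - k).
Proof.
move=> [x [y [Px Qy d]]]; set M := \matrix_(i, j) _ in d.
have freeM : row_free M by rewrite row_free_unit unitmxE unitfE.
have part (S : pred X) : has_minor (predI P S) Q f #|[pred i | S (x i)]|.
  pose a (i : 'I_#|[pred i | S (x i)]|) := enum_val i.
  apply: (rank_has_minor (x := x \o a) (y := y)) => [i||] //=.
    by rewrite Px /=; have := enum_valP i.
  apply: eq_leq; rewrite -[LHS](eqnP (row_free_rowsub (@enum_val_inj _ _) freeM)).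
  by congr (\rank _); apply/matrixP=> i j; rewrite !mxE.
exists #|[pred i | D (x i)]|; first exact: part.
apply: has_minorW (part (predC D)).
by rewrite leq_subLR -[r in (r <= _)%N]card_ord -(cardC [pred i | D (x i)]).
Qed.

Lemma generic_rank_remove_point (K : numFieldType) N s r : (3 <= N)%N ->
  generic_rank_ge K N s.+1 r -> generic_rank_ge K N s (r - (3 * N - 8)).
Proof.
move=> N3 [pts minor]; exists pts.
have [k minor1 minor2] := has_minor_split (fun x : nat * nat * nat => x.1.1 == s) minor.
have k_le : (k <= 3 * N - 8)%N.
  apply: (@tangent_rank K N (pts s)) => //.
  apply: (has_minor_map (a := fun x : nat * nat * nat => (x.1.2, x.2)) (b := id)) minor1 => //.
    by move=> [[i j] l] /andP[/and3P[/= _ -> ->]].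
  by move=> [[i j] l] t /andP[_ /eqP/= ->] _.
apply: (@has_minorW _ _ _ _ _ _ (r - k)); first by rewrite leq_sub2l.
apply: (has_minor_map (a := id) (b := id)) minor2 =>
  // -[[i j] l] /andP[/and3P[/= ? -> ->] /= ?].
by rewrite !andbT; lia.
Qed.

(** If the tangent spaces have the maximal rank together, any removed point
    took away at most 3 N - 8. *)
Lemma independent_remove_points (K : numFieldType) N s s' : (3 <= N)%N -> (s' <= s)%N ->
  generic_rank_ge K N s (s * (3 * N - 8)) -> generic_rank_ge K N s' (s' * (3 * N - 8)).
Proof.
move=> N3 /subnKC <-; elim: (s - s')%N => [|d IHd]; first by rewrite addn0.
by rewrite addnS => /(generic_rank_remove_point N3); rewrite mulSn addKn.
Qed.

(** * Numerical form of the enlargement step *)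

Definition supported (S : pred nat) : pred (seq (seq (seq nat))) :=
  all (all (all S)).

Lemma bit_unsupported (R : comNzRingType) S d c r i :
  supported S d -> ~~ S i -> list_pts R d c r i = 0.
Proof.
move=> Sd SNi; rewrite /list_pts /support_pts; case: (boolP (i \in _)) => // id; case/negP: SNi.
have [cd|cd] := ltnP c (size d); last by rewrite (nth_default _ cd) nth_nil in id.
have [rd|rd] := ltnP r (size (nth [::] d c)); last by rewrite (nth_default _ rd) in id.
exact: (allP (allP (allP Sd _ (mem_nth _ cd)) _ (mem_nth _ rd)) _ id).
Qed.

Lemma generic_rank_step_of_data (K : numFieldType) z e x y E X Y r0 r1 h a r :
    supported (fun i => (i < 6) || (12 <= i))%N E ->
    supported (fun i => 6 <= i)%N X -> supported (fun i => 12 <= i)%N Y ->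
    core_check z e y E Y r0 ->
    ((0 < h)%N -> vertex_check z e x q0_data E X r1) ->
  generic_rank_ge K (6 * h + z) a r ->
  generic_rank_ge K (6 * h + z + 6) (a + (4 * h + e))
    (r + (r0 + h * r1 + 'C(h, 2) * 216 - 18 * (4 * 'C(h, 2) + x * h + y - a))).
Proof.
move=> E_F X_U Y_U /(core_check_ok K) coreK vertexK.
have ppU : supported (fun i => 6 <= i)%N pp_data by [].
have q0Z : supported (fun i => i < 12)%N q0_data by [].
have q1Z : supported (fun i => i < 12)%N q1_data by [].
have pairK := pair_check_ok K pair_data_rank.
have [tau [vtx prs]] : exists tau : nat -> K,
  (forall j, (j < h)%N -> vertex_ok z e x (list_pts K X) (list_pts K E)
      (between (list_pts K q0_data) (list_pts K q1_data) (tau j)) r1) /\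
  (forall j k, (j < k < h)%N -> pair_ok (list_pts K pp_data)
      (between (list_pts K q0_data) (list_pts K q1_data) (tau j))
      (between (list_pts K q0_data) (list_pts K q1_data) (tau k)) 216).
  have [h0|h0] := posnP h; first by exists (fun=> 0); split=> [j|j k]; rewrite h0 // ltn0 andbF.
  exact: exists_vertex_parameters (vertex_check_ok K (vertexK h0)) pairK h.
apply: (generic_rank_step (pp := list_pts K pp_data) (X := list_pts K X) (E := list_pts K E)
  (Y := list_pts K Y) (q := fun j =>
    between (list_pts K q0_data) (list_pts K q1_data) (tau j))) => //.
- by move=> c s i i6; apply: (bit_unsupported _ _ _ ppU); rewrite -ltnNge.
- by move=> c s i i6; apply: (bit_unsupported _ _ _ X_U); rewrite -ltnNge.
- by move=> c s i i6; apply: (bit_unsupported _ _ _ Y_U); rewrite -ltnNge.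
- by move=> c s i i6; apply: (bit_unsupported _ _ _ E_F); lia.
move=> j c s i i12; rewrite /between (bit_unsupported _ _ _ q0Z) -?leqNgt //.
by rewrite (bit_unsupported _ _ _ q1Z) -?leqNgt // subrr mulr0 addr0.
Qed.

Lemma generic_rank_more_points (K : numFieldType) N s s' r :
  (s <= s')%N -> generic_rank_ge K N s r -> generic_rank_ge K N s' r.
Proof.
move=> le_s [pts minor]; exists pts.
apply: (has_minor_map (a := id) (b := id)) minor => // x /and3P[xs -> ->].
by rewrite (leq_trans xs).
Qed.

Section Steps.
Variable K : numFieldType.

Definition independent_at N s := generic_rank_ge K N s (s * (3 * N - 8)).
Definition spanning_at N s := generic_rank_ge K N s 'C(N, 3).

Lemma bin2E h : (2 * 'C(h, 2) + h = h * h)%N.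
Proof. by elim: h => // h; rewrite binS bin1; nia. Qed.

(** The ranks required of the blocks are the numbers of their rows corrected
    by the redundancy of each tangent space.  In the core block each of the e points
    has 3 (6 + z) - 8 independent tangent directions and each of the y old points
    3 * 6; in the vertex block these numbers are 3 (12 + z) - 8 for the four points
    of U + F_j and 3 * 6 for the e points, moved along F_j, and for the x old ones.
    The alternative on m is needed as 3 m - 8 is a truncated difference. *)
Lemma independent_step z e x y E X Y h a :
    supported (fun i => (i < 6) || (12 <= i))%N E ->
    supported (fun i => 6 <= i)%N X -> supported (fun i => 12 <= i)%N Y ->
    core_check z e y E Y (e * (3 * z + 10) + 18 * y) ->
    ((0 < h)%N -> vertex_check z e x q0_data E X
       (4 * (3 * z + 28) + 18 * e + 18 * x)) ->
    (3 <= 6 * h + z \/ a = 0)%N -> (a <= 4 * 'C(h, 2) + x * h + y)%N ->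
  independent_at (6 * h + z) a -> independent_at (6 * h + z + 6) (a + (4 * h + e)).
Proof.
move=> E_F X_U Y_U chk0 chk1 m3 aA /(generic_rank_step_of_data E_F X_U Y_U chk0 chk1).
congr generic_rank_ge; move: (bin2E h) aA m3.
set c := 'C(h, 2) => cE aA m3.
have -> : (a * (3 * (6 * h + z) - 8) = a * (18 * h + 3 * z) - 8 * a)%N.
  case: m3 => [m3|->]; last by lia.
  by rewrite mulnBr; lia.
have ha : (8 * a <= a * (18 * h + 3 * z))%N by case: m3 => [m3|->]; [nia | lia].
have e1 : (18 * (4 * c + x * h + y - a) + 18 * a = 18 * (4 * c + x * h + y))%N by lia.
have -> : (3 * (6 * h + z + 6) - 8 = 18 * h + 3 * z + 10)%N by lia.
lia.
Qed.

(** The ranks required of the blocks are the numbers of their columns. *)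
Lemma spanning_step z e x y E X Y h a :
    supported (fun i => (i < 6) || (12 <= i))%N E ->
    supported (fun i => 6 <= i)%N X -> supported (fun i => 12 <= i)%N Y ->
    core_check z e y E Y (3 * z * z + 12 * z + 20) ->
    ((0 < h)%N -> vertex_check z e x q0_data E X (180 + 36 * z)) ->
    (4 * 'C(h, 2) + x * h + y <= a)%N ->
  spanning_at (6 * h + z) a -> spanning_at (6 * h + z + 6) (a + (4 * h + e)).
Proof.
move=> E_F X_U Y_U chk0 chk1 Aa /(generic_rank_step_of_data E_F X_U Y_U chk0 chk1).
congr generic_rank_ge; rewrite (eqP Aa) muln0 subn0.
have bin3 m : ('C(m + 6, 3) = 'C(m, 3) + 6 * 'C(m, 2) + 15 * m + 20)%N.
  have S3 n : ('C(n.+1, 3) = 'C(n, 3) + 'C(n, 2))%N by exact: binS.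
  have S2 n : ('C(n.+1, 2) = 'C(n, 2) + n)%N by rewrite binS bin1.
  by rewrite !addnS addn0 !S3 !S2; lia.
rewrite bin3; move: (bin2E h) (bin2E (6 * h + z)); lia.
Qed.

Lemma independent_fewer N s s' : (3 <= N)%N -> (s' <= s)%N ->
  independent_at N s -> independent_at N s'.
Proof. exact: independent_remove_points. Qed.

Lemma spanning_more N s s' : (s <= s')%N -> spanning_at N s -> spanning_at N s'.
Proof. exact: generic_rank_more_points. Qed.

End Steps.

(** * The ranges s1 and s2 *)

Section Ranges.
Variable K : numFieldType.

(** The dimension of the old space modulo 6 decides which data apply. *)
Lemma independent_steps h z a : (z < 6)%N -> (3 <= 6 * h + z \/ a = 0)%N ->
    (a <= 4 * 'C(h, 2) + nth 0 [:: 2; 2; 3; 3; 4; 5] z * h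
          + nth 0 [:: 0; 0; 0; 0; 1; 1] z)%N ->
    independent_at K (6 * h + z) a ->
  independent_at K (6 * h + z + 6) (a + (4 * h + nth 0 [:: 1; 2; 3; 3; 4; 5] z)).
Proof.
by case: z => [|[|[|[|[|[|//]]]]]] _ m3 aA; move: m3 aA;
  [ apply: (independent_step (E := E_I0) (X := X_I0) (Y := Y_I0))
  | apply: (independent_step (E := E_I1) (X := X_I1) (Y := Y_I1))
  | apply: (independent_step (E := E_I2) (X := X_I2) (Y := Y_I2))
  | apply: (independent_step (E := E_I3) (X := X_I3) (Y := Y_I3))
  | apply: (independent_step (E := E_I4) (X := X_I4) (Y := Y_I4))
  | apply: (independent_step (E := E_I5) (X := X_I5) (Y := Y_I5)) ];
  rewrite ?core_I0 ?core_I1 ?core_I2 ?core_I3 ?core_I4 ?core_I5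
    ?vertex_I0 ?vertex_I1 ?vertex_I2 ?vertex_I3 ?vertex_I4 ?vertex_I5.
Qed.

Lemma generic_rank_no_point N : generic_rank_ge K N 0 0.
Proof. exists (fun _ _ _ => 0); exact: has_minor0. Qed.

(** Points on disjoint triples of coordinate vectors. *)
Definition coordinate_spaces (s : nat) : seq (seq (seq nat)) :=
  [seq [seq [:: 3 * i + r] | r <- iota 0 3] | i <- iota 0 s]%N.

Lemma independent_small : [/\ independent_at K 4 1, independent_at K 5 1,
  independent_at K 6 2 /\ independent_at K 7 2 & independent_at K 8 3 /\ independent_at K 9 3].
Proof.
have base N s : generic_rank_check N s (coordinate_spaces s) (s * (3 * N - 8)) ->
    independent_at K N s by apply: generic_rank_check_ok.
split; [exact: base | exact: base | by split; apply: base | split; last exact: base].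
apply: (independent_steps (h := 0) (z := 2) (a := 0)) => //; first by right.
exact: generic_rank_no_point.
Qed.

(** For z = 1 a seven-dimensional Z absorbs one of the F_j. *)
Lemma spanning_steps h z a : (z < 6)%N -> (z = 1 -> 0 < h)%N ->
    (4 * 'C(h, 2) + nth 0 [:: 2; 3; 3; 4; 5; 5] z * h
          + nth 0 [:: 0; 0; 0; 1; 1; 1] z <= a)%N ->
    spanning_at K (6 * h + z) a ->
  spanning_at K (6 * h + z + 6) (a + (4 * h + nth 0 [:: 2; 3; 4; 4; 5; 6] z)).
Proof.
case: z => [|[|[|[|[|[|//]]]]]] _ h0 Aa; move: h0 Aa => /=;
  [ move=> _; apply: (spanning_step (E := E_S0) (X := X_S0) (Y := Y_S0))
  |
  | move=> _; apply: (spanning_step (E := E_S2) (X := X_S2) (Y := Y_S2))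
  | move=> _; apply: (spanning_step (E := E_S3) (X := X_S3) (Y := Y_S3))
  | move=> _; apply: (spanning_step (E := E_S4) (X := X_S4) (Y := Y_S4))
  | move=> _; apply: (spanning_step (E := E_S5) (X := X_S5) (Y := Y_S5)) ];
  rewrite ?core_S0 ?core_S2 ?core_S3 ?core_S4 ?core_S5
    ?vertex_S0 ?vertex_S2 ?vertex_S3 ?vertex_S4 ?vertex_S5 //.
case: h => [/(_ erefl)//|h] _ Aa.
have -> : (6 * h.+1 + 1 = 6 * h + 7)%N by lia.
have -> : (4 * h.+1 + 3 = 4 * h + 7)%N by lia.
apply: (spanning_step (x := 7) (y := 2) (E := E_S7) (X := X_S7) (Y := Y_S7));
  rewrite ?core_S7 ?vertex_S7 //.
by apply: leq_trans Aa; rewrite binS bin1; lia.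
Qed.

Lemma spanning_small : [/\ spanning_at K 4 1, spanning_at K 5 2,
  spanning_at K 6 2 /\ spanning_at K 7 4 & spanning_at K 8 4 /\ spanning_at K 9 5].
Proof.
have base N s d : generic_rank_check N s d 'C(N, 3) ->
  spanning_at K N s by apply: generic_rank_check_ok.
have s3 : spanning_at K 3 1 by apply: (base _ _ (coordinate_spaces 1)).
split; first by apply: (base _ _ (coordinate_spaces 1)).
- by apply: (base _ _ [:: [:: [:: 0]; [:: 1]; [:: 2]]; [:: [:: 0]; [:: 3]; [:: 4]]]%N).
- split; first by apply: (spanning_steps (h := 0) (z := 0) (a := 0)) => //;
  apply: generic_rank_no_point.
  have no_vertex P : (0 < 0)%N -> P by [].
  have := @spanning_step K 1 4 0 0 E_S1 [::] Y_S1 0 0 isT isT isT core_S1 (no_vertex _).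
  by apply=> //; apply: generic_rank_no_point.
split; first by apply: (spanning_steps (h := 0) (z := 2) (a := 0)) => //;
  apply: generic_rank_no_point.
exact: (spanning_steps (h := 0) (z := 3) (a := 1)).
Qed.

Lemma independent_base :
  [/\ independent_at K 10 5, independent_at K 11 6 /\ independent_at K 12 7,
      independent_at K 13 8 /\ independent_at K 14 10 & independent_at K 15 11].
Proof.
have [i4 i5 [i6 i7] [i8 i9]] := independent_small; split.
- by apply: (independent_steps (h := 0) (z := 4) (a := 1)) => //; left.
- split; first by apply: (independent_steps (h := 0) (z := 5) (a := 1)) => //; left.
  by apply: (independent_steps (h := 1) (z := 0) (a := 2)) => //; left.
- split; first by apply: (independent_steps (h := 1) (z := 1) (a := 2)) => //; left.
  by apply: (independent_steps (h := 1) (z := 2) (a := 3)) => //; left.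
have no_vertex P : (0 < 0)%N -> P by [].
(* the step with h = 1 and z = 3 would only give 10 points in K^15 *)
have := @independent_step K 9 8 0 3 E_I9 [::] Y_I9 0 3 isT isT isT core_I9 (no_vertex _).
by apply; [left | | exact: i9].
Qed.

Lemma spanning_base :
  [/\ spanning_at K 10 7, spanning_at K 11 9 /\ spanning_at K 12 9,
      spanning_at K 13 11 /\ spanning_at K 14 13 & spanning_at K 15 14].
Proof.
have [i4 i5 [i6 i7] [i8 i9]] := spanning_small; split.
(* the step sometimes needs fewer points than s2 provides *)
- apply: (@spanning_more _ _ 6) => //.
  exact: (spanning_steps (h := 0) (z := 4) (a := 1)).
- split; first by apply: (@spanning_more _ _ 8) => //;
  apply: (spanning_steps (h := 0) (z := 5) (a := 2)).
  by apply: (@spanning_more _ _ 8) => //; apply: (spanning_steps (h := 1) (z := 0) (a := 2)).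
- split; first by apply: (spanning_steps (h := 1) (z := 1) (a := 4)).
  by apply: (@spanning_more _ _ 12) => //; apply: (spanning_steps (h := 1) (z := 2) (a := 4)).
apply: (@spanning_more _ _ 13) => //; exact: (spanning_steps (h := 1) (z := 3) (a := 5)).
Qed.

End Ranges.

Lemma floor_divz (a : int) (d : nat) : (0 < d)%N ->
  Num.floor (a%:~R / d%:R : rat) = (a %/ d%:Z)%Z.
Proof.
move=> d0; apply: floor_def.
have dR : 0 < d%:R :> rat by rewrite ltr0n.
have dd : d%:R = (d%:Z)%:~R :> rat by [].
rewrite ler_pdivlMr // ltr_pdivrMr // dd -!intrM ler_int ltr_int.
by rewrite lez_floor ?gt_eqF //= ltz_ceil.
Qed.

Lemma s1E n : s1 n = ((9 * (n%:Z * n%:Z) - 120 * n%:Z + 574) %/ 162%:Z)%Z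
  + ((6 * n%:Z - 13) %/ 9%:Z)%Z.
Proof.
rewrite -(@floor_divz _ 162) // -(@floor_divz _ 9) // /s1.
have -> : ((9 * (n%:Z * n%:Z) - 120 * n%:Z + 574)%:~R : rat) = 9 * (n%:R * n%:R) - 120 * n%:R + 574.
  by rewrite rmorphD rmorphB !rmorphM /= !rmorph_nat -pmulrn.
have -> : ((6 * n%:Z - 13)%:~R : rat) = 6 * n%:R - 13.
  by rewrite rmorphB rmorphM /= !rmorph_nat -pmulrn.
by congr (Num.floor _ + _); field.
Qed.

Lemma ceil_divz (a : int) (d : nat) : (0 < d)%N ->
  Num.ceil (a%:~R / d%:R : rat) = - ((- a) %/ d%:Z)%Z.
Proof. by move=> d0; rewrite -floor_divz // rmorphN /= mulNr ceilNfloor. Qed.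

Lemma s2E n : s2 n = - ((- (9 * (n%:Z * n%:Z) - 66 * n%:Z + 88)) %/ 162%:Z)%Z
  - ((- (6 * n%:Z - 13)) %/ 9%:Z)%Z.
Proof.
rewrite -(@ceil_divz _ 162) // -(@ceil_divz _ 9) // /s2.
have -> : ((9 * (n%:Z * n%:Z) - 66 * n%:Z + 88)%:~R : rat) = 9 * (n%:R * n%:R) - 66 * n%:R + 88.
  by rewrite rmorphD rmorphB !rmorphM /= !rmorph_nat -pmulrn.
have -> : ((6 * n%:Z - 13)%:~R : rat) = 6 * n%:R - 13.
  by rewrite rmorphB rmorphM /= !rmorph_nat -pmulrn.
by congr (Num.ceil _ + _); field.
Qed.

Section Main.
Variable K : numFieldType.

(** Induction from n - 6 to n.  The step adds 4 h + e points, and s1 n minus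
    this number is at most s1 (n - 6) and at most the number of old points that
    the specialization accommodates. *)
Lemma independent_s1 n : (9 <= n)%N ->
  0 <= s1 n /\ independent_at K n.+1 `|s1 n|%N.
Proof.
elim/ltn_ind: n => n IHn n9.
have [n15|n15] := ltnP n 15.
  have [i10 [i11 i12] [i13 i14] i15] := independent_base K.
  have s1n m k : s1 m = k%:Z -> independent_at K m.+1 k ->
      0 <= s1 m /\ independent_at K m.+1 `|s1 m|%N by move=> ->.
  have : n \in iota 9 6 by rewrite mem_iota n9 n15.
  rewrite !inE => /or4P[/eqP->|/eqP->|/eqP->|/or3P[]/eqP->].
  - by apply: (s1n _ 5); rewrite ?s1E.
  - by apply: (s1n _ 6); rewrite ?s1E.
  - by apply: (s1n _ 7); rewrite ?s1E.
  - by apply: (s1n _ 8); rewrite ?s1E.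
  - by apply: (s1n _ 10); rewrite ?s1E.
  - by apply: (s1n _ 11); rewrite ?s1E.
pose h := ((n - 5) %/ 6)%N; pose z := ((n - 5) %% 6)%N.
have nE : (n = 6 * h + z + 5)%N by rewrite /h /z; lia.
have z6 : (z < 6)%N by rewrite ltn_mod.
have [||s1_0 indep] := IHn (n - 6)%N; [lia|lia|].
have mE : (n - 6).+1 = (6 * h + z)%N by lia.
rewrite mE in indep.
have h1 : (1 <= h)%N by rewrite /h; lia.
pose A := (4 * 'C(h, 2) + nth 0 [:: 2; 2; 3; 3; 4; 5] z * h
          + nth 0 [:: 0; 0; 0; 0; 1; 1] z)%N.
pose b := (4 * h + nth 0 [:: 1; 2; 3; 3; 4; 5] z)%N.
have [s1n0 bs aA as1] : [/\ 0 <= s1 n, (b <= `|s1 n|)%N, (`|s1 n| - b <= A)%N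
    & (`|s1 n| - b <= `|s1 (n - 6)|)%N].
  rewrite !s1E /A /b; clear s1_0 indep mE; move: (bin2E h) n15.
  have -> : (n - 6)%N%:Z = (6 * h + z)%N%:Z - 1 by lia.
  (* for fixed z the claims compare integer quotients of quadratic polynomials in h *)
  rewrite nE; clear A b nE n9 IHn; clearbody h z; case: z z6 => [|[|[|[|[|[|//]]]]]] _ /=;
    split; lia.
split=> //; have -> : n.+1 = (6 * h + z + 6)%N by lia.
rewrite -(subnK bs); apply: independent_steps => //; first by left; lia.
by apply: independent_fewer as1 indep; lia.
Qed.

Lemma spanning_s2 n : (9 <= n)%N ->
  0 <= s2 n /\ spanning_at K n.+1 `|s2 n|%N.
Proof.
elim/ltn_ind: n => n IHn n9.
have [n15|n15] := ltnP n 15.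
  have [i10 [i11 i12] [i13 i14] i15] := spanning_base K.
  have s2n m k : s2 m = k%:Z -> spanning_at K m.+1 k ->
      0 <= s2 m /\ spanning_at K m.+1 `|s2 m|%N by move=> ->.
  have : n \in iota 9 6 by rewrite mem_iota n9 n15.
  rewrite !inE => /or4P[/eqP->|/eqP->|/eqP->|/or3P[]/eqP->].
  - by apply: (s2n _ 7); rewrite ?s2E.
  - by apply: (s2n _ 9); rewrite ?s2E.
  - by apply: (s2n _ 9); rewrite ?s2E.
  - by apply: (s2n _ 11); rewrite ?s2E.
  - by apply: (s2n _ 13); rewrite ?s2E.
  - by apply: (s2n _ 14); rewrite ?s2E.
pose h := ((n - 5) %/ 6)%N; pose z := ((n - 5) %% 6)%N.
have nE : (n = 6 * h + z + 5)%N by rewrite /h /z; lia.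
have z6 : (z < 6)%N by rewrite ltn_mod.
have [||s2_0 span] := IHn (n - 6)%N; [lia|lia|].
have mE : (n - 6).+1 = (6 * h + z)%N by lia.
rewrite mE in span.
have h1 : (1 <= h)%N by rewrite /h; lia.
pose A := (4 * 'C(h, 2) + nth 0 [:: 2; 3; 3; 4; 5; 5] z * h
          + nth 0 [:: 0; 0; 0; 1; 1; 1] z)%N.
pose b := (4 * h + nth 0 [:: 2; 3; 4; 4; 5; 6] z)%N.
have [s2n0 bs aA as2] : [/\ 0 <= s2 n, (b <= `|s2 n|)%N, (A <= `|s2 n| - b)%N
    & (`|s2 (n - 6)| <= `|s2 n| - b)%N].
  rewrite !s2E /A /b; clear s2_0 span mE; move: (bin2E h) n15.
  have -> : (n - 6)%N%:Z = (6 * h + z)%N%:Z - 1 by lia.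
  rewrite nE; clear A b nE n9 IHn; clearbody h z; case: z z6 => [|[|[|[|[|[|//]]]]]] _ /=;
    split; lia.
split=> //; have -> : n.+1 = (6 * h + z + 6)%N by lia.
rewrite -(subnK bs); apply: spanning_steps => //.
exact: spanning_more as2 span.
Qed.
End Main.

(** * Polynomial functions over an infinite field *)

Section InfiniteField.
Variable K : numFieldType.

Lemma poly_vanish (g : {poly K}) : (forall t, g.[t] = 0) -> g = 0.
Proof.
move=> g0; apply/eqP; apply/negPn/negP=> gN0.
have [|t /=] := @exists_non_root K [:: g]; first by rewrite /= gN0.
by rewrite g0 eqxx.
Qed.

Lemma poly_vanish_unit (g : {poly K}) : (forall t, t != 0 -> g.[t] = 0) -> g = 0.
Proof.
move=> g0; have /eqP : g * 'X = 0.
  apply: poly_vanish => t; rewrite hornerM hornerX.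
  by have [->|/g0->] := eqVneq t 0; rewrite ?mulr0 ?mul0r.
by rewrite mulf_eq0 polyX_eq0 orbF => /eqP.
Qed.

Section LastVariable.
Variable n : nat.
Implicit Types (F : {mpoly K[n.+1]}) (v : 'I_n.+1 -> K).

Local Notation widen := (widen_ord (leqnSn n)).

(** The coefficients of F are those of F as a polynomial in its last
    variable. *)
Lemma muni_eq0 F : muni F = 0 -> F = 0.
Proof.
move=> F0; apply/mpolyP=> m; rewrite mcoeff0.
pose m' : 'X_{1..n} := [multinom m (widen i) | i < n].
have : ((muni F)`_(m ord_max))@_m' = 0 by rewrite F0 coef0 mcoeff0.
rewrite muniE coef_sum raddf_sum /=.
rewrite (eq_bigr (fun u => F@_u *+ (u == m))); last first.
  move=> u _; rewrite coefZ coefXn mulr_natr mcoeffMn mcoeffZ mcoeffX.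
  have -> : (u == m) = ([multinom u (widen i) | i < n] == m') && (m ord_max == u ord_max).
    apply/eqP/andP => [->|[/eqP/mnmP um /eqP um']]; first by rewrite !eqxx.
    apply/mnmP=> i; have [j ->|->] := unliftP ord_max i; last by rewrite um'.
    have -> : lift ord_max j = widen j by apply: val_inj; apply: lift_max.
    by have := um j; rewrite !mnmE.
  by case: (_ == m'); case: (_ == u ord_max); rewrite ?mulr1 ?mulr0 ?mulr0n.
have [mF|] := boolP (m \in msupp F); last by move/memN_msupp_eq0.
rewrite (bigD1_seq m) ?msupp_uniq //= eqxx big1 ?addr0 //.
by move=> u /negPf->.
Qed.

Lemma meval_muni F v :
  F.@[v] = (map_poly (meval (fun i => v (widen i))) (muni F)).[v ord_max].
Proof.
rewrite muniE raddf_sum horner_sum mevalE; apply: eq_bigr => m _.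
rewrite big_ord_recr /= map_polyZ /= map_polyXn hornerZ hornerXn mevalZ mevalX mulrA.
by congr (_ * _ * _); apply: eq_bigr => i _; rewrite mnmE.
Qed.
End LastVariable.

Lemma mpoly_point n (F : {mpoly K[n]}) : F != 0 -> exists v, F.@[v] != 0.
Proof.
elim: n F => [|n IHn] F F0.
  exists (fun=> 0); apply: contra F0; rewrite -{1}(mpolyKC F) mevalC => /eqP F0.
  by rewrite -(mpolyKC F) /= F0 mpolyC0.
have : muni F != 0 by apply: contraNneq F0 => /muni_eq0->.
rewrite -lead_coef_eq0 => /IHn[v lead_v].
pose g := map_poly (meval v) (muni F).
have [|t /= /andP[gt _]] := @exists_non_root K [:: g].
  rewrite /= andbT; apply: contraNneq lead_v => g0.
  by rewrite lead_coefE -coef_map -/g g0 coef0.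
pose w (i : 'I_n.+1) := if unlift ord_max i is Some j then v j else t.
exists w; rewrite meval_muni {2}/w unlift_none; move: gt; rewrite /g.
congr (_.[t] != 0); apply: eq_map_poly => p; apply: meval_eq => i.
have -> : widen_ord (leqnSn n) i = lift ord_max i by apply/esym/val_inj/lift_max.
by rewrite /w liftK.
Qed.

Lemma dhomog_scale n (F : {mpoly K[n]}) d c v : F \is d.-homog ->
  F.@[fun i => c * v i] = c ^+ d * F.@[v].
Proof.
move=> /dhomogP homF; rewrite !mevalE mulr_sumr; apply: eq_big_seq => m /homF <-.
rewrite mulrCA; congr (_ * _); rewrite /= mdegE -prodrXr -big_split /=.
by apply: eq_bigr => i _; rewrite exprMn.
Qed.

(** F (t^3 v) is a polynomial in t whose coefficients are the values of the
    homogeneous components at v.  The cube appears because scaling three vectors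
    by t scales their product by t^3; over the ground field a scalar need not be
    a cube. *)
Lemma pihomog_vanish n (F : {mpoly K[n]}) v :
    (forall t, t != 0 -> F.@[fun i => t ^+ 3 * v i] = 0) ->
  forall d, (pihomog mdeg d F).@[v] = 0.
Proof.
move=> F0 d; pose k := (maxn (msize F) d.+1).
pose g : {poly K} := \sum_(e < k) (pihomog mdeg e F).@[v] *: 'X^(3 * e).
have g0 : g = 0.
  apply: poly_vanish_unit => t /F0 <-; rewrite horner_sum.
  rewrite [in RHS](@pihomog_partitionE _ _ mdeg k F) ?leq_maxl //.
  rewrite raddf_sum; apply: eq_bigr => e _.
  rewrite /= (dhomog_scale _ _ (pihomogP _ _ _)) hornerZ hornerXn mulrC -exprM //.
have lt_d : (d < k)%N by rewrite leq_max ltnSn orbT.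
have : g`_(3 * d) = 0 by rewrite g0 coef0.
rewrite coef_sum (bigD1 (Ordinal lt_d)) //= coefZ coefXn eqxx mulr1 big1 ?addr0 // => e.
by rewrite -val_eqE /= => ne; rewrite coefZ coefXn eqn_pmul2l // eq_sym (negPf ne) mulr0.
Qed.

Definition curve_eval n (F : {mpoly K[n]}) (w : 'I_n -> {poly K}) : {poly K} :=
  mmap (@polyC K) w F.

Lemma curve_evalE n (F : {mpoly K[n]}) w t :
  (curve_eval F w).[t] = F.@[fun i => (w i).[t]].
Proof.
rewrite /curve_eval /mmap horner_sum mevalE; apply: eq_bigr => m _.
rewrite hornerM hornerC /mmap1 horner_prod; congr (_ * _).
by apply: eq_bigr => i _; rewrite horner_exp.
Qed.

End InfiniteField.

(** * Algebraic dependence *)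

Section Dependence.
Variable K : numFieldType.

Lemma msize_prod_exp M k (h : 'I_k -> {mpoly K[M]}) (e : 'I_k -> nat) b d :
    (forall i, (msize (h i) <= b.+1)%N) -> (forall i, (e i <= d)%N) ->
  (msize (\prod_i h i ^+ e i) <= (k * (d * b)).+1)%N.
Proof.
move=> h_b e_d.
have mulS (p q : {mpoly K[M]}) u v : (msize p <= u.+1)%N -> (msize q <= v.+1)%N ->
    (msize (p * q) <= (u + v).+1)%N.
  have [->|p0] := eqVneq p 0; first by rewrite mul0r msize0.
  have [->|q0] := eqVneq q 0; first by rewrite mulr0 msize0.
  rewrite msizeM // => p_u q_v.
  by rewrite -subn1 leq_subLR; apply: leq_trans (leq_add p_u q_v) _; lia.
have powS i c : (msize (h i ^+ c) <= (c * b).+1)%N.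
  elim: c => [|c IHc]; first by rewrite expr0 msize1.
  by rewrite exprS mulSn; apply: mulS.
have -> : (k * (d * b) = \sum_(i < k) d * b)%N by rewrite sum_nat_const card_ord.
elim/big_rec2: _ => [|i u p _ le_p]; first by rewrite msize1.
apply: mulS => //; apply: leq_trans (powS i (e i)) _.
by rewrite ltnS leq_mul2r e_d orbT.
Qed.

(** The products of the h_i with exponents at most d outnumber the monomials
    of the degrees that occur in them when d is large: there are (d + 1)^k of them
    in a space of dimension O(d^M). *)
Lemma algebraic_dependence M k (h : 'I_k -> {mpoly K[M]}) : (M < k)%N ->
  exists2 F : {mpoly K[k]}, F != 0 & forall x, F.@[fun i => (h i).@[x]] = 0.
Proof.
move=> lt_Mk; pose b := \max_i msize (h i).
have h_b i : (msize (h i) <= b.+1)%N by apply: leqW; apply: leq_bigmax.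
(* the constant of the estimate B ^ M <= d (d + 1) ^ M, beaten by (d + 1) ^ k *)
pose d := ((k * b).+1 ^ M)%N; pose B := (k * (d * b)).+1.
pose rowT := {ffun 'I_k -> 'I_d.+1}; pose colT := {ffun 'I_M -> 'I_B}.
pose P (m : rowT) : {mpoly K[M]} := \prod_i h i ^+ m i.
pose mon k d (m : {ffun 'I_k -> 'I_d}) : 'X_{1..k} := [multinom (m i : nat) | i < k].
have mon_inj k' d' : injective (@mon k' d').
  move=> m m' /mnmP eq_m; apply/ffunP=> i; apply: val_inj.
  by have := eq_m i; rewrite !mnmE.
pose A : 'M[K]_(#|{: rowT}|, #|{: colT}|) :=
  \matrix_(i, j) (P (enum_val i))@_(mon _ _ (enum_val j)).
have lt_card : (#|{: colT}| < #|{: rowT}|)%N.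
  rewrite !card_ffun !card_ord.
  have leB : (B <= (k * b).+1 * d.+1)%N by rewrite /B; nia.
  have leBM : (B ^ M <= ((k * b).+1 * d.+1) ^ M)%N.
    by case: (M) => // M'; rewrite leq_exp2r.
  apply: leq_ltn_trans leBM _; rewrite expnMn.
  have -> : (d.+1 ^ k = d.+1 ^ (k - M) * d.+1 ^ M)%N by rewrite -expnD subnK // ltnW.
  rewrite ltn_pmul2r ?expn_gt0 // -/d.
  have : (0 < k - M)%N by rewrite subn_gt0.
  by case: (k - M)%N => // c _; rewrite expnS; apply: leq_pmulr; rewrite expn_gt0.
have kerA : kermx A != 0.
  rewrite -mxrank_eq0 mxrank_ker -lt0n subn_gt0.
  exact: leq_ltn_trans (rank_leq_col A) lt_card.
pose c := nz_row (kermx A).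
have c0 : c != 0 by rewrite nz_row_eq0.
have cA : c *m A = 0 by apply/sub_kermxP/nz_row_sub.
pose F : {mpoly K[k]} := \sum_i c 0 i *: 'X_[mon _ _ (enum_val i : rowT)].
exists F.
  apply: contraNneq c0 => F0; apply/eqP/rowP=> i; rewrite mxE.
  have : F@_(mon _ _ (enum_val i : rowT)) = 0 by rewrite F0 mcoeff0.
  rewrite raddf_sum (bigD1 i) //= mcoeffZ mcoeffX eqxx mulr1 big1 ?addr0 // => j ji.
  rewrite mcoeffZ mcoeffX; case: eqP => [/mon_inj/enum_val_inj ij|]; last by rewrite mulr0.
  by rewrite ij eqxx in ji.
move=> x; pose G := \sum_i c 0 i *: P (enum_val i).
have -> : F.@[fun i => (h i).@[x]] = G.@[x].
  rewrite !raddf_sum; apply: eq_bigr => i _; rewrite /= !mevalZ mevalX rmorph_prod.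
  by congr (_ * _); apply: eq_bigr => j _; rewrite rmorphXn mnmE.
suff -> : G = 0 by rewrite meval0.
apply/mpolyP=> u; rewrite mcoeff0 raddf_sum /=.
have [u_lt|] := boolP [forall i, u i < B]%N.
  pose u' : colT := [ffun i => Ordinal (forallP u_lt i)].
  have uE : mon _ _ u' = u by apply/mnmP=> i; rewrite mnmE ffunE.
  have := congr1 (fun v : 'rV_ _ => v 0 (enum_rank u')) cA; rewrite !mxE; apply: etrans.
  by apply: eq_bigr => i _; rewrite mcoeffZ mxE enum_rankK uE.
rewrite negb_forall => /existsP[o]; rewrite -leqNgt => le_Bu.
rewrite big1 // => j _; rewrite mcoeffZ; apply/eqP; rewrite mulf_eq0 mcoeff_eq0.
apply/orP; right; apply: msize_mdeg_ge.
apply: leq_trans (msize_prod_exp h_b (fun i => leq_ord (enum_val j i))) _.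
apply: leq_trans le_Bu _; by rewrite mdegE (bigD1 o) //= leq_addr.
Qed.

(** Translate c to the origin and substitute a curve with velocity u: the
    lowest order term in t is the lowest homogeneous component of F at u, which
    therefore vanishes for all u. *)
Lemma curves_determine (k : nat) (S : ('I_k -> K) -> Prop) (c : 'I_k -> K)
    (F : {mpoly K[k]}) :
    (forall u : 'I_k -> K, exists a b : 'I_k -> K, forall t,
       S (fun i => c i + t * (u i + t * (a i + t * b i)))) ->
    (forall y, S y -> F.@[y] = 0) ->
  F = 0.
Proof.
move=> curves F0; pose G := F \mPo [tuple 'X_i + (c i)%:MP | i < k].
have GE y : G.@[y] = F.@[fun i => c i + y i].
  rewrite comp_mpoly_meval; apply: meval_eq => i.
  by rewrite tnth_mktuple mevalD mevalXU mevalC addrC.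
suff G0 : G = 0.
  apply/eqP/negPn/negP => /mpoly_point[v]; apply/negP; rewrite negbK.
  have := GE (fun i => v i - c i); rewrite G0 meval0 => GE0.
  apply/eqP; rewrite [RHS]GE0; apply: meval_eq => i; rewrite addrC subrK //.
apply/eqP/negPn/negP => G_neq0.
(* the lowest nonzero homogeneous component *)
have [e [e_neq0 e_min]] : exists e, pihomog mdeg e G != 0 /\
    forall d, (d < e)%N -> pihomog mdeg d G = 0.
  have ex : exists e, pihomog mdeg e G != 0.
    have [/existsP[e eN]|] := boolP [exists e : 'I_(msize G), pihomog mdeg e G != 0].
      by exists e.
    rewrite negb_exists => /forallP none; case/negP: G_neq0; apply/eqP.
    rewrite [LHS](@pihomog_partitionE _ _ mdeg _ G (leqnn _)) big1 // => d _.
    by apply/eqP; have := none d; rewrite negbK.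
  exists (ex_minn ex); case: ex_minnP => e eN e_min; split=> // d lt_de.
  by apply/eqP; apply: contraTT lt_de => /e_min; rewrite -leqNgt.
have [u u_neq0] := mpoly_point e_neq0.
have [a [b S_ab]] := curves u.
pose w i : {poly K} := (u i)%:P + 'X * ((a i)%:P + 'X * (b i)%:P).
have wE t i : (w i).[t] = u i + t * (a i + t * b i).
  by rewrite !(hornerD, hornerM, hornerX, hornerC).
pose H d : {poly K} := curve_eval (pihomog mdeg d G) w.
pose N := maxn (msize G) e.+1.
have sumH : \sum_(d < N) 'X^d * H d = 0.
  apply: poly_vanish => t; rewrite horner_sum.
  have := F0 _ (S_ab t); rewrite -[LHS]/(F.@[fun i => c i + (fun j =>
    t * (u j + t * (a j + t * b j))) i]) -GE.
  rewrite (@pihomog_partitionE _ _ mdeg N G) ?leq_maxl // raddf_sum => {2}<-.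
  apply: eq_bigr => d _; rewrite /= (dhomog_scale _ _ (pihomogP _ _ _)).
  rewrite hornerM hornerXn curve_evalE; congr (_ * _).
  by apply: meval_eq => i; rewrite wE.
have eN : (e < N)%N by rewrite leq_max ltnSn orbT.
have : (\sum_(d < N) 'X^d * H d)`_e = 0 by rewrite sumH coef0.
rewrite coef_sum (bigD1 (Ordinal eN)) //= coefXnM ltnn subnn.
rewrite big1 ?addr0 => [|d]; last first.
  rewrite -val_eqE /= => de; rewrite coefXnM; case: ltngtP de => // lt_de _.
  by rewrite /H e_min // /curve_eval mmap0 coef0.
move=> H0; case/negP: u_neq0; apply/eqP; rewrite -[RHS]H0 -horner_coef0 curve_evalE.
by apply: meval_eq => i; rewrite wE mul0r addr0.
Qed.

End Dependence.

(** * Closures of cones swept out by maps *)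

Local Open Scope classical_set_scope.

Section Projective.
Variables (K : numFieldType) (D : nat).
Implicit Types (v : 'rV[K]_D) (L : pspace K D) (F G : {mpoly K[D]}).

Definition veval F v : K := F.@[fun i => v 0 i].

Lemma vevalZ F d c v : F \is d.-homog -> veval F (c *: v) = c ^+ d * veval F v.
Proof.
move=> /dhomog_scale <-; apply: meval_eq => i; by rewrite mxE.
Qed.

Definition span_line v (v0 : v != 0) : pspace K D :=
  exist _ <[v]>%VS (introT eqP (etrans (dim_vline v) (congr1 nat_of_bool v0))).

Lemma pspace_gen L : exists2 v, v != 0 & val L = <[v]>%VS.
Proof.
case: L => L /= /eqP dimL; exists (vpick L).
  by rewrite vpick0; apply: contra_eq_neq dimL => ->; rewrite dimv0.
apply/eqP; rewrite eq_sym eqEdim -memvE memv_pick dimL dim_vline.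
by rewrite vpick0; case: eqP dimL => // ->; rewrite dimv0.
Qed.

Lemma pvanish_gen F L v : homogeneous F -> val L = <[v]>%VS ->
  pvanish F L <-> veval F v = 0.
Proof.
move=> [d homF] Lv; split=> [|Fv u].
  by apply; rewrite Lv memv_line.
by rewrite Lv => /vlineP[k ->]; rewrite -/(veval _ _) (vevalZ _ _ homF) Fv mulr0.
Qed.

Section Swept.
Variables (X : Type) (psi : X -> 'rV[K]_D).

(** The Zariski closure of the projectivization of the image of psi. *)
Definition swept : set (pspace K D) :=
  [set L | forall F, homogeneous F -> (forall x, veval F (psi x) = 0) -> pvanish F L].

Lemma swept_closed : zariski_closed swept.
Proof.
exists [set F | homogeneous F /\ forall x, veval F (psi x) = 0].
  by move=> F [].
by apply/seteqP; split=> L HL F; [move=> []; apply: HL | move=> hF F0; apply: HL].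
Qed.

Lemma swept_line x (x0 : psi x != 0) : swept (span_line x0).
Proof. by move=> F hF F0; apply/(pvanish_gen hF (v := psi x)). Qed.

(** Holds for maps that are homogeneous of degree 3. *)
Definition cubic_cone := forall t x, exists x', psi x' = t ^+ 3 *: psi x.
(** On a cone the homogeneous components of F vanish separately, so F need not
    be homogeneous. *)
Lemma swept_vanish F L : cubic_cone -> (forall x, veval F (psi x) = 0) ->
  swept L -> pvanish F L.
Proof.
move=> cone F0 SL v vL.
rewrite [F](@pihomog_partitionE _ _ mdeg _ F (leqnn _)) raddf_sum big1 // => d _ /=.
apply: SL vL; first by exists d; apply: pihomogP.
move=> x; apply: pihomog_vanish => t _; have [x' x'E] := cone t x.
by rewrite -[RHS](F0 x'); apply: meval_eq => i; rewrite x'E mxE.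
Qed.

End Swept.

Lemma swept_mono (X X' : Type) (psi : X -> 'rV[K]_D) (psi' : X' -> 'rV[K]_D) :
  (forall x, exists x', psi' x' = psi x) -> swept psi `<=` swept psi'.
Proof. by move=> sub L SL F hF F0; apply: SL => // x; have [x' <-] := sub x. Qed.

(** If two homogeneous polynomials do not vanish identically on the image, then
    neither does their product, because the polynomials in the parameters form a
    domain. *)
Lemma swept_irreducible M (psi : ('I_M -> K) -> 'rV[K]_D) (h : 'I_D -> {mpoly K[M]}) :
    (forall x j, psi x 0 j = (h j).@[x]) -> (exists x, psi x != 0) ->
  irreducible (swept psi).
Proof.
move=> psiE [x0 psi0]; split.
  by exists (span_line psi0); apply: swept_line.
have pullE F x : veval F (psi x) = (F \mPo [tuple h j | j < D]).@[x].
  by rewrite comp_mpoly_meval; apply: meval_eq => i; rewrite tnth_mktuple psiE.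
have pullN0 F x : veval F (psi x) != 0 -> F \mPo [tuple h j | j < D] != 0.
  by rewrite pullE; apply: contraNneq => ->; rewrite meval0.
move=> A B [IA homA ->] [IB homB ->] sAB.
apply: contrapT => nAB.
have sep I : I `<=` (fun F => homogeneous F) ->
    ~ swept psi `<=` [set L | forall F, I F -> pvanish F L] ->
    exists F x, I F /\ veval F (psi x) != 0.
  move=> homI nI; apply: contrapT => none; apply: nI => L SL F IF.
  apply: SL; first exact: homI.
  by move=> x; apply/eqP/negPn/negP => Fx; apply: none; exists F, x.
have [F [x [IF /pullN0 Fx]]] := sep _ homA (fun sA => nAB (or_introl sA)).
have [G [y [IG /pullN0 Gy]]] := sep _ homB (fun sB => nAB (or_intror sB)).
have [j psi0j] : exists j, psi x0 0 j != 0.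
  by move: psi0; rewrite matrix_eq0; case/existsP=> i; rewrite ord1 => /existsP.
(* the third factor keeps psi z away from zero *)
have Xj : 'X_j \mPo [tuple h j | j < D] != 0.
  by apply: (pullN0 _ x0); rewrite /veval mevalXU.
have [z] := mpoly_point (mulf_neq0 (mulf_neq0 Fx Gy) Xj).
rewrite !mevalM !mulf_eq0 !negb_or -andbA -!pullE => /and3P[Fz Gz Xz].
have psiz : psi z != 0 by apply: contraNneq Xz => ->; rewrite /veval mevalXU mxE.
case: (sAB _ (swept_line (x0 := psiz))) => [/(_ F IF)|/(_ G IG)] van.
  by case/negP: Fz; apply/eqP; apply: van; apply: memv_line.
by case/negP: Gz; apply/eqP; apply: van; apply: memv_line.
Qed.
End Projective.

(** * An upper bound for chains of irreducible closed sets *)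

Section UpperBound.
Variables (K : numFieldType) (D : nat).
Implicit Types (v : 'rV[K]_D) (L : pspace K D) (F G : {mpoly K[D]}).
Implicit Types (Z : set (pspace K D)).

Definition cone Z : set 'rV[K]_D := [set v | exists2 L, Z L & v \in val L].

(** Irreducibility of Z as primality of the ideal of its cone.  The polynomial
    p need not be homogeneous, but its components can be treated one by one since
    the cone is invariant under scaling. *)
Lemma cone_cancel Z g p : irreducible Z -> homogeneous g ->
    (exists2 L, Z L & ~ pvanish g L) ->
    (forall v, cone Z v -> veval g v * veval p v = 0) ->
  forall v, cone Z v -> veval p v = 0.
Proof.
move=> [_ irr] homg [L0 ZL0 gL0] gp0 v [L ZL vL].
have [d gd] := homg.
rewrite /veval [p](@pihomog_partitionE _ _ mdeg _ p (leqnn _)) raddf_sum big1 // => e _ /=.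
set q := pihomog mdeg e p.
have homq : homogeneous q by exists e; apply: pihomogP.
have closed1 F : homogeneous F -> zariski_closed [set L | pvanish F L].
  move=> homF; exists [set F] => [_ ->//|].
  by apply/seteqP; split=> L' /= FL' => [_ ->//|]; apply: FL'.
have cover : Z `<=` [set L | pvanish g L] `|` [set L | pvanish q L].
  move=> L' ZL'; have [u u0 L'u] := pspace_gen L'.
  have [gu|gu] := eqVneq (veval g u) 0; [left|right]; apply/(pvanish_gen _ L'u) => //.
  apply: pihomog_vanish => t t0.
  have /gp0/eqP : cone Z (t ^+ 3 *: u).
    by exists L' => //; rewrite L'u memvZ ?memv_line.
  rewrite (vevalZ _ _ gd) !mulf_eq0 !expf_eq0 (negPf t0) (negPf gu) !andbF /=.
  by move=> /eqP pu; apply: etrans pu; apply: meval_eq => i; rewrite mxE.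
case: (irr _ _ (closed1 _ homg) (closed1 _ homq) cover) => [/(_ _ ZL0)//|/(_ _ ZL)].
exact.
Qed.

(** Algebraic independence of the restrictions of the f_i to C. *)
Definition independent_on k (C : set 'rV[K]_D) (f : 'I_k -> {mpoly K[D]}) : Prop :=
  forall P : {mpoly K[k]},
    (forall v, C v -> P.@[fun i => veval (f i) v] = 0) -> P = 0.

Definition extend_family k (f : 'I_k -> {mpoly K[D]}) g (i : 'I_k.+1) :=
  if unlift ord_max i is Some j then f j else g.

(** Let P (f, g) vanish on the cone of Z.  On C, where g vanishes, this says
    that the constant term of P in its last variable vanishes at f, hence is 0.
    So P is divisible by the last variable; cancel g and repeat. *)
Lemma independent_extend k (C : set 'rV[K]_D) (f : 'I_k -> {mpoly K[D]}) Z g :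
    irreducible Z -> C `<=` cone Z -> independent_on C f -> homogeneous g ->
    (forall v, C v -> veval g v = 0) -> (exists2 L, Z L & ~ pvanish g L) ->
  independent_on (cone Z) (extend_family f g).
Proof.
move=> irrZ CZ indf homg gC gZ P P0; apply: muni_eq0.
have : forall v, cone Z v ->
    (map_poly (meval (fun i => veval (f i) v)) (muni P)).[veval g v] = 0.
  move=> v /P0; rewrite meval_muni /extend_family unlift_none; apply: etrans.
  congr (_.[_]); apply: eq_map_poly => q; apply: meval_eq => i.
  have -> : widen_ord (leqnSn k) i = lift ord_max i by apply/esym/val_inj/lift_max.
  by rewrite liftK.
elim/poly_ind: (muni P) => // Q c IHQ Q0.
have c0 : c = 0.
  apply: indf => v Cv; have := Q0 v (CZ _ Cv).
  rewrite gC // rmorphD rmorphM /= map_polyX map_polyC /=.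
  by rewrite hornerD hornerM hornerX hornerC mulr0 add0r.
rewrite c0 IHQ ?mul0r ?addr0 // => v Zv.
pose p : {mpoly K[D]} := (map_poly (comp_mpoly [tuple f i | i < k]) Q).[g].
have pE u : (map_poly (meval (fun i => veval (f i) u)) Q).[veval g u] = veval p u.
  rewrite /veval /p -horner_map -map_poly_comp; congr (_.[_]).
  apply: eq_map_poly => q; rewrite /= comp_mpoly_meval; apply: meval_eq => i.
  by rewrite tnth_mktuple.
rewrite pE; apply: (cone_cancel irrZ homg gZ) Zv => u Zu.
have := Q0 u Zu; rewrite c0 addr0 rmorphM /= map_polyX hornerM hornerX pE => <-.
by rewrite mulrC.
Qed.

(** The cone of the first member carries one independent function, a
    coordinate; every strict inclusion adds a polynomial that vanishes on the
    smaller set only. *)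
Lemma chain_independent e (Z : 'I_e.+1 -> set (pspace K D)) (i : nat) (ie : (i < e.+1)%N):
    (forall i, zariski_closed (Z i)) -> (forall i, irreducible (Z i)) ->
    (forall i j : 'I_e.+1, (i < j)%N -> Z i `<` Z j) ->
  exists f : 'I_i.+1 -> {mpoly K[D]}, independent_on (cone (Z (Ordinal ie))) f.
Proof.
move=> clZ irrZ incZ; elim: i ie => [|i IHi] ie.
  have [[L ZL] _] := irrZ (Ordinal ie).
  have [v v0 Lv] := pspace_gen L.
  have [j vj] : exists j, v 0 j != 0.
    by move: v0; rewrite matrix_eq0; case/existsP=> a; rewrite ord1 => /existsP.
  pose f0 (i : 'I_0) : {mpoly K[D]} := 0.
  exists (extend_family f0 'X_j); apply: (@independent_extend _ [set 0]) => //.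
  - by move=> _ ->; exists L; rewrite ?mem0v.
  - move=> P /(_ 0 erefl) P0; rewrite -(mpolyKC P).
    by move: P0; rewrite -{1}(mpolyKC P) mevalC /= => ->; rewrite mpolyC0.
  - by exists 1%N; rewrite dhomogX /= mdeg1.
  - by move=> _ ->; rewrite /veval mevalXU mxE.
  exists L => // /(_ v); rewrite Lv memv_line mevalXU => /(_ erefl) /eqP.
  by apply/negP.
have ie' : (i < e.+1)%N by apply: ltnW.
have [f indf] := IHi ie'.
have [sub nsub] : Z (Ordinal ie') `<` Z (Ordinal ie) by apply: incZ.
have [I homI ZI] := clZ (Ordinal ie').
have [g [Ig gZ]] : exists g, I g /\ exists2 L, Z (Ordinal ie) L & ~ pvanish g L.
  apply: contrapT => none; apply: nsub => L ZL; rewrite ZI => g Ig.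
  by apply: contrapT => gL; apply: none; exists g; split=> //; exists L.
exists (extend_family f g); apply: (independent_extend _ _ indf) => //.
- by move=> v [L ZL vL]; exists L => //; apply: sub.
- exact: homI.
by move=> v [L]; rewrite ZI => /(_ g Ig) + vL; apply.
Qed.

(** e + 1 functions that are independent on the last member of the chain pull
    back to e + 1 independent polynomials in M variables. *)
Lemma swept_dim_le M (psi : ('I_M -> K) -> 'rV[K]_D) (h : 'I_D -> {mpoly K[M]})
    (X : set (pspace K D)) e :
    (forall x j, psi x 0 j = (h j).@[x]) -> cubic_cone psi -> X `<=` swept psi ->
  irreducible_chain X e -> (e < M)%N.
Proof.
move=> psiE conepsi sX [Z [HZ incZ]].
have [f indf] := chain_independent (ltnSn e) (fun i => let: And3 c _ _ := HZ i in c)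
  (fun i => let: And3 _ c _ := HZ i in c) incZ.
rewrite ltnNge; apply/negP => le_Me.
have [F /eqP F0 Fh] := algebraic_dependence
  (fun i => f i \mPo [tuple h j | j < D]) (le_Me : (M < e.+1)%N).
apply: F0; apply: indf => v [L ZL vL].
have /(_ _ vL) : pvanish (F \mPo [tuple f i | i < e.+1]) L.
  have [_ _ ZX] := HZ (Ordinal (ltnSn e)).
  apply: (swept_vanish conepsi) (sX _ (ZX _ ZL)) => x; apply: etrans (Fh x).
  rewrite /veval comp_mpoly_meval; apply: meval_eq => i.
  rewrite tnth_mktuple comp_mpoly_meval; apply: meval_eq => j.
  by rewrite tnth_mktuple psiE.
rewrite comp_mpoly_meval; apply: etrans; apply: meval_eq => i.
by rewrite tnth_mktuple.
Qed.
End UpperBound.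

(** * Sums of decomposable trivectors and their derivatives *)

(** Trivectors have coordinates indexed by increasing triples, whereas the
    minors were built with arbitrary triples. *)
Definition index_triple N (j : 'I_(extdim N 3)) : triple :=
  let t := enum_val j : 3.-tuple 'I_N in
  (val (tnth t ord0), val (tnth t (inord 1)), val (tnth t ord_max)).

Lemma index_triple_below N (j : 'I_(extdim N 3)) : below N (index_triple j).
Proof. by rewrite /below /index_triple !ltn_ord. Qed.

Lemma index_tripleP N i j k : (i < j < k)%N -> (k < N)%N ->
  exists a : 'I_(extdim N 3), index_triple a = (i, j, k).
Proof.
move=> /andP[ij jk] kN; have jN := ltn_trans jk kN; have iN := ltn_trans ij jN.
pose t : 3.-tuple 'I_N := [tuple Ordinal iN; Ordinal jN; Ordinal kN].
have tB : t \in extbasis N 3 by rewrite inE /= ij jk.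
exists (enum_rank_in tB t).
by rewrite /index_triple enum_rankK_in // !(tnth_nth (Ordinal iN)) /= !inordK.
Qed.

Lemma sort_triple (R : comNzRingType) N t : below N t ->
  exists e : R, exists j : option 'I_(extdim N 3), forall p : point R,
    volume p t = if j is Some j' then e * volume p (index_triple j') else 0.
Proof.
case: t => [[i j] k] /and3P[iN jN kN].
have sorted_case a b c (e : R) : (a < b < c)%N -> (c < N)%N ->
    (forall p : point R, volume p (i, j, k) = e * volume p (a, b, c)) ->
    exists e : R, exists j' : option 'I_(extdim N 3), forall p : point R,
    volume p (i, j, k) = if j' is Some j' then e * volume p (index_triple j') else 0.
  move=> abc cN eE; have [n nE] := index_tripleP abc cN.
  by exists e, (Some n) => p; rewrite nE.
have degenerate : [|| i == j, j == k | i == k] ->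
    exists e : R, exists j' : option 'I_(extdim N 3), forall p : point R,
    volume p (i, j, k) = if j' is Some j' then e * volume p (index_triple j') else 0.
  move=> eq; exists 0, None => p; rewrite /volume /det3.
  by case/or3P: eq => /eqP->; ring.
case: (ltngtP i j) => [ij|ij|/eqP ij]; last by apply: degenerate; rewrite ij.
  case: (ltngtP j k) => [jk|jk|/eqP jk]; last by apply: degenerate; rewrite jk orbT.
    by apply: (sorted_case i j k 1); rewrite ?ij // => p; rewrite mul1r.
  case: (ltngtP i k) => [ik|ik|/eqP ik]; last by apply: degenerate; rewrite ik !orbT.
    by apply: (sorted_case i k j (-1)); rewrite ?ik // => p; rewrite /volume /det3; ring.
  by apply: (sorted_case k i j 1); rewrite ?ik // => p; rewrite /volume /det3; ring.
case: (ltngtP i k) => [ik|ik|/eqP ik]; last by apply: degenerate; rewrite ik !orbT.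
  by apply: (sorted_case j i k (-1)); rewrite ?ij // => p; rewrite /volume /det3; ring.
case: (ltngtP j k) => [jk|jk|/eqP jk]; last by apply: degenerate; rewrite jk orbT.
  by apply: (sorted_case j k i 1); rewrite ?jk // => p; rewrite /volume /det3; ring.
by apply: (sorted_case k j i (-1)); rewrite ?jk // => p; rewrite /volume /det3; ring.
Qed.

Section Sums.
Variables (K : numFieldType) (N s : nat).
Implicit Types (pts q : nat -> point K).
Local Notation D := (extdim N 3).

Definition wedge_sum pts : 'rV[K]_D :=
  \row_j \sum_(i < s) volume (pts i) (index_triple j).

Definition directional pts q : 'rV[K]_D :=
  \row_j \sum_(i < s) \sum_(r < 3) volume (set_row (pts i) r (q i r)) (index_triple j).

(** The derivative of p_0 /\ p_1 /\ p_2 along q is the sum of the products in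
    which one q_r replaces p_r. *)
Lemma volume_line (p q : point K) tau t :
  volume (fun r l => p r l + tau * q r l) t =
    volume p t + tau * (\sum_(r < 3) volume (set_row p r (q r)) t +
      tau * (\sum_(r < 3) volume (set_row q r (p r)) t + tau * volume q t)).
Proof.
case: t => [[i j] k]; rewrite !big_ord_recl !big_ord0 /volume /set_row /det3 /=; ring.
Qed.

Lemma wedge_sum_line pts q : exists a b : 'rV[K]_D, forall tau,
  wedge_sum (fun i r l => pts i r l + tau * q i r l) =
    wedge_sum pts + tau *: (directional pts q + tau *: (a + tau *: b)).
Proof.
exists (directional q pts), (wedge_sum q) => tau; apply/rowP=> j; rewrite !mxE.
under eq_bigr do rewrite volume_line.
rewrite big_split; congr (_ + _); rewrite /= -mulr_sumr; congr (_ * _).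
rewrite big_split; congr (_ + _); rewrite /= -mulr_sumr; congr (_ * _).
by rewrite big_split; congr (_ + _); rewrite /= -mulr_sumr.
Qed.

(** Euler's relation for the cubic map [wedge_sum]. *)
Lemma directional_self pts : directional pts pts = 3%:R *: wedge_sum pts.
Proof.
apply/rowP=> j; rewrite !mxE mulr_sumr; apply: eq_bigr => i _.
rewrite (eq_bigr (fun=> volume (pts i) (index_triple j))) => [|r _].
  by rewrite sumr_const card_ord mulr_natl.
rewrite /volume /set_row; case: r => [[|[|[|//]]] /= _] //.
Qed.

Lemma directional_sum pts m (u : 'I_m -> K) (v : 'I_m -> nat -> point K) :
  directional pts (fun i r l => \sum_a u a * v a i r l)
    = \sum_a u a *: directional pts (v a).
Proof.
apply/rowP=> j; rewrite summxE !mxE; under [RHS]eq_bigr do rewrite !mxE mulr_sumr.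
rewrite [RHS]exchange_big; apply: eq_bigr => i _.
under [RHS]eq_bigr do rewrite mulr_sumr.
rewrite [RHS]exchange_big; apply: eq_bigr => r _ /=.
case: (index_triple j) => [[x y] z].
have [A [B [C volE]]] := volume_linear (pts i) x y z (ltn_ord r).
rewrite volE !mulr_suml -!big_split; apply: eq_bigr => a _ /=.
by rewrite volE; ring.
Qed.

Definition unit_direction (x : nat * nat * nat) : nat -> point K :=
  fun i r l => ((i, r, l) == x)%:R.

Lemma directional_unit pts x : (x.1.1 < s)%N -> (x.1.2 < 3)%N ->
  directional pts (unit_direction x) = \row_j jacobian pts x (index_triple j).
Proof.
case: x => [[i r] l] /= i_s r3; apply/rowP=> j; rewrite !mxE.
have zero i' r' : volume (set_row (pts i') r' (fun=> 0)) (index_triple j) = 0 \/ (3 <= r')%N.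
  case: (ltnP r' 3) => r'3; [left|by right].
  case: (index_triple j) => [[a b] c].
  by have [A [B [C ->]]] := volume_linear (pts i') a b c r'3; ring.
have zeroE i' (r' : 'I_3) c : c =1 (fun=> 0) ->
    volume (set_row (pts i') r' c) (index_triple j) = 0.
  move=> c0; have [<-|] := zero i' r'; last by rewrite leqNgt ltn_ord.
  by congr (volume (set_row _ _ _) _); apply/funext.
rewrite (bigD1 (Ordinal i_s)) //= [X in _ + X]big1 ?addr0 => [|i' i'i]; last first.
  rewrite big1 // => r' _; apply: zeroE => l'; rewrite /unit_direction.
  by move: i'i; rewrite -val_eqE /= !xpair_eqE => /negPf->.
rewrite (bigD1 (Ordinal r3)) //= [X in _ + X]big1 ?addr0 => [|r' r'r]; last first.
  apply: zeroE => l'; rewrite /unit_direction.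
  by move: r'r; rewrite -val_eqE /= !xpair_eqE => /negPf->; rewrite andbF.
rewrite /jacobian tangent_set_row; congr (volume (set_row _ _ _) _); apply/funext=> l'.
by rewrite /unit_direction !xpair_eqE !eqxx.
Qed.
End Sums.

(** * A chain of the expected length *)

Lemma rmorph_volume (R S : comNzRingType) (f : {rmorphism R -> S}) (p : point R) t :
  f (volume p t) = volume (fun r l => f (p r l)) t.
Proof.
by case: t => [[i j] k]; rewrite /volume /det3 !(rmorphD, rmorphN, rmorphM).
Qed.

Section Chain.
Variables (K : numFieldType) (N s : nat).
Implicit Types (pts q : nat -> point K).
Local Notation D := (extdim N 3).
Local Notation wedge_sum := (@wedge_sum K N s).
Local Notation directional := (@directional K N s).

Definition wedge_poly M (P : nat -> point {mpoly K[M]}) (j : 'I_D) : {mpoly K[M]} :=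
  \sum_(i < s) volume (P i) (index_triple j).

Lemma wedge_polyE M (P : nat -> point {mpoly K[M]}) x j :
  wedge_sum (fun i r l => (P i r l).@[x]) 0 j = (wedge_poly P j).@[x].
Proof.
rewrite mxE /wedge_poly raddf_sum; apply: eq_bigr => i _.
by rewrite /= (rmorph_volume (meval x)).
Qed.

Lemma wedge_sum_scale pts c :
  wedge_sum (fun i r l => c * pts i r l) = c ^+ 3 *: wedge_sum pts.
Proof.
apply/rowP=> j; rewrite !mxE mulr_sumr; apply: eq_bigr => i _.
by case: (index_triple j) => [[x y] z]; rewrite /volume /det3; ring.
Qed.

(** The columns of a minor become columns indexed by increasing triples.
    Moving the configuration in addition towards one whose sum is
    e_0 /\ e_1 /\ e_2 makes the sum itself nonzero. *)
Lemma generic_rank_jacobian r : generic_rank_ge K N s r -> (0 < s)%N -> (3 <= N)%N ->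
  exists pts, exists x : 'I_r -> nat * nat * nat,
    [/\ forall a, ((x a).1.1 < s /\ (x a).1.2 < 3)%N,
        row_free (\matrix_(a < r, j < D) jacobian pts (x a) (index_triple j))
      & wedge_sum pts != 0].
Proof.
move=> [pts0 minor0] s0 N3.
pose star (i r l : nat) : K := ((i == 0) && (r == l))%N%:R.
pose line i r l : {poly K} := (pts0 i r l)%:P + 'X * (star i r l - pts0 i r l)%:P.
pose fam t i r l := pts0 i r l + t * (star i r l - pts0 i r l).
have lineE t i r' l : (line i r' l).[t] = fam t i r' l.
  by rewrite hornerD hornerM hornerX !hornerC.
pose valid (x : nat * nat * nat) := [&& x.1.1 < s, x.1.2 < 3 & x.2 < N]%N.
have [|g g0 gP] := @jacobian_generic K nat valid (below N) r line fam 0 lineE.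
  by apply: eq_jacobian minor0 => i r' l; rewrite /fam mul0r addr0.
have [j0 j0E] : exists j : 'I_D, index_triple j = (0, 1, 2)%N by apply: index_tripleP.
pose w : {poly K} := \sum_(i < s) volume (line i) (index_triple j0).
have wE t : w.[t] = wedge_sum (fam t) 0 j0.
  rewrite mxE horner_sum; apply: eq_bigr => i _.
  rewrite -horner_evalE rmorph_volume; congr (volume _ _).
  by do 2 (apply/funext => ?); apply: lineE.
have w0 : w != 0.
  apply: contra_neq (oner_neq0 K) => w0.
  have := wE 1; rewrite w0 horner0 mxE (bigD1 (Ordinal s0)) //= big1 => [->|i i0].
    by rewrite j0E /volume /det3 /fam /star /=; ring.
  rewrite j0E /volume /det3 /fam /star /=.
  by move: i0; rewrite -val_eqE /= => /negPf->; ring.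
have [|t /= /and3P[/gP[x [y [xP yP d]]] wt _]] := @exists_non_root K [:: g; w].
  by rewrite /= g0 w0.
exists (fam t), x; split=> [a||]; first by have /and3P[] := xP a.
  set M := \matrix_(a, b) _ in d.
  have M_unit : M \in unitmx by rewrite unitmxE unitfE.
  have [|c cE] := @choice _ _ (fun b (c : 'I_D -> K) => forall p : point K,
      volume p (y b) = \sum_j volume p (index_triple j) * c j).
    move=> b.
    have [e [[j|] eE]] := sort_triple K (yP b).
      exists (fun j' => (j' == j)%:R * e) => p; rewrite eE (bigD1 j) //= eqxx.
      rewrite big1 => [|j' /negPf->]; last by rewrite mul0r mulr0.
      by rewrite addr0 mul1r mulrC.
    by exists (fun=> 0) => p; rewrite eE big1 // => j _; rewrite mulr0.
  apply/row_freeP; exists ((\matrix_(j, b) c b j) *m invmx M).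
  rewrite mulmxA -(mulmxV M_unit); congr (_ *m _); apply/matrixP=> a b.
  rewrite !mxE /jacobian tangent_set_row cE; apply: eq_bigr => j _.
  by rewrite !mxE /jacobian tangent_set_row.
by apply: contraNneq wt => w1; rewrite wE w1 mxE.
Qed.

(** At a general configuration the sum w is nonzero and, by Euler's relation,
    a tangent vector; it is completed to r + 1 independent tangent vectors, the
    derivatives along the directions v_0 = pts, v_1, ..., v_r.  The k-th member of
    the chain is swept by the combinations of v_0, ..., v_k.  If the member j were
    contained in an earlier member i, then a polynomial relation F between the
    first j + 1 dual coordinates on the member i, which has only i + 1 parameters,
    would hold on the member j as well.  There curves through v_0 have arbitrary
    velocities in these coordinates, so that F = 0. *)
Lemma wedge_sum_chain r : generic_rank_ge K N s r.+1 -> (0 < s)%N -> (3 <= N)%N ->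
  irreducible_chain (swept wedge_sum) r.
Proof.
move=> goodr s0 N3; have [pts [x [x_ok free pts0]]] := generic_rank_jacobian goodr s0 N3.
set B := \matrix_(a, j) _ in free.
pose w := directional pts pts : 'rV_D.
have w0 : w != 0 by rewrite /w directional_self scaler_eq0 negb_or pts0 pnatr_eq0.
have [sel freew] : exists sel : 'I_r -> 'I_r.+1, row_free (col_mx w (rowsub sel B)).
  (* modulo w the rank drops by one at most *)
  pose B' := B *m cokermx w.
  have rankB' : (r <= \rank B')%N.
    have := mxrank_mul_ker B (cokermx w); rewrite (eqnP free) -/B' => E.
    have : (\rank (B :&: kermx (cokermx w)) <= 1)%N.
      apply: leq_trans (mxrankS (capmxSr _ _)) _.
      by rewrite mxrank_ker mxrank_coker rank_rV w0 leq_subLR; lia.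
    by move: E; lia.
  pose a i := maxrankfun B' (widen_ord rankB' i).
  have free' : row_free (rowsub a B').
    rewrite /a -[rowsub _ _]/(rowsub (maxrankfun B' \o widen_ord rankB') B').
    rewrite rowsub_comp row_free_rowsub ?maxrowsub_free //.
    by move=> i j /(congr1 val) eq_ij; apply: val_inj.
  exists a; apply: inj_row_free => v; rewrite -[v]hsubmxK mul_row_col => v0.
  have v2 : rsubmx v = 0.
    apply: (row_free_inj free'); rewrite mul0mx /B' -mul_rowsub_mx mulmxA.
    have := congr1 (mulmx^~ (cokermx w)) v0.
    by rewrite mulmxDl -[lsubmx v *m w *m _]mulmxA mulmx_coker mulmx0 add0r mul0mx ;apply.
  have v1 : lsubmx v = 0.
    move: v0; rewrite v2 mul0mx addr0 [lsubmx v]mx11_scalar mul_scalar_mx => /eqP.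
    by rewrite scaler_eq0 (negPf w0) orbF => /eqP->; rewrite raddf0.
  by rewrite v1 v2 row_mx0.
pose v (a : nat) : nat -> point K :=
  if a is b.+1 then (if insub b is Some c then unit_direction K (x (sel c)) else pts)
  else pts.
have vE (a : 'I_r.+1) : directional pts (v a) = row a (col_mx w (rowsub sel B)).
  have [b ab|b ab] := splitP (a : 'I_(1 + r)).
    have -> : a = lshift r b by apply: val_inj.
    by apply: etrans (esym (rowKu _ _ _)); rewrite ord1 row_id /v.
  have -> : a = rshift 1 b by apply: val_inj.
  apply: etrans (esym (rowKd _ _ _)); rewrite row_rowsub /v; have [xs x3] := x_ok (sel b).
  rewrite /= valK.
  by rewrite directional_unit //; apply/rowP=> j; rewrite !mxE.
have [Y CY] := row_freeP freew.
pose psi k (u : 'I_k -> K) := wedge_sum (fun i r l => \sum_a u a * v a i r l).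
pose P k i r l : {mpoly K[k]} := \sum_a 'X_a * (v a i r l)%:MP.
have psiE k u j : psi k u 0 j = (wedge_poly (P k) j).@[u].
  rewrite -wedge_polyE; congr (wedge_sum _ _ _); do 3 apply/funext=> ?.
  by rewrite raddf_sum; apply: eq_bigr => a _; rewrite /= mevalM mevalXU mevalC.
have psi_cone k : cubic_cone (psi k).
  move=> c u; exists (fun a => c * u a); rewrite -wedge_sum_scale.
  congr wedge_sum; do 3 apply/funext=> ?; rewrite mulr_sumr.
  by apply: eq_bigr => a _; rewrite mulrA.
have psi_pad k k' u : (k <= k')%N -> exists u', psi k' u' = psi k u.
  move=> le_kk'; exists (fun a => if insub (val a) is Some b then u b else 0).
  congr wedge_sum; do 3 apply/funext=> ?.
  rewrite (bigID (fun a : 'I_k' => a < k)%N) /= [X in _ + X]big1 ?addr0 => [|a ak].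
    rewrite (big_ord_narrow le_kk') /=; apply: eq_bigr => a _.
    by rewrite insubT // => ak; rewrite (_ : Sub _ _ = a) //; apply: val_inj.
  by rewrite insubN ?mul0r.
have psi_sub k k' : (k <= k')%N -> swept (psi k) `<=` swept (psi k').
  by move=> le_kk'; apply: swept_mono => u; apply: psi_pad.
pose u0 k : 'I_k.+1 -> K := fun a => (a == ord0)%:R.
have sum_u0 k i r' l : \sum_a u0 k a * v a i r' l = pts i r' l.
  rewrite big_ord_recl /u0 eqxx mul1r big1 ?addr0 // => a _.
  by rewrite mul0r.
have psi_u0 k : psi k.+1 (u0 k) = wedge_sum pts.
  by congr wedge_sum; do 3 apply/funext=> ?; apply: sum_u0.
have vY a c : (a < r.+1)%N -> (c < r.+1)%N ->
    (directional pts (v a) *m Y) 0 (inord c) = (a == c)%:R.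
  move=> ar cr; rewrite (vE (Ordinal ar)) -row_mul CY.
  by rewrite !mxE -val_eqE /= inordK.
exists (fun k => swept (psi k.+1)); split=> [k|i j ij].
  split; first exact: swept_closed.
    by apply: (swept_irreducible (psiE _)); exists (u0 k); rewrite psi_u0.
  by apply: swept_mono => u; eexists.
split; first by apply: psi_sub; apply: ltnW.
move=> sub_ji.
(* the coordinates dual to the tangent vectors *)
pose y k (a : 'I_k) : {mpoly K[D]} := \sum_l (Y l (inord a)) *: 'X_l.
have yE k (a : 'I_k) z : veval (y k a) z = (z *m Y) 0 (inord a).
  rewrite /veval raddf_sum mxE; apply: eq_bigr => l _.
  by rewrite /= mevalZ mevalXU mulrC.
have [F /eqP F0 Fy] := algebraic_dependence
  (fun a => y j.+1 a \mPo [tuple wedge_poly (P i.+1) l | l < D]) (ij : (i.+1 < j.+1)%N).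
apply: F0; pose S (z : 'I_j.+1 -> K) := exists u, z = fun a => veval (y _ a) (psi j.+1 u).
apply: (@curves_determine _ _ S (fun a => veval (y _ a) (wedge_sum pts))) => [u|_ [u ->]].
  have [a [b abE]] := wedge_sum_line N s pts (fun i r l => \sum_a u a * v a i r l).
  exists (fun c => veval (y _ c) a), (fun c => veval (y _ c) b) => t.
  exists (fun c => u0 j c + t * u c); apply/funext=> c.
  have -> : psi j.+1 (fun c => u0 j c + t * u c) = wedge_sum pts +
      t *: (\sum_a u a *: directional pts (v a) + t *: (a + t *: b)).
    rewrite -directional_sum -abE; congr wedge_sum; do 3 apply/funext=> ?.
    by under eq_bigr do rewrite mulrDl -mulrA; rewrite big_split -mulr_sumr sum_u0.
  have jr : (j.+1 <= r.+1)%N := ltn_ord j.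
  have lt_r (a' : 'I_j.+1) : (a' < r.+1)%N := leq_trans (ltn_ord a') jr.
  have uE : ((\sum_a u a *: directional pts (v a)) *m Y) 0 (inord c) = u c.
    rewrite mulmx_suml summxE (bigD1 c) //= -scalemxAl mxE vY // eqxx mulr1.
    rewrite big1 ?addr0 // => a'; rewrite -val_eqE /= => a'c.
    by rewrite -scalemxAl mxE vY // (negPf a'c) mulr0.
  rewrite !yE -uE !mulmxDl -!scalemxAl !mulmxDl -!scalemxAl mulmxDl -scalemxAl.
  move: (_ *m Y) (_ *m Y) (_ *m Y) (_ *m Y) => A1 A2 A3 A4.
  by rewrite !mxE.
have [L ZL uL] : exists2 L, swept (psi j.+1) L & psi j.+1 u \in val L.
  have [u1|u1] := eqVneq (psi j.+1 u) 0.
    have psi0N : psi j.+1 (u0 j) != 0 by rewrite psi_u0.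
    by exists (span_line psi0N); [apply: swept_line | rewrite u1 mem0v].
  by exists (span_line u1); [apply: swept_line | apply: memv_line].
have /(_ _ uL) : pvanish (F \mPo [tuple y j.+1 a | a < j.+1]) L.
  apply: swept_vanish (psi_cone _) _ (sub_ji _ ZL) => u'; rewrite -(Fy u').
  rewrite /veval comp_mpoly_meval; apply: meval_eq => a.
  rewrite tnth_mktuple comp_mpoly_meval; apply: meval_eq => l.
  by rewrite tnth_mktuple psiE.
rewrite comp_mpoly_meval; apply: etrans; apply: meval_eq => a.
by rewrite tnth_mktuple.
Qed.
End Chain.

(** * The secant variety as a swept closure *)

Section Wedge.
Variable K : fieldType.

Lemma wedge_mulmx k r (A : 'M[K]_r) (V : 'M_(r, k)) :
  wedge (A *m V) = \det A *: wedge V.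
Proof. by apply/rowP=> j; rewrite !mxE -mulmx_colsub det_mulmx. Qed.

(** A relation between the rows is a relation between the rows of every maximal
    minor. *)
Lemma row_free_wedge k r (M : 'M[K]_(r, k)) : wedge M != 0 -> row_free M.
Proof.
rewrite matrix_eq0; case/existsP=> i; rewrite ord1 => /existsP[j]; rewrite mxE => d.
apply: inj_row_free => v vM; set C := colsub _ _ in d.
have C_unit : C \in unitmx by rewrite unitmxE unitfE.
by rewrite -(mulmxK C_unit v) mulmx_colsub vM; apply/rowP=> a; rewrite !mxE big1 // => b _;
  rewrite !mxE mul0r.
Qed.

(** The rows of M span a point of the Grassmannian; the basis chosen for the
    definition of its Pluecker vector changes the latter by a determinant. *)
Lemma wedge_Gr k r (M : 'M[K]_(r.+1, k.+1)) : wedge M != 0 ->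
  exists2 L, Gr K r k L & wedge M \in val L.
Proof.
move=> M0; have freeM := row_free_wedge M0.
pose X := [tuple row i M | i < r.+1]; pose W := <<X>>%VS.
have dimW : \dim W = r.+1.
  rewrite -[RHS](size_tuple X); apply/eqP/freeP => c c0 i.
  have : \row_a c a = 0.
    apply: (row_free_inj freeM); rewrite mul0mx -[RHS]c0 mulmx_sum_row.
    by apply: eq_bigr => a _; rewrite mxE -tnth_nth tnth_mktuple.
  by move/rowP/(_ i); rewrite !mxE.
pose V := \matrix_(i < r.+1) (vbasis W)`_i.
have [A MA] : exists A, M = A *m V.
  have inW i : row i M \in W by apply: memv_span; apply/tnthP; exists i; rewrite tnth_mktuple.
  exists (\matrix_(i, j) coord (vbasis W) (cast_ord (esym dimW) j) (row i M)).
  apply/row_matrixP=> i; rewrite row_mul mulmx_sum_row.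
  rewrite (coord_vbasis (inW i)) (reindex (cast_ord (esym dimW))) /=; last first.
    by exists (cast_ord dimW) => j _; rewrite ?cast_ordK ?cast_ordKV.
  by apply: eq_bigr => j _; rewrite rowK !mxE.
have V0 : wedge V != 0.
  by move: M0; rewrite MA wedge_mulmx; apply: contraNneq => ->; rewrite scaler0.
have L1 : \dim (plucker r.+1 W) == 1%N by rewrite dim_vline V0.
exists (exist _ (plucker r.+1 W) L1 : pspace K _); first by exists W.
by rewrite /= MA wedge_mulmx memvZ // memv_line.
Qed.
End Wedge.

Section Secant.
Variables (K : numFieldType) (n s : nat).
Local Notation N := n.+1.
Local Notation D := (extdim N 3).
Local Notation wedge_sum := (@wedge_sum K N s).

Lemma wedge_volume (p : point K) :
  wedge (\matrix_(r < 3, l < N) p r l) = \row_j volume p (index_triple j).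
Proof.
apply/rowP=> j; rewrite !mxE /index_triple -det_volume; congr (\det _).
apply/matrixP=> a b; rewrite !mxE; congr (p a _).
by case: b => [[|[|[|//]]] b3] /=; congr (val (tnth _ _)); apply: val_inj; rewrite /= ?inordK.
Qed.

Lemma wedge_sumE pts :
  wedge_sum pts = \sum_(i < s) wedge (\matrix_(r < 3, l < N) pts i r l).
Proof.
apply/rowP=> j; rewrite summxE mxE; apply: eq_bigr => i _.
by rewrite wedge_volume mxE.
Qed.

Lemma exists_wedge_neq0 : (2 <= n)%N ->
  exists p : point K, wedge (\matrix_(r < 3, l < N) p r l) != 0.
Proof.
move=> n2; have [j jE] : exists j : 'I_D, index_triple j = (0, 1, 2)%N by apply: index_tripleP.
exists (fun r l => (r == l)%:R); apply/eqP=> /rowP/(_ j)/eqP.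
rewrite (wedge_volume (fun r l => (r == l)%:R)) !mxE jE /volume /det3 /=.
by rewrite !(mulr0, mul0r, mulr1, subr0, subrr, addr0) oner_eq0.
Qed.

(** A vector in the span of s decomposable ones is a sum of s decomposable
    ones, since the scalars can be moved into the first factors.  Conversely, the
    summands of [wedge_sum] are decomposable or zero; for a zero summand any point
    of the Grassmannian will do. *)
Lemma secant_swept : (0 < s)%N -> (2 <= n)%N -> secant s (Gr K 2 n) = swept wedge_sum.
Proof.
move=> s0 n2; have [p0 p0N] := exists_wedge_neq0 n2.
apply/seteqP; split.
  apply: smallest_sub; first exact: swept_closed.
  move=> L [x Gx sL].
  have [v v0 Lv] := pspace_gen L.
  have /memv_sumP[u xu vE] : v \in (\sum_i val (x i))%VS.
    by apply: (subvP sL); rewrite Lv memv_line.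
  have [|q qE] := @choice _ _ (fun (i : 'I_s) (q : point K) =>
      u i = wedge (\matrix_(r < 3, l < N) q r l)).
    move=> i; have [W _ xW] := Gx i; have := xu i isT; rewrite xW => /vlineP[c ->].
    set V := \matrix_i _ .
    exists (fun r l => (if r == 0%N then c else 1) * V (inord r) (inord l)).
    pose A : 'M[K]_3 := diag_mx (\row_r if r == ord0 then c else 1).
    have detA : \det A = c.
      by rewrite det_diag big_ord_recl !mxE big1 ?mulr1 // => i' _; rewrite mxE.
    rewrite -{1}detA -wedge_mulmx; congr wedge; apply/matrixP=> r l.
    by rewrite /A mul_diag_mx !mxE !inord_val.
  pose pts i : point K := if insub i is Some i' then q i' else fun _ _ => 0.
  have vE' : v = wedge_sum pts.
    by rewrite wedge_sumE vE; apply: eq_bigr => i _; rewrite qE /pts valK.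
  by move=> F hF F0; apply/(pvanish_gen hF Lv); rewrite vE'.
move=> L SL _ [[I homI ->] sI] F IF; apply: SL; first exact: homI.
have nonzero pts : wedge_sum pts != 0 -> veval F (wedge_sum pts) = 0.
  move=> w0; suff /sI/(_ F IF) : spanned s (Gr K 2 n) (span_line w0).
    by apply; apply: memv_line.
  have [|x xE] := @choice _ _ (fun (i : 'I_s) (L : pspace K D) =>
     Gr K 2 n L /\ wedge (\matrix_(r < 3, l < N) pts i r l) \in val L).
    move=> i; set w := wedge _.
    have [w_i|/wedge_Gr[L' ? ?]] := eqVneq w 0.
      by have [L' GL' _] := wedge_Gr p0N; exists L'; rewrite w_i mem0v.
    by exists L'.
  exists x => [i|]; first by have [] := xE i.
  rewrite /= -memvE wedge_sumE; apply: memv_sumr => i _.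
  by have [] := xE i.
move=> pts; have [w0|/nonzero//] := eqVneq (wedge_sum pts) 0.
(* a homogeneous F that vanishes at one nonzero vector vanishes at 0 *)
pose pts0 (i : nat) : point K := if i == 0%N then p0 else fun _ _ => 0.
have pts0E : wedge_sum pts0 = wedge (\matrix_(r < 3, l < N) p0 r l).
  rewrite wedge_sumE (bigD1 (Ordinal s0)) //= big1 ?addr0 // => i.
  rewrite -val_eqE /= /pts0 => /negPf->; apply/rowP=> j.
  by rewrite (wedge_volume (fun _ _ => 0)) !mxE; case: (index_triple j) => [[a b] c];
    rewrite /volume /det3; ring.
have [d hF] := homI _ IF.
by rewrite w0 -(scale0r (wedge_sum pts0)) (vevalZ _ _ hF) nonzero ?mulr0 // pts0E.
Qed.
End Secant.

(** * Charts and the dimension *)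

Section Bounds.
Variables (K : numFieldType).

Lemma eq_volume N (p q : point K) t : below N t ->
  (forall r l, (r < 3)%N -> (l < N)%N -> p r l = q r l) -> volume p t = volume q t.
Proof.
case: t => [[i j] k] /and3P[iN jN kN] pq; rewrite /volume /det3.
by rewrite !pq.
Qed.

Lemma ambient_dim_le D (X : set (pspace K D)) e : irreducible_chain X e -> (e < D)%N.
Proof.
pose psi (x : 'I_D -> K) : 'rV[K]_D := \row_j x j.
apply: (@swept_dim_le _ _ _ psi (fun j => 'X_j)) => [x j|t x|L _ F _ F0 v _].
- by rewrite mxE mevalXU.
- by exists (fun j => t ^+ 3 * x j); apply/rowP=> j; rewrite !mxE.
rewrite -[RHS](F0 (fun j => v 0 j)); apply: meval_eq => j.
by rewrite mxE.
Qed.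

(** Multiply by the inverse of the leading 3 x 3 matrix. *)
Lemma reduced_point (p : point K) : volume p (0, 1, 2)%N != 0 ->
  exists q : point K,
    (forall r l, (r < 3)%N -> (l < 3)%N -> q r l = (r == l)%:R) /\
    forall t, volume p t = volume p (0, 1, 2)%N * volume q t.
Proof.
pose P : 'M[K]_3 := \matrix_(a, b) p a b.
have detP : \det P = volume p (0, 1, 2)%N.
  rewrite -det_volume; congr (\det _); apply/matrixP=> a b; rewrite !mxE.
  by case: b => [[|[|[|//]]] ?].
rewrite -detP => P0; have P_unit : P \in unitmx by rewrite unitmxE unitfE.
exists (fun r l => \sum_(a < 3) invmx P (inord r) a * p a l); split=> [r l r3 l3|[[i j] k]].
  have /matrixP/(_ (inord r) (inord l)) := mulVmx P_unit.
  rewrite !mxE -val_eqE /= !inordK // => <-.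
  by apply: eq_bigr => a _; rewrite mxE inordK.
rewrite -!det_volume -det_mulmx; congr (\det _); set Q := \matrix_(a, b) _.
have -> : \matrix_(a < 3, b < 3) (\sum_(a0 < 3) invmx P (inord a) a0
    * p a0 (nth 0%N [:: i; j; k] b)) = invmx P *m Q.
  by apply/matrixP=> a b; rewrite !mxE; apply: eq_bigr => c _; rewrite inord_val mxE.
by rewrite mulKVmx.
Qed.

Section Chart.
Variables (m s : nat).
Local Notation N := m.+4.
Local Notation T := ('I_s.+1 * option ('I_3 * 'I_m.+1))%type.
Local Notation D := (extdim N 3).
Local Notation wedge_sum := (@wedge_sum K N s.+1).

(** Multiples of the products given by reduced matrices (1 | A); the multiple is
    carried by the first row. *)
Definition chart (R : comNzRingType) (y : T -> R) (i : nat) : point R :=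
  fun r l => (if r == 0%N then y (inord i, None) else 1) *
    (if (l < 3)%N then (r == l)%:R else y (inord i, Some (inord r, inord (l - 3)))).

Lemma chart_surj pts : (forall i, (i < s.+1)%N -> volume (pts i) (0, 1, 2)%N != 0) ->
  exists y : T -> K, wedge_sum (chart y) = wedge_sum pts.
Proof.
move=> vol.
have [|q qP] := @choice _ _ (fun (i : 'I_s.+1) (q : point K) =>
  (forall r l, (r < 3)%N -> (l < 3)%N -> q r l = (r == l)%:R) /\
    forall t, volume (pts i) t = volume (pts i) (0, 1, 2)%N * volume q t).
  by move=> i; apply/reduced_point/vol.
exists (fun x : T => if x.2 is Some (a, b) then q x.1 a (b + 3)%N
                 else volume (pts x.1) (0, 1, 2)%N).
apply/rowP=> j; rewrite !mxE; apply: eq_bigr => i _.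
have [q_red ->] := qP i.
set c := volume (pts i) _.
rewrite (@eq_volume N _ (set_row (q i) 0 (fun l => c * q i 0%N l))) ?index_triple_below //.
  by case: (index_triple j) => [[a b] d]; rewrite /volume /det3 /set_row /=; ring.
move=> r l r3 lN; rewrite /chart /set_row !inord_val /= -/c.
have -> : (if (l < 3)%N then (r == l)%:R else q i (@inord 2 r) (@inord m (l - 3) + 3)%N) = q i r l.
  case: ifP => l3; first by rewrite q_red.
  by rewrite !inordK //; [rewrite subnK // leqNgt l3 | lia].
by case: eqP => [->|_]; rewrite ?mul1r.
Qed.

(** A configuration with a vanishing leading minor is the limit, on a line, of
    configurations in the chart. *)
Lemma swept_chart : swept wedge_sum `<=` swept (fun y : T -> K => wedge_sum (chart y)).
Proof.
move=> L SL F hF F0; apply: SL => // pts.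
pose star (r l : nat) : K := (r == l)%:R.
pose line i r l : {poly K} := (pts i r l)%:P + 'X * (star r l - pts i r l)%:P.
pose fam t i r l := pts i r l + t * (star r l - pts i r l).
have lineE t i r l : (line i r l).[t] = fam t i r l.
  by rewrite hornerD hornerM hornerX !hornerC.
have volE t i y : (volume (line i) y).[t] = volume (fam t i) y.
  rewrite -horner_evalE rmorph_volume; congr (volume _ _).
  by do 2 (apply/funext => ?); apply: lineE.
pose w (j : 'I_D) : {poly K} := \sum_(i < s.+1) volume (line i) (index_triple j).
have wE t j : (w j).[t] = wedge_sum (fam t) 0 j.
  by rewrite mxE horner_sum; apply: eq_bigr => i _; apply: volE.
pose g := \prod_(i < s.+1) volume (line i) (0, 1, 2)%N.
have g0 : g != 0.
  apply/prodf_neq0 => i _; apply: contra_neq (oner_neq0 K) => vol0.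
  have := volE 1 i (0, 1, 2)%N; rewrite vol0 horner0 => ->.
  by rewrite /volume /det3 /fam /star /=; ring.
have /eqP : g * curve_eval F w = 0.
  apply: poly_vanish => t; rewrite hornerM curve_evalE.
  have [->|gt] := eqVneq g.[t] 0; first by rewrite mul0r.
  have [|y yE] := @chart_surj (fam t).
    move=> i i_s; apply: contraNneq gt => voli.
    by rewrite horner_prod (bigD1 (Ordinal i_s)) //= volE voli mul0r.
  rewrite [X in _ * X](_ : _ = 0) ?mulr0 // -[RHS](F0 y); apply: meval_eq => j.
  by rewrite wE yE.
rewrite mulf_eq0 (negPf g0) /= => /eqP w0.
have := curve_evalE F w 0; rewrite w0 horner0 => E; rewrite [RHS]E; apply: meval_eq => j.
rewrite wE; congr (wedge_sum _ _ _); do 3 apply/funext=> ?.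
by rewrite /fam mul0r addr0.
Qed.

Lemma secant_dim_le e : irreducible_chain (swept wedge_sum) e ->
  (e < s.+1 * (3 * m.+1 + 1))%N.
Proof.
have cardT : #|{: T}| = (s.+1 * (3 * m.+1 + 1))%N.
  by rewrite card_prod card_option card_prod !card_ord addn1.
rewrite -cardT.
pose Y R (x : 'I_#|{: T}| -> R) (y : T) := x (enum_rank y).
pose psi (x : 'I_#|{: T}| -> K) := wedge_sum (chart (Y K x)).
pose P := chart (Y _ (fun i : 'I_#|{: T}| => 'X_i : {mpoly K[_]})).
apply: (@swept_dim_le K D _ psi (@wedge_poly K N s.+1 _ P) (swept wedge_sum)) => [x j|c x|].
- rewrite -wedge_polyE; congr (wedge_sum _ _ _); do 3 apply/funext=> ?.
  by rewrite /P /chart /Y mevalM; congr (_ * _); case: ifP => _;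
    rewrite ?mevalXU ?rmorph1 ?rmorph_nat.
- exists (fun i => (if (enum_val i).2 is None then c ^+ 3 else 1) * x i).
  apply/rowP=> j; rewrite !mxE mulr_sumr; apply: eq_bigr => i _.
  case: (index_triple j) => [[a b] d]; rewrite /volume /det3 /chart /Y !enum_rankK /=.
  by rewrite !mul1r; ring.
apply: subset_trans swept_chart _; apply: swept_mono => y.
exists (fun i => y (enum_val i)); congr (wedge_sum (chart _)).
by apply/funext=> u; rewrite /Y enum_rankK.
Qed.
End Chart.

(** The tangent vectors form a basis, so that there are curves in the image
    with every velocity, and no nonzero polynomial vanishes on the image. *)
Lemma generic_rank_fills N s : generic_rank_ge K N s (extdim N 3) -> (0 < s)%N -> (3 <= N)%N ->
  swept (@wedge_sum K N s) = setT.
Proof.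
move=> goodD s0 N3; have [pts [x [x_ok free _]]] := generic_rank_jacobian goodD s0 N3.
set B := \matrix_(a, j) _ in free; have B_unit : B \in unitmx by rewrite -row_free_unit.
apply/seteqP; split=> // L _ F _ F0 v _.
suff -> : F = 0 by rewrite meval0.
pose S (z : 'I_(extdim N 3) -> K) := exists pts', z = fun j => wedge_sum N s pts' 0 j.
apply: (@curves_determine _ _ S (wedge_sum N s pts 0)) => [u|_ [pts' ->]]; last exact: F0.
pose c := (\row_j u j) *m invmx B.
have [a [b abE]] := wedge_sum_line N s pts
  (fun i r l => \sum_k c 0 k * unit_direction K (x k) i r l).
exists (a 0), (b 0) => t.
exists (fun i r l => pts i r l + t * \sum_k c 0 k * unit_direction K (x k) i r l).
apply/funext=> j; rewrite abE directional_sum.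
have -> : \sum_k c 0 k *: directional N s pts (unit_direction K (x k)) = \row_j u j.
  rewrite -[RHS](mulmxKV B_unit) -/c [RHS]mulmx_sum_row; apply: eq_bigr => k _.
  have [xs x3] := x_ok k; rewrite directional_unit //; congr (_ *: _).
  by apply/rowP=> l; rewrite !mxE.
by rewrite !mxE.
Qed.
End Bounds.

(** The chain shows that r - 1 is at most either upper bound; so the minimum in
    [expected_dim] is r - 1. *)
Lemma generic_rank_dim (K : numFieldType) n s r :
    (9 <= n)%N -> (0 < s)%N -> generic_rank_ge K n.+1 s r ->
    (r = s * (3 * n - 5) \/ r = 'C(n.+1, 3))%N ->
  has_dim (secant s (Gr K 2 n)) (expected_dim s n).
Proof.
move=> n9 s0 goodr rE; have n2 : (2 <= n)%N by lia.
have r0 : (0 < r)%N by case: rE => ->; rewrite ?bin_gt0 ?muln_gt0 ?s0; lia.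
rewrite secant_swept //.
have le_ambient e : irreducible_chain (swept (@wedge_sum K n.+1 s)) e -> (e < 'C(n.+1, 3))%N.
  by move/ambient_dim_le; rewrite extdimE.
have le_chart e : irreducible_chain (swept (@wedge_sum K n.+1 s)) e -> (e < s * (3 * n - 5))%N.
  case: (n) (s) n9 s0 => [|[|[|m]]] // [|t] // n9 _ /secant_dim_le.
  by congr (_ < _)%N; lia.
have chain : irreducible_chain (swept (@wedge_sum K n.+1 s)) r.-1.
  by apply: wedge_sum_chain; rewrite ?prednK.
have dimE : expected_dim s n = r.-1.
  have := le_ambient _ chain; have := le_chart _ chain; rewrite /expected_dim.
  by case: rE => ->; lia.
split=> [|e chain_e]; rewrite dimE //.
have := le_ambient _ chain_e; have := le_chart _ chain_e.
by case: rE => ->; lia.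
Qed.

Theorem theorem1p5 (R : realType) (n s : nat) (hn : (9 <= n)%N)
    (hs : (1 <= s)%N) :
  (s%:Z <= s1 n -> has_dim (secant s (Gr R[i] 2 n)) (expected_dim s n)) /\
  (s2 n <= s%:Z -> has_dim (secant s (Gr R[i] 2 n)) (expected_dim s n) /\
                   secant s (Gr R[i] 2 n) = setT).
Proof.
have n3 : (3 <= n.+1)%N by lia.
split=> [le_s1|le_s2].
  have [s1_ge0 ind] := independent_s1 R[i] hn.
  have : independent_at R[i] n.+1 s by apply: (independent_fewer n3) ind; lia.
  by move/(generic_rank_dim hn hs); apply; left; congr (_ * _)%N; lia.
have [s2_ge0 span] := spanning_s2 R[i] hn.
have good_s : spanning_at R[i] n.+1 s by apply: spanning_more span; rewrite -lez_nat gez0_abs.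
split; first by apply: (generic_rank_dim hn hs good_s); right.
have n2 : (2 <= n)%N by lia.
rewrite secant_swept //.
by apply: generic_rank_fills => //; rewrite extdimE.
Qed.
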